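(* The symmetry superalgebra of any odd-contact $F(4)$-supergeometry $(M^{1|8},\mathcal C,[\mathsf Q])$ satisfies $$\dim\mathfrak{inf}(M,\mathcal C,[\mathsf Q])\le\dim F(4)=(24|16).$$
   Context: Everything is over $\mathbb C$. $F(4)$ is the exceptional simple Lie superalgebra of dimension $(24|16)$. An inequality of superdimensions means that the even and the odd dimensions are respectively bounded. A contact supermanifold $(M^{1|8},\mathcal C)$ is a supermanifold of dimension $(1|8)$ with a maximally non-integrable superdistribution $\mathcal C$ of rank $(0|8)$: locally $\mathcal C=\ker\sigma$ with $\sigma$ an even 1-form and $d\sigma|_{\mathcal C}$ non-degenerate. A collection $\{\omega^i,\theta_i\}_{i=0}^3$ of odd 1-forms on $M$ is a local conformal coframe of $\mathcal C$ if $d\sigma=\lambda\sum_i\omega^i\wedge\theta_i$ on $\mathcal C$ for some even invertible superfunction $\lambda$ ($\wedge$ is skew in the super-sense, i.e. symmetric here). Given such a coframe, define the even supersymmetric 4-tensor on $\mathcal C$ (restrictions to $\mathcal C$ omitted) $$\begin{aligned}\mathsf Q&=\omega^0\omega^1\theta_0\theta_1+\omega^0\omega^2\theta_0\theta_2+\omega^0\omega^3\theta_0\theta_3-2\omega^0\theta_1\theta_2\theta_3\\&\quad-\omega^1\omega^2\theta_1\theta_2-\omega^1\omega^3\theta_1\theta_3-\omega^2\omega^3\theta_2\theta_3+2\omega^1\omega^2\omega^3\theta_0\ \in\Gamma(\odot^4\mathcal C^* )\end{aligned}$$ (the product is supersymmetric; since $\mathcal C$ is generated by odd supervector fields, $\mathsf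 Q$ is skew in the classical sense on these generators). An odd-contact $F(4)$-supergeometry $(M^{1|8},\mathcal C,[\mathsf Q])$ is a contact supermanifold $(M^{1|8},\mathcal C)$ of dimension $(1|8)$, with contact superdistribution $\mathcal C$ of rank $(0|8)$, equipped with a conformal class $[\mathsf Q]$ of a quartic tensor $\mathsf Q\in\Gamma(\odot^4\mathcal C^* )$ that is locally of the form $\mathsf Q=\omega^0\omega^1\theta_0\theta_1+\omega^0\omega^2\theta_0\theta_2+\omega^0\omega^3\theta_0\theta_3-2\omega^0\theta_1\theta_2\theta_3-\omega^1\omega^2\theta_1\theta_2-\omega^1\omega^3\theta_1\theta_3-\omega^2\omega^3\theta_2\theta_3+2\omega^1\omega^2\omega^3\theta_0$ for some local conformal coframe $\{\omega^i,\theta_i\}_{i=0}^3$ of $\mathcal C$. Its symmetry superalgebra is $\mathfrak{inf}(M,\mathcal C,[\mathsf Q])=\{\mathbf X\in\mathfrak X(M):\mathcal L_{\mathbf X}\mathcal C\subset\mathcal C,\ \exists\,\mu\text{ with }\mathcal L_{\mathbf X}\mathsf Q=\mu\mathsf Q\text{ on }\mathcal C\}$.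
   Formalization: M is assumed connected: for a disconnected M, such as two disjoint copies of the flat model, the global symmetry superalgebra is a product over the components, of dimension (48|32), and the stated bound fails. *)

(* Defs.v *)
From HB Require Import structures.
From mathcomp Require Import all_boot all_order all_algebra all_fingroup.
From mathcomp Require Import complex.
From mathcomp Require Import all_classical all_reals all_analysis.
Set Implicit Arguments.
Unset Strict Implicit.
Unset Printing Implicit Defensive.
Import Order.TTheory GRing.Theory Num.Theory.
Import numFieldNormedType.Exports.
Local Open Scope classical_set_scope.
Local Open Scope ring_scope.

(* The topology on C is the one of a numFieldType, given by the modulus. *)
Definition Cx (R : realType) : numClosedFieldType := R[i].

Definition holomorphic_on (R : realType) (V : set (Cx R)) (f : Cx R -> Cx R) :=
  forall z0, V z0 -> exists a : nat -> Cx R,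
    \forall z \near z0,
      series (fun n => a n * (z - z0) ^+ n) @ \oo --> f z.

(* Superfunctions on a domain of C^{1|n} are written \sum_I f_I(z) xi_I, with
   xi_I the product of the odd coordinates xi_i, i in I, in increasing order. *)
Section Grassmann.
Variables (R : realType) (n : nat).

Definition grassmann_sign (J K : {set 'I_n}) : Cx R :=
  (-1) ^+ #|[pred jk : 'I_n * 'I_n |
              [&& jk.1 \in J, jk.2 \in K & (jk.2 < jk.1)%N]]|.

Definition grassmann_mul (f g : {set 'I_n} -> Cx R -> Cx R)
    (I : {set 'I_n}) (z : Cx R) : Cx R :=
  \sum_(J : {set 'I_n} | J \subset I)
    grassmann_sign J (I :\: J) * f J z * g (I :\: J) z.

End Grassmann.

(* Parities are booleans (true = odd). Sections and restriction maps are total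
   in the sets involved, but are only constrained on (included) open sets. *)
Record superspace (R : realType) := Superspace {
  body :> topologicalType;
  sfun : set body -> pzRingType;
  csec : forall U : set body, {rmorphism Cx R -> sfun U};
  par : forall U : set body, bool -> sfun U -> Prop;
  res : forall U V : set body, sfun U -> sfun V }.

Arguments csec {R s} U.
Arguments par {R s} U p f.
Arguments res {R s} U V f.

Section Superspaces.
Variables (R : realType) (M : superspace R).
Implicit Types (U V W : set M) (p q r : bool).

Definition supercommutative_algebra U :=
  [/\ forall c, par U false (csec U c),
      forall p f g, par U p f -> par U p g -> par U p (f - g),
      forall p q f g, par U p f -> par U q g -> par U (p (+) q) (f * g),
      forall f, exists! fg : sfun U * sfun U,
        [/\ par U false fg.1, par U true fg.2 & f = fg.1 + fg.2]
    & forall p q f g, par U p f -> par U q g ->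
        g * f = (-1) ^+ (p && q) * (f * g)].

Definition restriction_morphism U V :=
  [/\ forall f g : sfun U, res U V (f + g) = res U V f + res U V g,
      forall f g : sfun U, res U V (f * g) = res U V f * res U V g,
      forall c, res U V (csec U c) = csec V c
    & forall p f, par U p f -> par V p (res U V f)].

Definition presheaf_of_superalgebras :=
  [/\ forall U, open U -> supercommutative_algebra U,
      forall U V, open U -> open V -> V `<=` U -> restriction_morphism U V,
      forall U f, open U -> res U U f = f
    & forall U V W f, open U -> open V -> open W -> V `<=` U -> W `<=` V ->
        res V W (res U V f) = res U W f].

Definition sheaf_condition :=
  forall F : set (set M), (forall V, F V -> open V) ->
  let U := \bigcup_(V in F) V in
  forall s : (forall V, sfun V),
    (forall V W, F V -> F W -> res V (V `&` W) (s V) = res W (V `&` W) (s W)) ->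
  exists! f : sfun U, forall V, F V -> res U V f = s V.

(* phi and Phi form an isomorphism of the restriction of M to U with a domain
   of C^{1|n}; Phi W f I is the coefficient of xi_I, only meaningful on
   phi @` W. *)
Definition superchart n U (phi : M -> Cx R)
    (Phi : forall W, sfun W -> {set 'I_n} -> Cx R -> Cx R) :=
  [/\ open U,
      {in U &, injective phi},
      (forall V : set (Cx R), open V -> open (U `&` phi @^-1` V)),
      (forall W, open W -> W `<=` U -> open (phi @` W))
    & forall W, open W -> W `<=` U ->
      let eqW (a b : Cx R -> Cx R) := forall z, (phi @` W) z -> a z = b z in
      [/\ (forall f I, holomorphic_on (phi @` W) (Phi W f I)) /\
            (forall a : {set 'I_n} -> Cx R -> Cx R,
              (forall I, holomorphic_on (phi @` W) (a I)) ->
              exists! f, forall I, eqW (Phi W f I) (a I)),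
          (forall f g I,
            eqW (Phi W (f + g) I) (fun z => Phi W f I z + Phi W g I z)) /\
            (forall f g I,
              eqW (Phi W (f * g) I) (grassmann_mul (Phi W f) (Phi W g) I)),
          (forall c I,
            eqW (Phi W (csec W c) I) (fun=> if I == finset.set0 then c else 0)),
          (forall p f, par W p f <->
            forall I : {set 'I_n}, odd #|I| != p -> eqW (Phi W f I) (fun=> 0))
        & (forall V f I, open V -> V `<=` W ->
            forall z, (phi @` V) z -> Phi V (res W V f) I z = Phi W f I z)]].

Definition is_supermanifold n :=
  [/\ hausdorff_space M /\ @second_countable M,
      presheaf_of_superalgebras,
      sheaf_condition
    & forall x : M, exists U phi Phi, U x /\ @superchart n U phi Phi].

(* Vector fields are derivations of the structure sheaf. All the objects below
   are evaluated on homogeneous vector fields only, to which they extend by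
   additivity. *)
Definition op := forall W : set M, sfun W -> sfun W.

Definition agree U (X Y : op) :=
  forall W, open W -> W `<=` U -> forall f, X W f = Y W f.

Definition is_vf U p (X : op) :=
  forall W, open W -> W `<=` U ->
  [/\ forall f g, X W (f + g) = X W f + X W g,
      forall c f, X W (csec W c * f) = csec W c * X W f,
      forall q f, par W q f -> par W (p (+) q) (X W f),
      forall q f g, par W q f ->
        X W (f * g) = X W f * g + (-1) ^+ (p && q) * (f * X W g)
    & forall V f, open V -> V `<=` W -> res W V (X W f) = X V (res W V f)].

Definition vf_add (X Y : op) : op := fun W f => X W f + Y W f.

Definition vf_smul U (f : sfun U) (X : op) : op :=
  fun W g => res U W f * X W g.

Definition bracket p q (X Y : op) : op :=
  fun W f => X W (Y W f) - (-1) ^+ (p && q) * Y W (X W f).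

(* E stands for a subsheaf of TM: E U X says that X is a section over U. *)
Definition tangent : set M -> op -> Prop := fun _ _ => True.

Definition section (E : set M -> op -> Prop) U p (X : op) :=
  is_vf U p X /\ E U X.

(* Homogeneous sections of the dual of E over U; 1-forms when E = TM. *)
Definition cofield := forall W : set M, op -> sfun W.

Definition is_cofield (E : set M -> op -> Prop) U q (al : cofield) :=
  forall W, open W -> W `<=` U ->
  [/\ forall p X Y, section E W p X -> section E W p Y -> agree W X Y ->
        al W X = al W Y,
      forall p X V, section E W p X -> open V -> V `<=` W ->
        res W V (al W X) = al V X,
      forall p X, section E W p X -> par W (p (+) q) (al W X),
      forall p X Y, section E W p X -> section E W p Y ->
        al W (vf_add X Y) = al W X + al W Y
    & forall p r f X, section E W p X -> par W r f ->
        al W (vf_smul f X) = (-1) ^+ (q && r) * (f * al W X)].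

Definition even_form_d (sg : cofield) p q (X Y : op) W : sfun W :=
  X W (sg W Y) - (-1) ^+ (p && q) * Y W (sg W X) - sg W (bracket p q X Y).

(* al /\ be = al (x) be + be (x) al for odd al and be; the sign comes from
   moving be past X. *)
Definition odd_wedge (al be : cofield) p (X Y : op) W : sfun W :=
  (-1) ^+ p * (al W X * be W Y + be W X * al W Y).

Definition superdistribution := set M -> op -> Prop.

Definition vf_frame n U (T : op) (D : 'I_n -> op) :=
  [/\ is_vf U false T, forall i, is_vf U true (D i)
    & forall W p X, open W -> W `<=` U -> is_vf W p X ->
      exists! af : sfun W * ('I_n -> sfun W),
        agree W X (fun V g => res W V af.1 * T V g
                              + \sum_i res W V (af.2 i) * D i V g)].

(* A subsheaf of TM which is locally a direct summand, free of rank (0|n). *)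
Definition has_odd_rank n (C : superdistribution) :=
  (forall W p X, open W -> is_vf W p X ->
     (C W X <-> forall x, W x ->
                  exists V, [/\ open V, V x, V `<=` W & C V X])) /\
  (forall x : M, exists U T (D : 'I_n -> op),
     [/\ open U, U x, vf_frame U T D
       & forall W p X, open W -> W `<=` U -> is_vf W p X ->
           (C W X <-> exists f : 'I_n -> sfun W,
              agree W X (fun V g => \sum_i res W V (f i) * D i V g))]).

(* X |-> d sg (X, -) is an isomorphism from C onto its dual, over U. *)
Definition d_nondegenerate (C : superdistribution) U (sg : cofield) :=
  forall W q al, open W -> W `<=` U -> is_cofield C W q al ->
  let dual_to X := section C W q X /\
    (forall V p Y, open V -> V `<=` W -> section C V p Y ->
       even_form_d sg q p X Y V = al V Y) in
  exists2 X, dual_to X & forall X', dual_to X' -> agree W X X'.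

Definition contact_form (C : superdistribution) U (sg : cofield) :=
  [/\ is_cofield tangent U false sg,
      forall W p X, open W -> W `<=` U -> is_vf W p X ->
        (C W X <-> sg W X = 0)
    & d_nondegenerate C U sg].

Definition contact n (C : superdistribution) :=
  has_odd_rank n C /\
  forall x : M, exists U sg, [/\ open U, U x & contact_form C U sg].

Definition conformal_coframe (C : superdistribution) U (om th : 'I_4 -> cofield) :=
  (forall i, is_cofield tangent U true (om i) /\
             is_cofield tangent U true (th i)) /\
  exists sg (la la' : sfun U),
    [/\ contact_form C U sg, par U false la, la * la' = 1
      & forall W p q X Y, open W -> W `<=` U ->
          section C W p X -> section C W q Y ->
          even_form_d sg p q X Y W =
          res U W la * \sum_(i < 4) odd_wedge (om i) (th i) p X Y W].

Definition tensor4 := forall W : set M, ('I_4 -> op) -> sfun W.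

Definition subst_at (Y : 'I_4 -> op) (i : 'I_4) (X : op) : 'I_4 -> op :=
  fun j => if j == i then X else Y j.

Definition par_before (p : 'I_4 -> bool) (i : 'I_4) : nat :=
  \sum_(j < 4 | (j < i)%N) p j.

(* Even global sections of the fourth supersymmetric power of the dual of C. *)
Definition is_even_supersym4 (C : superdistribution) (Q : tensor4) :=
  forall W (p : 'I_4 -> bool) (Y : 'I_4 -> op), open W ->
    (forall i, section C W (p i) (Y i)) ->
  [/\ forall Z, (forall i, section C W (p i) (Z i)) ->
        (forall i, agree W (Y i) (Z i)) -> Q W Y = Q W Z,
      forall V, open V -> V `<=` W -> res W V (Q W Y) = Q V Y,
      par W (odd (\sum_i p i)) (Q W Y),
      (forall i X, section C W (p i) X ->
        Q W (subst_at Y i (vf_add (Y i) X)) = Q W Y + Q W (subst_at Y i X)) /\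
      (forall i r f, par W r f ->
        Q W (subst_at Y i (vf_smul f (Y i))) =
        (-1) ^+ (r * par_before p i) * (f * Q W Y))
    & forall i j : 'I_4, j = i.+1 :> nat ->
        Q W (Y \o tperm i j) = (-1) ^+ (p i && p j) * Q W Y].

(* Supersymmetric product of four odd cofields, evaluated at Y_0, ..., Y_3 of
   parities p_0, ..., p_3: the product is skew in the cofields, and moving the
   j-th cofield past the Y_i with i < j gives the other sign. *)
Definition odd_prod4 (al : 4.-tuple cofield) W (p : 'I_4 -> bool)
    (Y : 'I_4 -> op) : sfun W :=
  (-1) ^+ (\sum_j par_before p j) *
  \sum_(s : 'S_4) (-1) ^+ s * \prod_(i < 4) tnth al (s i) W (Y i).

Definition F4_quartic (om th : 'I_4 -> cofield) W (p : 'I_4 -> bool)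
    (Y : 'I_4 -> op) : sfun W :=
  let o k := om (inord k) in
  let t k := th (inord k) in
  let m a b c d := odd_prod4 [tuple a; b; c; d] W p Y in
  m (o 0) (o 1) (t 0) (t 1) + m (o 0) (o 2) (t 0) (t 2)
  + m (o 0) (o 3) (t 0) (t 3) - m (o 0) (t 1) (t 2) (t 3) *+ 2
  - m (o 1) (o 2) (t 1) (t 2) - m (o 1) (o 3) (t 1) (t 3)
  - m (o 2) (o 3) (t 2) (t 3) + m (o 1) (o 2) (o 3) (t 0) *+ 2.

(* The conformal class is given by a representative Q. *)
Definition odd_contact_F4 (C : superdistribution) (Q : tensor4) :=
  [/\ contact 8 C, is_even_supersym4 C Q
    & forall x : M, exists U om th,
      [/\ open U, U x, conformal_coframe C U om th
        & forall W (p : 'I_4 -> bool) (Y : 'I_4 -> op),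
            open W -> W `<=` U -> (forall i, section C W (p i) (Y i)) ->
            Q W Y = F4_quartic om th W p Y]].

Definition lie_tensor4 q (X : op) (Q : tensor4) W (p : 'I_4 -> bool)
    (Y : 'I_4 -> op) : sfun W :=
  X W (Q W Y) -
  \sum_(i < 4) (-1) ^+ (q * par_before p i) *
     Q W (subst_at Y i (bracket q (p i) X (Y i))).

(* The component of parity q of the symmetry superalgebra. *)
Definition symmetry (C : superdistribution) (Q : tensor4) q (X : op) :=
  [/\ is_vf setT q X,
      forall W p Y, open W -> section C W p Y -> C W (bracket q p X Y)
    & exists mu : sfun (setT : set M),
        forall W (p : 'I_4 -> bool) (Y : 'I_4 -> op),
          open W -> (forall i, section C W (p i) (Y i)) ->
          lie_tensor4 q X Q W p Y = res setT W mu * Q W Y].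

Definition dim_le (S : op -> Prop) (d : nat) :=
  exists v : 'I_d -> op, (forall i, S (v i)) /\
    forall X, S X -> exists c : 'I_d -> Cx R,
      agree setT X (fun W f => \sum_i csec W (c i) * v i W f).

Definition sdim_le (S : bool -> op -> Prop) (d : nat * nat) :=
  dim_le (S false) d.1 /\ dim_le (S true) d.2.

End Superspaces.

(* (even, odd) dimension of the simple Lie superalgebra F(4). *)
Definition sdim_F4 : nat * nat := (24, 16).

(* Main.v *)
From HB Require Import structures.
From mathcomp Require Import all_boot all_order all_algebra all_fingroup.
From mathcomp Require Import complex ring.
From mathcomp Require Import all_classical all_reals all_analysis.
Require Import Defs.

(** Why the bound holds. Near a point x choose a frame T, D_0, ..., D_7 of the
tangent sheaf whose odd part spans C and is dual at x to the given conformal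
coframe, and write a symmetry as X = a T + sum_i b_i D_i. Since the Levi form
of C is nondegenerate, the condition [X, C] in C expresses the b_i by the
derivatives D_j a, up to lower-order terms; the condition L_X Q = mu Q then
says that the matrix of second derivatives of a is, again up to lower-order
terms, in the conformal stabiliser of the quartic form. So X is controlled by
the function a, and the proof counts how many derivatives of a at x are free.

For a word w = i_1 ... i_k call the value at x of D_(i_1) ... D_(i_k) a the
symbol of a at w. If all symbols of length less than k vanish, those of length
k satisfy linear relations with constant coefficients (symbol_flat): Clifford
relations in any two adjacent letters, because D_i D_j + D_j D_i is H_ij T
modulo the D_k, and seven relations in the last two letters, which cut out
so(7) + C in so(8) + C and are computed from the quartic in stab_spin7. These
are the relations of the flat model, in which the symbols of lengths
0, 1, 2, 3, 4 depend on 1, 8, 22, 8, 1 parameters and all longer ones are zero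
(flat_ge5_eq0): these are the dimensions of the grading of F(4) of depth two.
As a has the parity of X, and a symbol is zero unless the parity of its length
is that of a, an even X is left with 1 + 22 + 1 = 24 symbols and an odd one
with 8 + 8 = 16. If these vanish, all symbols of a vanish
(determining_words_eq0), and so do those of the b_i.

A function all of whose symbols at x vanish is killed at x by every iterated
derivation: T is a combination of brackets of the D_i, and the coordinate
fields are combinations of T and the D_i. Its Taylor coefficients in a
superchart are then zero, so it vanishes near x (infinite_order_zero).
Conversely the coefficients of a field that vanishes on no neighbourhood of x
have a nonzero symbol, and a symbol that is nonzero at x is nonzero nearby; hence the set of
points near which X vanishes is open and closed, and X = 0 as M is connected
(identity_theorem). The list of the 24 or 16 symbols is therefore an injective
linear map on symmetries, which bounds their dimension (dim_le_functional). *)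

Set Implicit Arguments.
Unset Strict Implicit.
Unset Printing Implicit Defensive.
Import Order.TTheory GRing.Theory Num.Theory.
Import numFieldNormedType.Exports.
Local Open Scope classical_set_scope.
Local Open Scope ring_scope.

(** * The relations between symbols in the flat model *)

(** The letters 0, ..., 7 index a frame of C dual to the coframe
(om_0, ..., om_3, th_0, ..., th_3): the Levi form pairs i with i + 4. *)
Definition dual (a : 'I_8) : 'I_8 := inZp (a + 4).
Definition levi (a b : 'I_8) : bool := b == dual a.
Arguments levi : simpl never.

(** The quartic singles out the pair 0, 4 and is symmetric under cyclic
permutations of the three other pairs and under the exchange of the two halves of
the coframe. Writing the letters as zz c, for 0 and 4, and yy c i,
for i + 1 and i + 5, makes both symmetries visible: every argument below is made
once for all halves c and all i modulo 3. Below, E_0, E_i and F_0, F_i abbreviate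
zz c, yy c i and zz (~~ c), yy (~~ c) i. *)
Definition zz (c : bool) : 'I_8 := inZp (4 * c).
Definition yy (c : bool) (i : 'I_3) : 'I_8 := inZp (i.+1 + 4 * c).

Lemma levi_zz c d : levi (zz c) (zz d) = (c != d).
Proof. by case: c; case: d. Qed.

Lemma levi_zy c d i : levi (zz c) (yy d i) = false.
Proof. by case: c; case: d; case: i => [[|[|[|]]] ?]. Qed.

Lemma levi_yz c d i : levi (yy d i) (zz c) = false.
Proof. by case: c; case: d; case: i => [[|[|[|]]] ?]. Qed.

Lemma levi_yy c d i j : levi (yy c i) (yy d j) = (c != d) && (i == j).
Proof.
by case: c; case: d; case: i => [[|[|[|]]] ?]; case: j => [[|[|[|]]] ?].
Qed.

Lemma letterP (a : 'I_8) : (exists c, a = zz c) \/ (exists c i, a = yy c i).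
Proof.
case: a => [[|[|[|[|[|[|[|[|n]]]]]]]] lt_n] //; first by left; exists false; apply: val_inj.
- by right; exists false, (inZp 0); apply: val_inj.
- by right; exists false, (inZp 1); apply: val_inj.
- by right; exists false, (inZp 2); apply: val_inj.
- by left; exists true; apply: val_inj.
- by right; exists true, (inZp 0); apply: val_inj.
- by right; exists true, (inZp 1); apply: val_inj.
- by right; exists true, (inZp 2); apply: val_inj.
Qed.

Definition leviE := (levi_zz, levi_zy, levi_yz, levi_yy).

Lemma I3_case (i j : 'I_3) : [\/ j = i, j = i + 1 | j = i + 1 + 1].
Proof.
case: i => [[|[|[|]]] ?] //; case: j => [[|[|[|]]] ?] //;
  by [constructor 1; apply: val_inj | constructor 2; apply: val_inj
     | constructor 3; apply: val_inj].
Qed.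

Lemma I3_add3 (i : 'I_3) : i + 1 + 1 + 1 = i.
Proof. by apply/eqP; case: i => [[|[|[|]]] ?]. Qed.

Lemma I3_neq1 (i : 'I_3) : (i == i + 1) = false.
Proof. by case: i => [[|[|[|]]] ?]. Qed.
Lemma I3_neq2 (i : 'I_3) : (i == i + 1 + 1) = false.
Proof. by case: i => [[|[|[|]]] ?]. Qed.
Lemma I3_neq1' (i : 'I_3) : (i + 1 == i) = false.
Proof. by case: i => [[|[|[|]]] ?]. Qed.
Lemma I3_neq2' (i : 'I_3) : (i + 1 + 1 == i) = false.
Proof. by case: i => [[|[|[|]]] ?]. Qed.
Lemma I3_neq12 (i : 'I_3) : (i + 1 == i + 1 + 1) = false.
Proof. by case: i => [[|[|[|]]] ?]. Qed.
Lemma I3_neq21 (i : 'I_3) : (i + 1 + 1 == i + 1) = false.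
Proof. by case: i => [[|[|[|]]] ?]. Qed.
Definition I3E := (I3_neq1, I3_neq2, I3_neq1', I3_neq2', I3_neq12, I3_neq21).

Section LC.
Variable K : numFieldType.
(** lc1 and lc2 prove an equation from a certificate: the difference of its sides
is a given linear combination of the differences of the sides of known equations. *)
Lemma lc1 (x y l1 r1 c1 : K) : l1 = r1 -> x - y = c1 * (l1 - r1) -> x = y.
Proof. by move=> -> /eqP; rewrite subrr mulr0 subr_eq0 => /eqP. Qed.
Lemma lc2 (x y l1 r1 l2 r2 c1 c2 : K) : l1 = r1 -> l2 = r2 ->
  x - y = c1 * (l1 - r1) + c2 * (l2 - r2) -> x = y.
Proof. by move=> -> -> /eqP; rewrite !subrr !mulr0 addr0 subr_eq0 => /eqP. Qed.

End LC.

Section Flat.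
Variable K : numFieldType.
Implicit Types (s t : seq 'I_8 -> K) (u v w : seq 'I_8) (c : bool) (i : 'I_3).

(** The functions s and t are the symbols of a of lengths k and k - 2: exchanging
adjacent letters of a word produces the derivative along the transverse field,
which is central at the level of symbols, so t does not see where the pair stood. *)
Definition clifford k s t := forall u v a b, (size u + size v).+2 = k ->
  s (u ++ a :: b :: v) + s (u ++ b :: a :: v) = (levi a b)%:R * t (u ++ v).

(** The seven equations that cut out, among the matrices S whose symmetric part is
a multiple of the Levi form, the conformal stabiliser of the quartic. That
stabiliser is so(7) + C in its spin representation: 29 - 7 = 22. *)
Definition spin7 (S : 'I_8 -> 'I_8 -> K) :=
  (forall c i, S (zz c) (yy (~~ c) i) = - S (yy c (i + 1)) (yy c (i + 1 + 1))) /\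
  S (zz false) (zz true) - S (zz true) (zz false) =
    \sum_(i < 3) (S (yy false i) (yy true i) - S (yy true i) (yy false i)).

Definition flat k s t := clifford k s t /\
  forall u, (size u).+2 = k -> spin7 (fun a b => s (u ++ [:: a; b])).

Lemma flat_cons k s t a : flat k.+1 s t -> flat k (s \o cons a) (t \o cons a).
Proof.
case=> cl sp; split=> [u v b c sz|u sz] /=.
  by rewrite -!cat_cons cl //= addSn sz.
by apply: (sp (a :: u)); rewrite /= sz.
Qed.

Lemma spin7D S S' : spin7 S -> spin7 S' -> spin7 (fun a b => S a b + S' a b).
Proof.
move=> [s1 s2] [s1' s2']; split=> [c i|]; first by rewrite s1 s1' opprD.
rewrite opprD addrACA s2 s2' -big_split /=.
by apply: eq_bigr => i _; rewrite opprD addrACA.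
Qed.

(** The pair of letters contracted to form t may be placed in front of a word, so
t inherits from s the relations in the last two letters. *)
Lemma flat_tau k s t : flat k.+2 s t -> exists t', flat k t t'.
Proof.
case=> cl sp; exists (fun w => t [:: zz false, zz true & w] + t [:: zz true, zz false & w]).
have tE w : size w = k -> t w = s [:: zz false, zz true & w] + s [:: zz true, zz false & w].
  by move=> sz; rewrite (cl [::] w) ?leviE ?mul1r //= sz.
split=> [u v a b sz|u sz].
  rewrite (tE (u ++ [:: a, b & v])) ?size_cat /= ?addnS //.
  rewrite (tE (u ++ [:: b, a & v])) ?size_cat /= ?addnS // addrACA.
  have cl2 x y : s [:: x, y & u ++ [:: a, b & v]] + s [:: x, y & u ++ [:: b, a & v]]
      = (levi a b)%:R * t [:: x, y & u ++ v].
    by apply: (cl [:: x, y & u] v); rewrite /= !addSn sz.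
  by rewrite !cl2 mulrDr.
have [s1 s2] := spin7D (sp [:: zz false, zz true & u] (congr1 (addn 2) sz))
  (sp [:: zz true, zz false & u] (congr1 (addn 2) sz)).
have tE2 a b : t (u ++ [:: a; b]) = s [:: zz false, zz true & u ++ [:: a; b]] +
    s [:: zz true, zz false & u ++ [:: a; b]] by rewrite tE // size_cat addn2.
split=> [c i|]; first by rewrite !tE2 s1.
by rewrite !tE2 s2; apply: eq_bigr => i _; rewrite !tE2.
Qed.

Lemma sum_cyclic3 (F : 'I_3 -> K) i : \sum_(j < 3) F j = F i + F (i + 1) + F (i + 1 + 1).
Proof.
rewrite !big_ord_recl big_ord0 addr0 /=.
case: i => [[|[|[|]]] ?] //=.
- by rewrite addrA; congr (F _ + F _ + F _); apply: val_inj.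
- rewrite addrA [RHS]addrC addrA.
  by congr (F _ + F _ + F _); apply: val_inj.
- rewrite addrA -[RHS]addrA [RHS]addrC.
  by congr (F _ + F _ + F _); apply: val_inj.
Qed.

Lemma double_eq0 (x : K) : x + x = 0 -> x = 0.
Proof. by move=> /eqP; rewrite -mulr2n mulrn_eq0 /= => /eqP. Qed.

Section Degree3.
Variables (s t : seq 'I_8 -> K).
Hypothesis fl : flat 3 s t.

Lemma acomm12 a b (e : 'I_8) : s [:: a; b; e] + s [:: b; a; e] = (levi a b)%:R * t [:: e].
Proof. exact: (fl.1 [::] [:: e] a b erefl). Qed.

Lemma acomm23 a b (e : 'I_8) : s [:: a; b; e] + s [:: a; e; b] = (levi b e)%:R * t [:: a].
Proof. exact: (fl.1 [:: a] [::] b e erefl). Qed.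

Lemma levi_refl a : levi a a = false.
Proof. by case: (letterP a) => [[c ->]|[c [i ->]]]; rewrite leviE eqxx. Qed.

Lemma sq12 a b : s [:: a; a; b] = 0.
Proof. by apply: double_eq0; rewrite acomm12 levi_refl mul0r. Qed.

Lemma sq23 a b : s [:: a; b; b] = 0.
Proof. by apply: double_eq0; rewrite acomm23 levi_refl mul0r. Qed.

Lemma swap12 a b (e : 'I_8) : levi a b = false -> s [:: a; b; e] = - s [:: b; a; e].
Proof. by move=> ab; apply/eqP; rewrite -addr_eq0 acomm12 ab mul0r. Qed.

Lemma swap23 a b (e : 'I_8) : levi b e = false -> s [:: a; b; e] = - s [:: a; e; b].
Proof. by move=> ab; apply/eqP; rewrite -addr_eq0 acomm23 ab mul0r. Qed.

Lemma flat3_zy x c i :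
  s [:: x; zz c; yy (~~ c) i] = - s [:: x; yy c (i + 1); yy c (i + 1 + 1)].
Proof. exact: (fl.2 [:: x] erefl).1. Qed.

Lemma flat3_trace x c : s [:: x; zz c; zz (~~ c)] - s [:: x; zz (~~ c); zz c] =
  \sum_(i < 3) (s [:: x; yy c i; yy (~~ c) i] - s [:: x; yy (~~ c) i; yy c i]).
Proof.
have := (fl.2 [:: x] erefl).2 => /=.
case: c => //= /(congr1 -%R); rewrite opprB => ->.
by rewrite -sumrN; apply: eq_bigr => i _; rewrite opprB.
Qed.

(** By the relations E_0 F_i = - E_j E_k of the last two letters, where i, j, k is a
cyclic permutation of the indices, each word
E_0 E_i F_i equals E_1 E_2 E_3, which is cyclically symmetric; so the three
values agree, and the trace relation makes each of them a third of t. *)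
Lemma deg3_zyy c i : s [:: zz c; yy c i; yy (~~ c) i] = t [:: zz c] / 3%:R.
Proof.
have neq (d : bool) : (d != d) = false by rewrite eqxx.
pose Y j := s [:: yy c j; yy c (j + 1); yy c (j + 1 + 1)].
have step j : Y (j + 1) = Y j.
  by rewrite /Y I3_add3 [RHS]swap12 ?leviE ?neq // [in RHS]swap23 ?leviE ?neq // opprK.
have yyyE j : Y j = Y i by case: (I3_case i j) => ->; rewrite ?step.
have zyyE j : s [:: zz c; yy c j; yy (~~ c) j] = Y i.
  by rewrite swap12 ?leviE // flat3_zy opprK -(yyyE j).
have := flat3_trace (zz c) c.
under eq_bigr => j _.
  have -> : s [:: zz c; yy (~~ c) j; yy c j] = t [:: zz c] - Y i.
    by rewrite -(zyyE j); apply: (lc1 (c1 := 1) (acomm23 (zz c) (yy c j) (yy (~~ c) j)));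
       rewrite leviE eqxx andbT; case: (c); rewrite /= ?mul1r; ring.
  rewrite zyyE; over.
rewrite sq12 sumr_const card_ord zyyE => tr.
have tE : s [:: zz c; zz (~~ c); zz c] = t [:: zz c].
  by have := acomm12 (zz c) (zz (~~ c)) (zz c); rewrite sq23 addr0 leviE; case: (c); rewrite mul1r.
by apply: (lc1 (c1 := - 6%:R^-1) tr); rewrite tE; field.
Qed.

(** The three words of this kind with a given last letter are related in pairs by
two uses of the relations of the last two letters. Their common value W is then
found from the trace relation, in which the term of index i gives t, and those of
the two other indices 2 W - t. *)
Lemma deg3_zzy_yyy c i j (ji : j != i) :
  s [:: zz (~~ c); zz c; yy (~~ c) i] = t [:: yy (~~ c) i] / 3%:R /\
  s [:: yy c j; yy (~~ c) j; yy (~~ c) i] = t [:: yy (~~ c) i] / 3%:R.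
Proof.
have neq (d : bool) : (d != d) = false by rewrite eqxx.
pose W := s [:: zz (~~ c); zz c; yy (~~ c) i].
have zyc x k : s [:: x; zz (~~ c); yy c k] =
    - s [:: x; yy (~~ c) (k + 1); yy (~~ c) (k + 1 + 1)].
  by have := flat3_zy x (~~ c) k; rewrite negbK.
have w1 : s [:: yy c (i + 1); yy (~~ c) (i + 1); yy (~~ c) i] = W.
  rewrite /W flat3_zy [in RHS]swap12 ?leviE // opprK zyc I3_add3.
  by rewrite [in RHS]swap23 ?opprK // leviE neq.
have w2 : s [:: yy c (i + 1 + 1); yy (~~ c) (i + 1 + 1); yy (~~ c) i] = W.
  rewrite /W flat3_zy [in RHS]swap23 ?opprK ?leviE ?neq //.
  by rewrite [in RHS]swap12 ?leviE // zyc opprK I3_add3.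
have zzW : s [:: yy (~~ c) i; zz (~~ c); zz c] = W.
  by rewrite swap12 ?leviE // swap23 ?leviE // opprK.
have zzT : s [:: yy (~~ c) i; zz c; zz (~~ c)] = t [:: yy (~~ c) i] - W.
  rewrite -zzW; apply: (lc1 (c1 := 1) (acomm23 (yy (~~ c) i) (zz c) (zz (~~ c)))).
  by rewrite leviE; case: (c) => /=; ring.
have yyW k : (k != i) -> s [:: yy c k; yy (~~ c) k; yy (~~ c) i] = W ->
    s [:: yy (~~ c) i; yy c k; yy (~~ c) k] - s [:: yy (~~ c) i; yy (~~ c) k; yy c k] =
    W *+ 2 - t [:: yy (~~ c) i].
  move=> ki kW.
  have e1 : s [:: yy (~~ c) i; yy c k; yy (~~ c) k] = W.
    have gk : levi (yy (~~ c) i) (yy c k) = false by rewrite leviE (eq_sym i) (negPf ki) andbF.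
    by rewrite swap12 // swap23 ?opprK // leviE neq.
  have := acomm23 (yy (~~ c) i) (yy c k) (yy (~~ c) k).
  rewrite leviE eqxx andbT e1 => e2; apply: (lc1 (c1 := - 1) e2).
  by case: (c); rewrite /= ; ring.
have yyT : s [:: yy (~~ c) i; yy c i; yy (~~ c) i] = t [:: yy (~~ c) i].
  have := acomm12 (yy (~~ c) i) (yy c i) (yy (~~ c) i).
  by rewrite sq23 addr0 leviE eqxx andbT; case: (c); rewrite mul1r.
have := flat3_trace (yy (~~ c) i) c.
rewrite (sum_cyclic3 _ i) zzW zzT yyT sq12 subr0 (yyW (i + 1)) ?I3E // (yyW (i + 1 + 1)) ?I3E // => tr.
have WE : W = t [:: yy (~~ c) i] / 3%:R.
  by apply: (lc1 (c1 := - 6%:R^-1) tr); field.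
by split=> //; case: (I3_case i j) ji => ->; rewrite ?eqxx // ?w1 ?w2.
Qed.

(** In degree three everything is determined by the eight values of t. Once they
vanish, s is skew in all its letters, and each type of word is reduced to those of
deg3_zyy and deg3_zzy_yyy, or to a word with a repeated letter. *)
Lemma flat3_eq0 : (forall a, t [:: a] = 0) -> forall a b e, s [:: a; b; e] = 0.
Proof.
move=> t0.
have a12 a b (e : 'I_8) : s [:: a; b; e] = - s [:: b; a; e].
  by apply/eqP; rewrite -addr_eq0 acomm12 t0 mulr0.
have a23 a b (e : 'I_8) : s [:: a; b; e] = - s [:: a; e; b].
  by apply/eqP; rewrite -addr_eq0 acomm23 t0 mulr0.
have zzy c d e i : s [:: zz c; zz d; yy e i] = 0.
  case: (eqVneq c d) => [->|cd]; first by rewrite sq12.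
  have {cd}-> : c = ~~ d by case: c d cd => [] [].
  have [->|->] : e = d \/ e = ~~ d by case: e; case: (d); [left|right|right|left].
    have [h _] := @deg3_zzy_yyy (~~ d) i (i + 1) (negbT (I3_neq1' i)).
    by rewrite a12; move: h; rewrite negbK => ->; rewrite t0 mul0r oppr0.
  have [-> _] := @deg3_zzy_yyy d i (i + 1) (negbT (I3_neq1' i)).
  by rewrite t0 mul0r.
have yyy0 c i j x : s [:: yy c j; yy (~~ c) j; yy x i] = 0.
  case: (eqVneq j i) => [->|ji].
    have [->|->] : x = c \/ x = ~~ c by case: x; case: (c); [left|right|right|left].
      by rewrite a23 sq12 oppr0.
    by rewrite sq23.
  have [->|->] : x = c \/ x = ~~ c by case: x; case: (c); [left|right|right|left].
    have [_ h] := @deg3_zzy_yyy (~~ c) i j ji.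
    by rewrite a12; move: h; rewrite negbK => ->; rewrite t0 mul0r oppr0.
  by have [_ ->] := @deg3_zzy_yyy c i j ji; rewrite t0 mul0r.
have yyy0' c i j x : s [:: yy (~~ c) j; yy c j; yy x i] = 0.
  by rewrite a12 yyy0 oppr0.
have zyy0 c x i : s [:: zz c; yy x i; yy (~~ x) i] = 0.
  have [->|->] : x = c \/ x = ~~ c by case: x; case: (c); [left|right|right|left].
    by rewrite deg3_zyy t0 mul0r.
  by rewrite a23 negbK deg3_zyy t0 mul0r oppr0.
have zyy1 c x i : s [:: zz c; yy x i; yy x (i + 1)] = 0.
  have [->|->] : x = c \/ x = ~~ c by case: x; case: (c); [left|right|right|left].
    have := flat3_zy (zz c) c (i + 1 + 1); rewrite sq12 I3_add3 => /eqP.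
    by rewrite eq_sym oppr_eq0 => /eqP.
  by rewrite a12 flat3_zy I3_add3 a23 yyy0' !oppr0.
have zyy1' c x i : s [:: zz c; yy x i; yy x (i + 1 + 1)] = 0.
  by rewrite a23; have := zyy1 c x (i + 1 + 1); rewrite I3_add3 => ->; rewrite oppr0.
have zyy2 c x i : s [:: zz c; yy x (i + 1); yy (~~ x) i] = 0 /\
    s [:: zz c; yy x (i + 1 + 1); yy (~~ x) i] = 0.
  have main d j : s [:: zz d; yy d (j + 1); yy (~~ d) j] = 0 /\
     s [:: zz d; yy d (j + 1 + 1); yy (~~ d) j] = 0.
    by split; rewrite a12 flat3_zy ?sq12 ?[in RHS]a23 ?oppr0 // a23 sq12 !oppr0.
  have [->|->] : x = c \/ x = ~~ c by case: x; case: (c); [left|right|right|left].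
    exact: main.
  rewrite negbK; have := main c (i + 1); have := main c (i + 1 + 1).
  rewrite I3_add3 => -[h1 h2] [h3 h4].
  by rewrite a23 h4 a23 h1 oppr0.
have zyy c x i d j : s [:: zz c; yy x i; yy d j] = 0.
  have [->|->] : x = d \/ x = ~~ d by case: x; case: (d); [left|right|right|left].
    case: (I3_case i j) => ->; rewrite ?sq23 ?zyy1 ?zyy1' //.
  case: (I3_case j i) => ->.
  - by have := zyy0 c (~~ d) j; rewrite negbK.
  - by have := zyy2 c (~~ d) j; rewrite negbK => -[].
  - by have := zyy2 c (~~ d) j; rewrite negbK => -[].
have yyy1 c x i j : s [:: yy x j; yy c i; yy c (i + 1)] = 0.
  have := flat3_zy (yy x j) c (i + 1 + 1); rewrite I3_add3 a12 zyy oppr0 => /eqP.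
  by rewrite eq_sym oppr_eq0 => /eqP.
have yyy1' c x i j : s [:: yy x j; yy c i; yy c (i + 1 + 1)] = 0.
  by rewrite a23; have := yyy1 c x (i + 1 + 1) j; rewrite I3_add3 => ->; rewrite oppr0.
have yyy c i x j d k : s [:: yy c i; yy x j; yy d k] = 0.
  have [->|->] : x = d \/ x = ~~ d by case: x; case: (d); [left|right|right|left].
    case: (I3_case j k) => ->; rewrite ?sq23 ?yyy1 ?yyy1' //.
  have [->|->] : c = d \/ c = ~~ d by case: c; case: (d); [left|right|right|left].
    by rewrite a12; case: (I3_case i k) => ->; rewrite ?sq23 ?sq12 ?yyy1 ?yyy1' ?oppr0 // a23 sq12 !oppr0.
  by rewrite a23 a12; case: (I3_case i j) => ->; rewrite ?sq23 ?sq12 ?yyy1 ?yyy1' ?oppr0.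
move=> a b e.
case: (letterP a) => [[c ->]|[c [i ->]]]; case: (letterP b) => [[d ->]|[d [j ->]]];
  case: (letterP e) => [[f ->]|[f [k ->]]]; rewrite ?zzy ?zyy ?yyy //.
- have [->|->] : c = d \/ c = ~~ d by case: c; case: (d); [left|right|right|left].
    by rewrite sq12.
  have [->|->] : f = d \/ f = ~~ d by case: f; case: (d); [left|right|right|left].
    by rewrite sq23.
  by rewrite a23 sq12 oppr0.
- by rewrite a23 zzy oppr0.
- by rewrite a12 a23 zzy !oppr0.
- by rewrite a12 zyy oppr0.
- by rewrite a23 a12 zyy !oppr0.
Qed.

End Degree3.

Section Degree4.
Variables (s t u : seq 'I_8 -> K).
Hypothesis fl : flat 4 s t.
Hypothesis flt : flat 2 t u.

Lemma acomm_t a b : t [:: a; b] + t [:: b; a] = (levi a b)%:R * u [::].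
Proof. exact: (flt.1 [::] [::] a b erefl). Qed.

Lemma deg4_acomm12 a b d e : s [:: a; b; d; e] + s [:: b; a; d; e] = (levi a b)%:R * t [:: d; e].
Proof. exact: (fl.1 [::] [:: d; e] a b erefl). Qed.

Lemma deg4_sq12 a d e : s [:: a; a; d; e] = 0.
Proof. by apply: double_eq0; rewrite deg4_acomm12 levi_refl mul0r. Qed.

Lemma deg4_sq23 a b e : s [:: a; b; b; e] = 0.
Proof. exact: (sq12 (flat_cons a fl) b e). Qed.

Lemma div3_eq0 (x : K) : 0 = x / 3%:R -> x = 0.
Proof. by move=> /eqP; rewrite eq_sym mulf_eq0 invr_eq0 pnatr_eq0 orbF => /eqP. Qed.

(** With a letter put in front, the degree-three formulas express s by t; comparing
two of them through a word with a repeated or an exchanged letter kills t. *)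
Lemma deg4_zy d c i : t [:: zz d; yy c i] = 0.
Proof.
have deg3_zzy x : s [:: x; zz c; zz (~~ c); yy c i] = t [:: x; yy c i] / 3%:R.
  have [/= + _] := deg3_zzy_yyy (flat_cons x fl) (~~ c) (negbT (I3_neq1' i)).
  by rewrite negbK.
have [->|->] : d = c \/ d = ~~ c by case: d; case: (c); [left|right|right|left].
  by have := deg3_zzy (zz c); rewrite deg4_sq12 => /div3_eq0.
have := deg4_acomm12 (zz c) (zz (~~ c)) (zz (~~ c)) (yy c i).
rewrite deg4_sq23 add0r deg3_zzy leviE => e.
apply: (lc1 (c1 := - (3%:R / 2%:R)) e).
by case: (c); rewrite /=; field.
Qed.

Lemma deg4_yy_neq c d i j : i != j -> t [:: yy c i; yy d j] = 0.
Proof.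
move=> ij; have [->|->] : d = c \/ d = ~~ c by case: d; case: (c); [left|right|right|left].
  have cyc k : t [:: yy c (k + 1); yy c (k + 1 + 1)] = 0.
    have /= := flt.2 [::] erefl; case=> /(_ c k) + _.
    by rewrite deg4_zy => /eqP; rewrite eq_sym oppr_eq0 => /eqP.
  case: (I3_case i j) ij => ->; rewrite ?eqxx // => _.
    by have := cyc (i + 1 + 1); rewrite I3_add3.
  have := acomm_t (yy c i) (yy c (i + 1 + 1)); rewrite leviE eqxx mul0r.
  by have := cyc (i + 1); rewrite I3_add3 => ->; rewrite addr0.
have [_ /=] := deg3_zzy_yyy (flat_cons (yy c i) fl) c ij.
by rewrite deg4_sq12 => /div3_eq0.
Qed.

Lemma deg4_zz c i : t [:: zz (~~ c); zz c] = t [:: yy c i; yy (~~ c) i].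
Proof.
have /= e1 := deg3_zyy (flat_cons (zz (~~ c)) fl) c i.
have [/= e2 _] := deg3_zzy_yyy (flat_cons (yy c i) fl) c (negbT (I3_neq1' i)).
suff e : s [:: zz (~~ c); zz c; yy c i; yy (~~ c) i] =
         s [:: yy c i; zz (~~ c); zz c; yy (~~ c) i].
  move: e; rewrite e1 e2 => /(congr1 ( *%R^~ 3%:R)).
  by rewrite !mulfVK ?pnatr_eq0.
have /= := swap12 (flat_cons (zz (~~ c)) fl) (yy (~~ c) i) (levi_zy c c i).
move=> ->; apply/eqP; rewrite eqr_oppLR -addr_eq0 deg4_acomm12 //.
by rewrite leviE mul0r.
Qed.

(** In degree four t is a multiple of the Levi form, so that a single parameter is
left: it is the top component of the grading. *)
Lemma deg4_tE a b : t [:: a; b] = (levi a b)%:R * u [::] / 2%:R.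
Proof.
have zE c : t [:: zz (~~ c); zz c] = u [::] / 2%:R.
  have /= := flt.2 [::] erefl; case=> _.
  under eq_bigr => i _ do
    rewrite -(deg4_zz false i) (_ : yy false i = yy (~~ true) i) // -(deg4_zz true i).
  rewrite sumr_const card_ord /= => tr.
  have sw := acomm_t (zz false) (zz true); rewrite leviE mul1r in sw.
  case: c; first by apply: (lc2 (c1 := 8%:R^-1) (c2 := 2%:R^-1) tr sw); field.
  by apply: (lc2 (c1 := - 8%:R^-1) (c2 := 2%:R^-1) tr sw); field.
have sq x : t [:: x; x] = 0.
  by apply: double_eq0; rewrite acomm_t levi_refl mul0r.
case: (letterP a) => [[c ->]|[c [i ->]]]; case: (letterP b) => [[d ->]|[d [j ->]]].
- rewrite leviE; case: (eqVneq c d) => [->|]; first by rewrite sq !mul0r.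
  by rewrite mul1r; case: c d => [] [] // _; [apply: (zE false)|apply: (zE true)].
- by rewrite deg4_zy leviE !mul0r.
- by have := acomm_t (yy c i) (zz d); rewrite deg4_zy addr0 leviE !mul0r.
- rewrite leviE; case: (eqVneq i j) => [->|ij]; last by rewrite deg4_yy_neq // andbF !mul0r.
  rewrite andbT; case: (eqVneq c d) => [->|]; first by rewrite sq !mul0r.
  by rewrite mul1r; case: c d => [] [] // _;
    rewrite ?(deg4_zz true j) ?(deg4_zz false j) -(zE true) -?(zE false) -?deg4_zz // zE -(zE true).
Qed.

Lemma flat4_eq0 : u [::] = 0 -> forall a b d e, s [:: a; b; d; e] = 0.
Proof.
move=> u0 a b d e; apply: (flat3_eq0 (flat_cons a fl)) => x /=.
by rewrite deg4_tE u0 mulr0 mul0r.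
Qed.

End Degree4.

(** The grading stops here: in degree five, t is a multiple of the Levi form in its
last two letters by the degree-four formula, while the degree-three formulas
give it a different multiple. *)
Lemma flat5_eq0 s t : flat 5 s t -> forall w, size w = 5 -> s w = 0.
Proof.
move=> fl; have [u flt] := flat_tau fl.
have tE a b d : t [:: a; b; d] = (levi b d)%:R * u [:: a] / 2%:R.
  exact: (deg4_tE (flat_cons a fl) (flat_cons a flt)).
have u0 a : u [:: a] = 0.
  case: (letterP a) => [[c ->]|[c [i ->]]].
    have := deg3_zyy flt c 0; rewrite tE leviE eqxx andbT => e.
    apply: (lc1 (c1 := 6%:R) e).
    by case: (c); rewrite /=; field.
  have [] := deg3_zzy_yyy flt (~~ c) (negbT (I3_neq1' i)).
  by rewrite tE negbK leviE !mul0r => /div3_eq0.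
move=> [|a [|b [|d [|e [|f [|]]]]]] // _.
exact: (flat4_eq0 (flat_cons a fl) (flat_cons a flt) (u0 a)).
Qed.

Lemma flat_ge5_eq0 k s t : (5 <= k)%N -> flat k s t -> forall w, size w = k -> s w = 0.
Proof.
move=> k5; rewrite -(subnK k5); elim: (k - 5)%N s t => [|m IH] s t fl.
  exact: flat5_eq0 fl.
by case=> // a w [szw]; apply: (IH _ _ (flat_cons a fl)).
Qed.

Definition I3_enum : seq 'I_3 := [:: 0; 1; 1 + 1].
Definition bools : seq bool := [:: false; true].

Lemma mem_I3_enum i : i \in I3_enum.
Proof. by case: i => [[|[|[|]]] ?]. Qed.
Lemma mem_bools c : c \in bools.
Proof. by case: c. Qed.

(** A list of words of each length such that the flat relations express all symbols
of that length by those of the list: 8, 22, 8 and 1 words in lengths 1 to 4. *)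
Definition determining_words1 : seq (seq 'I_8) :=
  [seq [:: zz c] | c <- bools] ++ [seq [:: yy c i] | c <- bools, i <- I3_enum].

Definition determining_words2 : seq (seq 'I_8) :=
  [:: zz false; zz true] ::
  [seq [:: zz c; yy c i] | c <- bools, i <- I3_enum] ++
  [seq [:: yy c i; yy c (i + 1)] | c <- bools, i <- I3_enum] ++
  [seq [:: yy false i; yy true j] | i <- I3_enum, j <- I3_enum].

Definition determining_words3 : seq (seq 'I_8) :=
  [seq [:: zz c; yy c 0; yy (~~ c) 0] | c <- bools] ++
  [seq [:: zz c; zz (~~ c); yy c i] | c <- bools, i <- I3_enum].

Definition determining_words4 : seq (seq 'I_8) := [:: [:: zz false; zz true; zz false; zz true]].

Lemma determining_words1_eq0 s : {in determining_words1, forall w, s w = 0} ->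
  forall w, size w = 1 -> s w = 0.
Proof.
move=> s0 [|a []] // _; apply: s0; rewrite mem_cat; case: (letterP a) => [[c ->]|[c [i ->]]].
  by rewrite map_f ?mem_bools.
by rewrite (allpairs_f (fun c i => [:: yy c i]) (mem_bools c) (mem_I3_enum i)) orbT.
Qed.

(** The relations express zz c, yy (~~ c) i by pairs yy c, yy c, and the trace
relation then recovers t from words of the list. *)
Lemma determining_words2_eq0 s t : flat 2 s t -> {in determining_words2, forall w, s w = 0} ->
  forall w, size w = 2 -> s w = 0.
Proof.
case=> cl /(_ [::] erefl) /= [rel tr] s0.
have ac a b : s [:: a; b] + s [:: b; a] = (levi a b)%:R * t [::] by exact: (cl [::] [::]).
have zz0 : s [:: zz false; zz true] = 0 by apply: s0; rewrite inE eqxx.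
have zy c i : s [:: zz c; yy c i] = 0.
  apply: s0; rewrite in_cons mem_cat; apply/or3P/Or32.
  exact: (allpairs_f (fun c i => [:: zz c; yy c i]) (mem_bools c) (mem_I3_enum i)).
have yyS c i : s [:: yy c i; yy c (i + 1)] = 0.
  apply: s0; rewrite in_cons mem_cat; apply/or3P/Or33; rewrite mem_cat; apply/orP; left.
  exact: (allpairs_f (fun c i => [:: yy c i; yy c (i + 1)]) (mem_bools c) (mem_I3_enum i)).
have y01 i j : s [:: yy false i; yy true j] = 0.
  apply: s0; rewrite in_cons mem_cat; apply/or3P/Or33; rewrite mem_cat; apply/orP; right.
  exact: (allpairs_f (fun i j => [:: yy false i; yy true j]) (mem_I3_enum i) (mem_I3_enum j)).
have t0 : t [::] = 0.
  have zE : s [:: zz true; zz false] = t [::].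
    by have := ac (zz false) (zz true); rewrite zz0 add0r leviE mul1r.
  have yE i : s [:: yy true i; yy false i] = t [::].
    by have := ac (yy false i) (yy true i); rewrite y01 add0r leviE eqxx mul1r.
  move: tr; under eq_bigr => i _ do rewrite y01 yE.
  rewrite zz0 zE sumr_const card_ord => tr.
  by apply: (lc1 (c1 := 2%:R^-1) tr); field.
have sw a b : s [:: a; b] = 0 -> s [:: b; a] = 0.
  by move=> ab; have := ac a b; rewrite ab add0r t0 mulr0.
have sq a : s [:: a; a] = 0 by apply: double_eq0; rewrite ac levi_refl mul0r.
have yyC c i j : s [:: yy c i; yy c j] = 0.
  case: (I3_case i j) => ->; rewrite ?sq ?yyS //.
  by apply: sw; have := yyS c (i + 1 + 1); rewrite I3_add3.
have zyC c d i : s [:: zz c; yy d i] = 0.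
  have [->|->] : d = c \/ d = ~~ c by case: d; case: (c); [left|right|right|left].
    exact: zy.
  by rewrite rel yyC oppr0.
move=> [|a [|b []]] // _.
case: (letterP a) => [[c ->]|[c [i ->]]]; case: (letterP b) => [[d ->]|[d [j ->]]].
- by case: c d => [] [] //; apply: sw.
- exact: zyC.
- exact/sw/zyC.
- by case: c d => [] []; rewrite ?yyC //; apply: sw.
Qed.

Lemma determining_words3_eq0 s t : flat 3 s t -> {in determining_words3, forall w, s w = 0} ->
  forall w, size w = 3 -> s w = 0.
Proof.
move=> fl s0.
suff t0 a : t [:: a] = 0 by move=> [|a [|b [|d []]]] // _; apply: (flat3_eq0 fl).
case: (letterP a) => [[c ->]|[c [i ->]]]; apply: div3_eq0.
  rewrite -(deg3_zyy fl c 0); apply/esym/s0; rewrite mem_cat.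
  by rewrite (map_f (fun c => [:: zz c; yy c 0; yy (~~ c) 0]) (mem_bools c)).
have [] := deg3_zzy_yyy fl (~~ c) (negbT (I3_neq1' i)); rewrite negbK => <- _.
apply/esym/s0; rewrite mem_cat.
by rewrite (allpairs_f (fun c i => [:: zz c; zz (~~ c); yy c i]) (mem_bools c) (mem_I3_enum i)) orbT.
Qed.

Lemma determining_words4_eq0 s t : flat 4 s t -> {in determining_words4, forall w, s w = 0} ->
  forall w, size w = 4 -> s w = 0.
Proof.
move=> fl s0; have [u flt] := flat_tau fl.
suff u0 : u [::] = 0 by move=> [|a [|b [|d [|e []]]]] // _; apply: (flat4_eq0 fl flt).
have := deg4_acomm12 fl (zz false) (zz true) (zz false) (zz true).
rewrite s0 ?inE // add0r (deg4_sq23 fl) leviE mul1r (deg4_tE fl flt) leviE mul1r.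
by move=> /esym/eqP; rewrite mulf_eq0 invr_eq0 pnatr_eq0 orbF => /eqP.
Qed.

End Flat.

(** * The conformal stabiliser of the quartic *)

(** Determinants of matrices over nat-indexed families, by expansion along the first
row: unlike the sum over permutations, this form evaluates by computation. *)
Fixpoint laplace n (F : nat -> nat -> int) : int :=
  if n is m.+1 then
    foldr (fun k x => (-1) ^+ k * F 0%N k * laplace m (fun i j => F i.+1 (bump k j)) + x)
      0 (iota 0 m.+1)
  else 1.

Lemma foldr_sum (f : nat -> int) s : foldr (fun k x => f k + x) 0 s = \sum_(k <- s) f k.
Proof. by elim: s => [|k s IH] /=; rewrite ?big_nil ?big_cons ?IH. Qed.

Lemma det_laplace n (F : nat -> nat -> int) :
  \det (\matrix_(i < n, j < n) F i j) = laplace n F.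
Proof.
elim: n F => [|n IH] F; first by rewrite det_mx00.
transitivity (\sum_(k <- iota 0 n.+1)
    (-1) ^+ k * F 0%N k * laplace n (fun i j => F i.+1 (bump k j))); last exact/esym/foldr_sum.
rewrite (expand_det_row _ ord0) -[iota 0 n.+1]/(index_iota 0 n.+1) big_mkord; apply: eq_bigr => k _.
rewrite mxE /cofactor add0n mulrA (mulrC (F _ _)) -IH; congr (_ * \det _).
by apply/matrixP => i j; rewrite !mxE.
Qed.

(** The product of the four coframe elements listed in m, evaluated on the frame
vectors numbered a 0, ..., a 3, is a minor of the identity matrix. *)
Definition wedge_int (m : seq nat) (a : nat -> nat) : int :=
  laplace 4 (fun i j => (a i == nth 0%N m j)%:R).

Definition quartic_int (a : nat -> nat) : int :=
  let w m := wedge_int m a in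
  w [:: 0; 1; 4; 5]%N + w [:: 0; 2; 4; 6]%N + w [:: 0; 3; 4; 7]%N
  - w [:: 0; 5; 6; 7]%N *+ 2 - w [:: 1; 2; 5; 6]%N - w [:: 1; 3; 5; 7]%N
  - w [:: 2; 3; 6; 7]%N + w [:: 1; 2; 3; 4]%N *+ 2.

Definition replace (I T : eqType) (a : I -> T) i k j := if j == i then k else a j.

(** The nonzero terms of the equation that S stabilises the quartic, evaluated on
the frame vectors listed in n, as triples (coefficient, row, column). As the
matrices met below come from symbols of words whose last letter is dual to the
column, the column k appears as k + 4. *)
Definition stab_terms (n : seq nat) : seq (int * (nat * nat)) :=
  [seq x <- [seq (quartic_int (replace (nth 0%N n) i k), (nth 0%N n i, (k + 4) %% 8)%N)
            | i <- iota 0 4, k <- iota 0 8] | x.1 != 0].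

Lemma eq_wedge_int m a b : (forall i, (i < 4)%N -> a i = b i) -> wedge_int m a = wedge_int m b.
Proof.
move=> ab; rewrite /wedge_int -!det_laplace; congr (\det _).
by apply/matrixP => i j; rewrite !mxE ab.
Qed.

Lemma eq_quartic_int a b : (forall i, (i < 4)%N -> a i = b i) -> quartic_int a = quartic_int b.
Proof. by move=> ab; rewrite /quartic_int !(eq_wedge_int _ ab). Qed.

Section Stabiliser.
Variable K : numFieldType.

Definition quartic (a : 'I_4 -> 'I_8) : K := (quartic_int (fun i => a (inZp i)))%:~R.

Lemma det_wedge (m : seq nat) (a : 'I_4 -> 'I_8) :
  \det (\matrix_(i < 4, j < 4) ((a i == nth 0%N m j :> nat)%:R : K)) =
  (wedge_int m (fun i => a (inZp i)))%:~R.
Proof.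
rewrite /wedge_int -det_laplace -[RHS]det_map_mx; congr (\det _).
by apply/matrixP => i j; rewrite !mxE valZpK rmorph_nat.
Qed.

Variables (S : 'I_8 -> 'I_8 -> K) (t mu : K).
Hypothesis S_sym : forall a b, S a b + S b a = (levi a b)%:R * t.
Hypothesis S_stab : forall a : 'I_4 -> 'I_8,
  \sum_(i < 4) \sum_(k < 8) S (a i) (dual k) * quartic (replace a i k) = mu * quartic a.

Lemma stab_termsE n : all (fun k => k < 8)%N n ->
  \sum_(x <- stab_terms n) x.1%:~R * S (inZp x.2.1) (inZp x.2.2) =
  mu * (quartic_int (nth 0%N n))%:~R.
Proof.
move=> n8; have n8i i : (nth 0%N n i < 8)%N.
  by case: (ltnP i (size n)) => [/(all_nthP 0%N n8)|/(nth_default 0%N) ->].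
pose a (i : 'I_4) : 'I_8 := inZp (nth 0%N n i).
have aE i : (i < 4)%N -> a (inZp i) = nth 0%N n i :> nat.
  move=> i4; have -> : inZp i = Ordinal i4 by apply: val_inj; rewrite /= modn_small.
  by rewrite /= modn_small.
rewrite -[in RHS](eq_quartic_int aE) -[RHS]S_stab /stab_terms big_filter.
rewrite big_mkcond big_allpairs_dep.
rewrite -[iota 0 4]/(index_iota 0 4) big_mkord; apply: eq_bigr => i _.
rewrite -[iota 0 8]/(index_iota 0 8) big_mkord; apply: eq_bigr => k _ /=.
rewrite /quartic (@eq_quartic_int _ (replace (nth 0%N n) i k)); last first.
  move=> j j4; have -> : inZp j = Ordinal j4 by apply: val_inj; rewrite /= modn_small.
  rewrite /replace -val_eqE; case: eqP => // _.
  by rewrite /= modn_small.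
have -> : dual k = inZp ((k + 4) %% 8)%N by apply: val_inj; rewrite /= modn_mod.
case: eqP => [->|_]; first by rewrite mulr0.
by rewrite mulrC.
Qed.

Lemma S_symE m n : S (inZp m) (inZp n) =
  (inZp n == inZp (m + 4) :> 'I_8)%:R * t - S (inZp n) (inZp m).
Proof.
rewrite -[LHS](addrK (S (inZp n) (inZp m))) S_sym /levi.
by have -> : dual (inZp m) = inZp (m + 4) by apply: val_inj; rewrite /= modnDml.
Qed.

(** Six of the seven equations come from evaluating the stabiliser condition where
the quartic vanishes, and the last one from comparing two places where it does not. *)
Lemma stab_spin7 : spin7 S.
Proof.
pose s m n := S (inZp m) (inZp n).
have sE n l z : all (fun k => k < 8)%N n -> stab_terms n = l -> quartic_int (nth 0%N n) = z ->
    \sum_(x <- l) x.1%:~R * s x.2.1 x.2.2 = mu * z%:~R.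
  by move=> n8 <- <-; exact: stab_termsE.
pose T (c : int) (m n : nat) := (c, (m, n)).
(* The stabiliser condition on eight quadruples of frame vectors; the lists of nonzero
   terms are found by evaluation. In six of them the name eij
   tells which entry S i j is solved for. *)
have e05 := sE [:: 0; 2; 3; 4]%N [:: T 2 0%N 5%N; T 1 2%N 3%N; T (-1) 3%N 2%N]
  0 isT ltac:(by vm_compute) ltac:(by vm_compute).
have e06 := sE [:: 0; 1; 3; 4]%N [:: T (-2) 0%N 6%N; T 1 1%N 3%N; T (-1) 3%N 1%N]
  0 isT ltac:(by vm_compute) ltac:(by vm_compute).
have e07 := sE [:: 0; 1; 2; 4]%N [:: T 2 0%N 7%N; T 1 1%N 2%N; T (-1) 2%N 1%N]
  0 isT ltac:(by vm_compute) ltac:(by vm_compute).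
have e41 := sE [:: 0; 4; 6; 7]%N [:: T (-2) 4%N 1%N; T (-1) 6%N 7%N; T 1 7%N 6%N]
  0 isT ltac:(by vm_compute) ltac:(by vm_compute).
have e42 := sE [:: 0; 4; 5; 7]%N [:: T 2 4%N 2%N; T (-1) 5%N 7%N; T 1 7%N 5%N]
  0 isT ltac:(by vm_compute) ltac:(by vm_compute).
have e43 := sE [:: 0; 4; 5; 6]%N [:: T (-2) 4%N 3%N; T (-1) 5%N 6%N; T 1 6%N 5%N]
  0 isT ltac:(by vm_compute) ltac:(by vm_compute).
have e0 := sE [:: 0; 5; 6; 7]%N [:: T (-2) 0%N 4%N; T (-2) 5%N 1%N; T (-2) 6%N 2%N; T (-2) 7%N 3%N]
  (-2) isT ltac:(by vm_compute) ltac:(by vm_compute).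
have e1 := sE [:: 1; 2; 3; 4]%N [:: T 2 1%N 5%N; T 2 2%N 6%N; T 2 3%N 7%N; T 2 4%N 0%N]
  2 isT ltac:(by vm_compute) ltac:(by vm_compute).
rewrite !big_cons !big_nil /= in e05 e06 e07 e41 e42 e43 e0 e1.
have sw m n : inZp n != inZp (m + 4) :> 'I_8 -> s n m = - s m n.
  by rewrite /s (S_symE m n) => /negPf ->; rewrite mul0r add0r opprK.
have tr a b c d m n k l : a = inZp m -> b = inZp n -> c = inZp k -> d = inZp l ->
    s m n = - s k l -> S a b = - S c d by move=> -> -> -> ->.
split.
  case=> [] [[|[|[|]]] ?] //.
  - apply: (tr _ _ _ _ 4 1 6 7)%N; try exact: val_inj.
    by apply: (lc2 (c1 := - 2%:R^-1) (c2 := 2%:R^-1) e41 (sw 6 7 isT)%N); field.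
  - apply: (tr _ _ _ _ 4 2 7 5)%N; try exact: val_inj.
    by apply: (lc2 (c1 := 2%:R^-1) (c2 := 2%:R^-1) e42 (sw 5 7 isT)%N); field.
  - apply: (tr _ _ _ _ 4 3 5 6)%N; try exact: val_inj.
    by apply: (lc2 (c1 := - 2%:R^-1) (c2 := 2%:R^-1) e43 (sw 5 6 isT)%N); field.
  - apply: (tr _ _ _ _ 0 5 2 3)%N; try exact: val_inj.
    by apply: (lc2 (c1 := 2%:R^-1) (c2 := 2%:R^-1) e05 (sw 2 3 isT)%N); field.
  - apply: (tr _ _ _ _ 0 6 3 1)%N; try exact: val_inj.
    by apply: (lc2 (c1 := - 2%:R^-1) (c2 := 2%:R^-1) e06 (sw 1 3 isT)%N); field.
  - apply: (tr _ _ _ _ 0 7 1 2)%N; try exact: val_inj.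
    by apply: (lc2 (c1 := 2%:R^-1) (c2 := 2%:R^-1) e07 (sw 1 2 isT)%N); field.
have yE (c : bool) (i : 'I_3) m : m = (i.+1 + 4 * c)%N -> yy c i = inZp m by move=> ->.
rewrite !big_ord_recl big_ord0 /=.
rewrite (yE true ord0 5%N) // (yE false ord0 1%N) // (yE true _ 6%N) // (yE false _ 2%N) //.
rewrite (yE true _ 7%N) // (yE false _ 3%N) //.
rewrite -[zz false]/(inZp 0) -[zz true]/(inZp 4) -!/(s _ _).
by apply: (lc2 (c1 := - 2%:R^-1) (c2 := - 2%:R^-1) e0 e1); field.
Qed.

End Stabiliser.

(** * Symbols of the coefficient of a symmetry *)

Section Centrality.
Variable K : numFieldType.

Lemma dualK : involutive dual.
Proof. by move=> i; apply: val_inj; rewrite /= modnDml -addnA modnDr modn_small. Qed.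

Lemma levi_sym a b : levi a b = levi b a.
Proof. by rewrite /levi eq_sym (can2_eq dualK dualK). Qed.

(** The dual pair through which a contraction is moved past the letter c below. *)
Lemma letter_anticommuting_pair c : exists e, [/\ levi e c = false & levi (dual e) c = false].
Proof.
case: (letterP c) => [[d ->]|[d [i ->]]].
  by exists (yy false 0); case: d.
by exists (zz false); case: d; case: i => [[|[|[|]]] ?].
Qed.

(** The contraction of a dual pair at some place of a word depends only on the rest
of the word: to move a contraction past the letter c, replace the pair by a dual
pair whose letters both anticommute with c. *)
Lemma cliffordP (s : seq 'I_8 -> K) k :
  (forall u v a b, (size u + size v).+2 = k ->
    s (u ++ a :: b :: v) + s (u ++ b :: a :: v) = (levi a b)%:R *
      (s (u ++ zz false :: zz true :: v) + s (u ++ zz true :: zz false :: v))) ->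
  clifford k s (fun w => s [:: zz false, zz true & w] + s [:: zz true, zz false & w]).
Proof.
move=> cl.
pose tau u v := s (u ++ zz false :: zz true :: v) + s (u ++ zz true :: zz false :: v).
have central u c v : (size u + size v).+3 = k -> tau (rcons u c) v = tau u (c :: v).
  rewrite /tau => sz; have [e [ec e'c]] := letter_anticommuting_pair c.
  have sz1 : (size (rcons u c) + size v).+2 = k by rewrite size_rcons addSn.
  have sz2 : (size u + size (c :: v)).+2 = k by rewrite /= addnS.
  have g1 : levi e (dual e) = true by rewrite /levi eqxx.
  have := cl _ _ e (dual e) sz1; rewrite g1 mul1r => <-.
  have := cl _ _ e (dual e) sz2; rewrite g1 mul1r => <-.
  have sw u' x v' : levi x c = false -> (size u' + size v').+2 = k ->
      s (u' ++ [:: x, c & v']) = - s (u' ++ [:: c, x & v']).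
    by move=> xc sz'; apply/eqP; rewrite -addr_eq0 cl // xc mul0r.
  have sw2 x y : levi x c = false -> levi y c = false ->
      s (rcons u c ++ [:: x, y & v]) = s (u ++ [:: x, y, c & v]).
    move=> xc yc; rewrite -cats1 -catA /=.
    have := sw (u ++ [:: x]) y v yc; rewrite -!catA /= size_cat addn1 addSn => ->; last exact: sz.
    by rewrite sw // ?opprK //= addnS.
  by rewrite !sw2.
move=> u v a b sz; rewrite cl //; congr (_ * _).
elim/last_ind: u v sz => [|u c IH] v sz //.
rewrite -/(tau _ _) central; last by rewrite -sz size_rcons.
by rewrite /tau IH ?cat_rcons // -sz size_rcons /= addnS.
Qed.

End Centrality.

(** The setting abstracts the sections over a chart domain: ev is the value at the
chosen point, gam the involution that changes the sign of odd functions, and the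
D i are the odd fields of the frame, as skew derivations. *)
Section Words.
Variables (A : pzRingType) (K : numFieldType) (ev : {rmorphism A -> K}).
Variables (gam : A -> A) (D : 'I_8 -> {additive A -> A}).
Hypothesis ev_gam : forall f, ev (gam f) = ev f.
Hypothesis D_gam : forall i f, gam (D i f) = - D i (gam f).
Hypothesis D_mul : forall i f g, D i (f * g) = D i f * g + gam f * D i g.

Definition word (w : seq 'I_8) (f : A) : A := foldr (fun i => D i) f w.

Lemma word_cat u v f : word (u ++ v) f = word u (word v f).
Proof. exact: foldr_cat. Qed.

Lemma word_rcons u i f : word (rcons u i) f = word u (D i f).
Proof. exact: foldr_rcons. Qed.

Lemma wordD w f g : word w (f + g) = word w f + word w g.
Proof. by elim: w => //= i w ->; rewrite raddfD. Qed.

Lemma wordN w f : word w (- f) = - word w f.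
Proof. by elim: w => //= i w ->; rewrite raddfN. Qed.

Lemma word0 w : word w 0 = 0.
Proof. by elim: w => //= i w ->; rewrite raddf0. Qed.

Lemma word_sum w I (r : seq I) (P : pred I) F :
  word w (\sum_(i <- r | P i) F i) = \sum_(i <- r | P i) word w (F i).
Proof. exact: (big_morph _ (wordD w) (word0 w)). Qed.

Lemma word_sign w (b : bool) f : word w ((-1) ^+ b * f) = (-1) ^+ b * word w f.
Proof. by rewrite !mulr_sign; case: b; rewrite ?wordN. Qed.

Lemma ev_word_gam w f : ev (word w (gam f)) = (-1) ^+ size w * ev (word w f).
Proof.
elim/last_ind: w f => [|w i IH] f; first by rewrite mul1r ev_gam.
rewrite !word_rcons size_rcons exprS mulN1r mulNr -IH D_gam wordN raddfN opprK.
by [].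
Qed.

(** Vanishing at the point up to order k in the weighted sense, where the transverse
field counts twice. *)
Definition vanish k f := forall w, (size w < k)%N -> ev (word w f) = 0.

Lemma vanishW k m f : (m <= k)%N -> vanish k f -> vanish m f.
Proof. by move=> mk fk w wm; apply: fk; apply: leq_trans mk. Qed.

Lemma vanish_D k i f : vanish k.+1 f -> vanish k (D i f).
Proof. by move=> fk w wk; rewrite -word_rcons; apply: fk; rewrite size_rcons. Qed.

Lemma vanish_gam k f : vanish k f -> vanish k (gam f).
Proof. by move=> fk w wk; rewrite ev_word_gam fk // mulr0. Qed.

(** When f vanishes to the order of the word, no derivative can fall on g. *)
Lemma ev_word_mul w g f : vanish (size w) f ->
  ev (word w (g * f)) = ev g * ev (word w f).
Proof.
elim/last_ind: w g f => [|w i IH] g f; first by rewrite rmorphM.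
rewrite size_rcons => fw; rewrite !word_rcons D_mul wordD rmorphD !IH.
- by rewrite (fw w) // mulr0 add0r ev_gam.
- exact: vanish_D.
- exact: vanishW fw.
Qed.

Lemma ev_word_mulr w f g : vanish (size w) f ->
  ev (word w (f * g)) = ev (word w f) * ev g.
Proof.
elim/last_ind: w f g => [|w i IH] f g; first by rewrite rmorphM.
rewrite size_rcons => fw; rewrite !word_rcons D_mul wordD rmorphD !IH.
- by rewrite ev_word_gam (fw w) // mulr0 mul0r addr0.
- exact/vanish_gam/(vanishW _ fw).
- exact: vanish_D.
Qed.

Variables (T : A -> A) (H : 'I_8 -> 'I_8 -> A) (c : 'I_8 -> 'I_8 -> 'I_8 -> A) (tau : K).
Hypothesis D_comm : forall i j f,
  D i (D j f) + D j (D i f) = H i j * T f + \sum_k c i j k * D k f.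
Hypothesis ev_H : forall i j, ev (H i j) = tau * (levi i j)%:R.
Hypothesis tau_neq0 : tau != 0.

(** As the Levi form is nondegenerate, T is a combination of a bracket of the D_i
and of the D_i, so it lowers the weighted order by two. *)
Lemma vanish_T k f : vanish k.+2 f -> vanish k (T f).
Proof.
move=> fk w wk; have [n wn] := ubnP (size w); elim: n w wn wk => // n IH w wn wk.
have fT : vanish (size w) (T f).
  move=> v vw; apply: IH; first exact: leq_trans vw wn.
  exact: leq_trans vw (ltnW wk).
have := D_comm (zz false) (zz true) f => /(congr1 (fun g => ev (word w g))).
rewrite !wordD !rmorphD ev_word_mul // ev_H leviE mulr1 -!word_rcons.
rewrite !fk ?size_rcons // addr0 word_sum rmorph_sum big1 ?addr0.
  by move=> /esym/eqP; rewrite mulf_eq0 (negPf tau_neq0) => /eqP.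
move=> k' _; have fD : vanish k.+1 (D k' f) by apply: vanish_D fk.
rewrite ev_word_mul; first by rewrite fD ?mulr0 // ltnW.
by apply: vanishW fD; rewrite ltnW // ltnW.
Qed.

(** At leading order the frame generates a Clifford algebra over T. *)
Lemma ev_word_comm w i j f : vanish (size w).+2 f ->
  ev (word w (D i (D j f))) + ev (word w (D j (D i f))) =
  (levi i j)%:R * (tau * ev (word w (T f))).
Proof.
move=> fw; rewrite -rmorphD -wordD D_comm wordD rmorphD ev_word_mul; last exact: vanish_T.
rewrite ev_H word_sum rmorph_sum big1 ?addr0.
  by rewrite mulrA (mulrC tau).
move=> k _; have fD : vanish (size w).+1 (D k f) by apply: vanish_D fw.
by rewrite ev_word_mul ?fD ?mulr0 //; apply: vanishW fD.
Qed.

Definition symbol f w := ev (word w f).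

Lemma vanish_word k v f : vanish (k + size v) f -> vanish k (word v f).
Proof.
move=> fk w wk; rewrite -word_cat; apply: fk.
by rewrite size_cat ltn_add2r.
Qed.

Lemma symbol_clifford k f : vanish k f ->
  clifford k (symbol f)
    (fun w => symbol f [:: zz false, zz true & w] + symbol f [:: zz true, zz false & w]).
Proof.
move=> fk; apply: cliffordP => u v a b sz.
have fv : vanish (size u).+2 (word v f).
  by apply: vanish_word; rewrite !addSn sz.
by rewrite /symbol !word_cat /= ev_word_comm // ev_word_comm // leviE mul1r.
Qed.

(* The coefficients a and b of a symmetry of parity p, the matrix M of its action on the
   frame of C, and the three symmetry equations that they satisfy. *)
Variables (p : bool) (a : A) (b t : 'I_8 -> A) (S M : 'I_8 -> 'I_8 -> A).
Variables (Q : ('I_4 -> 'I_8) -> A) (mu : A).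
Hypothesis E1 : forall j, \sum_i b i * H i j = (-1) ^+ p * D j a - a * t j.
Hypothesis E2 : forall j k,
  M j k = a * S j k + \sum_i b i * c i j k - (-1) ^+ p * D j (b k).
Hypothesis E3 : forall al, a * T (Q al) + \sum_i b i * D i (Q al)
  - \sum_(m < 4) \sum_k M (al m) k * Q (replace al m k) = mu * Q al.
Hypothesis ev_Q : forall al, ev (Q al) = quartic K al.
Hypothesis parity_a : gam a = (-1) ^+ p * a.

(** The leading part of E1 is tau b_(dual j) = +- D_j a. *)
Lemma ev_word_b k w j : vanish k.+1 a -> (size w <= k)%N ->
  (forall i, vanish (size w) (b i)) ->
  tau * ev (word w (b (dual j))) = (-1) ^+ p * ev (word w (D j a)).
Proof.
move=> ak wk bw.
have := E1 j => /(congr1 (fun g => ev (word w g))).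
rewrite wordD wordN rmorphB (@ev_word_mulr w a); last by apply: vanishW ak; rewrite ltnW.
rewrite ak // mul0r subr0 word_sign rmorphM rmorph_sign => <-.
rewrite word_sum rmorph_sum (bigD1 (dual j)) //= big1 ?addr0.
  by rewrite ev_word_mulr // ev_H levi_sym /levi eqxx mulr1 mulrC.
move=> i ij; rewrite ev_word_mulr // ev_H levi_sym /levi (negPf ij) !mulr0.
by [].
Qed.

(** E1 determines b by the first derivatives of a; the induction on the length of
the word removes the terms in which derivatives fall on the Levi form. *)
Lemma vanish_b k i : vanish k.+1 a -> vanish k (b i).
Proof.
move=> ak w; have [n wn] := ubnP (size w); elim: n w i wn => // n IH w i wn wk.
have bw j : vanish (size w) (b j).
  move=> v vw; apply: IH; first exact: leq_trans vw wn.
  exact: ltn_trans vw wk.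
have := ev_word_b (dual i) ak (ltnW wk) bw.
rewrite dualK -word_rcons ak ?size_rcons // mulr0 => /eqP.
by rewrite mulf_eq0 (negPf tau_neq0) => /eqP.
Qed.

(** By E2 the leading part of the action on C is D_j b_l, that is, a second derivative
of a. *)
Lemma ev_word_M k w j l : vanish k.+2 a -> (size w <= k)%N ->
  tau * ev (word w (M j l)) = - symbol a (w ++ [:: j; dual l]).
Proof.
move=> ak wk; rewrite E2 wordD wordN rmorphB wordD rmorphD.
rewrite ev_word_mulr; last by apply: vanishW ak; rewrite ltnW // ltnW.
rewrite ak; last by rewrite ltnW.
rewrite mul0r add0r word_sum rmorph_sum big1 ?add0r.
  rewrite word_sign rmorphM rmorph_sign mulrN mulrCA -word_rcons.
  have bk i := vanish_b i ak.
  rewrite -[l in b l]dualK (ev_word_b _ ak).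
  - by rewrite mulrA -expr2 sqrr_sign mul1r /symbol -cat_rcons word_cat.
  - by rewrite size_rcons.
  - by move=> i; apply: vanishW (bk _); rewrite size_rcons.
move=> i _; rewrite ev_word_mulr.
  by rewrite (vanish_b _ ak) ?mul0r.
by apply: vanishW (vanish_b _ ak); rewrite ltnW.
Qed.

Lemma ev_word_mu k w al : vanish k.+2 a -> (size w <= k)%N ->
  tau * ev (word w (mu * Q al)) =
  \sum_(m < 4) \sum_l symbol a (w ++ [:: al m; dual l]) * quartic K (replace al m l).
Proof.
move=> ak wk; rewrite -E3 wordD wordN rmorphB wordD rmorphD.
rewrite ev_word_mulr; last by apply: vanishW ak; rewrite ltnW // ltnW.
rewrite ak; last by rewrite ltnW.
rewrite mul0r add0r word_sum rmorph_sum big1 ?add0r; last first.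
  move=> i _; rewrite ev_word_mulr.
    by rewrite (vanish_b _ ak) ?mul0r.
  by apply: vanishW (vanish_b _ ak); rewrite ltnW.
rewrite mulrN word_sum rmorph_sum mulr_sumr -sumrN; apply: eq_bigr => m _.
rewrite word_sum rmorph_sum mulr_sumr -sumrN; apply: eq_bigr => l _ /=.
have Mw : vanish (size w) (M (al m) l).
  move=> v vw; apply/eqP; rewrite -(mulrI_eq0 _ (mulfI tau_neq0)).
  rewrite (ev_word_M _ _ ak); last exact: leq_trans (ltnW vw) wk.
  by rewrite /symbol ak ?oppr0 // size_cat addn2 !ltnS (leq_trans vw).
by rewrite ev_word_mulr // ev_Q mulrA (ev_word_M _ _ ak) // mulNr opprK.
Qed.

(** A quadruple at which the quartic takes the value 1, so that E3 there computes mu. *)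
Definition al0145 : 'I_4 -> 'I_8 := fun i => inZp (nth 0%N [:: 0; 1; 4; 5]%N i).

Lemma quartic0145 : quartic K al0145 = 1.
Proof. by rewrite /quartic (_ : quartic_int _ = 1) //; vm_compute. Qed.

(** The factor mu vanishes to an order two less than a, so that at leading order it
acts as the conformal factor of the stabiliser equation. *)
Lemma vanish_mu k : vanish k.+2 a -> vanish k mu.
Proof.
move=> ak w; have [n wn] := ubnP (size w); elim: n w wn => // n IH w wn wk.
have muw : vanish (size w) mu.
  move=> v vw; apply: IH; first exact: leq_trans vw wn.
  exact: ltn_trans vw wk.
have := ev_word_mu al0145 ak (ltnW wk).
rewrite ev_word_mulr // ev_Q quartic0145 mulr1 big1.
  by move=> /eqP; rewrite mulf_eq0 (negPf tau_neq0) => /eqP.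
move=> m _; rewrite big1 // => l _.
by rewrite /symbol ak ?mul0r // size_cat addn2.
Qed.

(** The symbols of the first nonvanishing length obey the relations of the flat
model: all corrections, from the structure functions and from the variation of Q,
multiply derivatives of a of lower weighted order. *)
Lemma symbol_flat k : vanish k.+2 a -> flat k.+2 (symbol a)
    (fun w => symbol a [:: zz false, zz true & w] + symbol a [:: zz true, zz false & w]).
Proof.
move=> ak; have cl := symbol_clifford ak; split=> // u [uk].
apply: (@stab_spin7 K _ (symbol a [:: zz false, zz true & u] + symbol a [:: zz true, zz false & u])
  (tau * ev (word u mu))).
  by move=> i j; rewrite (cl u [::]) ?cats0 //= uk addn0.
move=> al; rewrite -(ev_word_mu _ ak) ?uk // ev_word_mulr ?ev_Q ?mulrA //.
by rewrite uk; apply: vanish_mu.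
Qed.

Lemma parity_symbol w : odd (size w) != p -> symbol a w = 0.
Proof.
move=> wp; have e : (-1) ^+ p * symbol a w = (-1) ^+ odd (size w) * symbol a w.
  by rewrite signr_odd -ev_word_gam parity_a word_sign rmorphM rmorph_sign.
apply: double_eq0; move: e; rewrite !mulr_sign.
case: p (odd _) wp => [] [] //= _ e; first by rewrite -[X in X + _]opprK e addNr.
by rewrite [X in X + _]e addNr.
Qed.

Definition determining_words (q : bool) : seq (seq 'I_8) :=
  if q then determining_words1 ++ determining_words3 else [::] :: determining_words2 ++ determining_words4.

(** Raise the order of vanishing one step at a time: half of the steps are free by
parity, those of lengths 1 to 4 use the determining words, and from length 5 on
the flat relations leave nothing. *)
Lemma determining_words_eq0 : {in determining_words p, forall w, symbol a w = 0} -> forall w, symbol a w = 0.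
Proof.
move=> w0.
have step k : vanish k a -> (forall w, size w = k -> symbol a w = 0) -> vanish k.+1 a.
  by move=> ak a0 w; rewrite ltnS leq_eqVlt => /orP[/eqP/a0|/ak].
have stepp k : vanish k a -> odd k != p -> vanish k.+1 a.
  by move=> ak kp; apply: step => // w wk; apply: parity_symbol; rewrite wk.
have v0 : vanish 0 a by [].
suff v5 : vanish 5 a.
  have vk k : vanish (k + 5) a.
    elim: k => [|k IH] //; rewrite addSn; apply: step => //.
    move: IH; rewrite addnC => IH w wk.
    by apply: (flat_ge5_eq0 _ (symbol_flat IH) wk).
  by move=> w; apply: (vk (size w)); rewrite addnS ltnS leq_addr.
move: w0; case ep : p => w0.
  have v2 : vanish 2 a.
    apply: step; first by apply: stepp; rewrite ?ep.
    by apply: determining_words1_eq0 => w wt; apply: w0; rewrite mem_cat wt.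
  have v3 : vanish 3 a by apply: stepp; rewrite ?ep.
  apply: stepp; rewrite ?ep //; apply: step => //.
  by apply: (determining_words3_eq0 (symbol_flat v3)) => w wt; apply: w0; rewrite mem_cat wt orbT.
have v2 : vanish 2 a.
  apply: stepp; rewrite ?ep //; apply: step => //.
  by case=> // _; apply: w0; rewrite inE eqxx.
have v4 : vanish 4 a.
  apply: stepp; rewrite ?ep //; apply: step => //.
  by apply: (determining_words2_eq0 (symbol_flat v2)) => w wt; apply: w0; rewrite in_cons mem_cat wt orbT.
apply: step => //.
by apply: (determining_words4_eq0 (symbol_flat v4)) => w wt; apply: w0; rewrite in_cons mem_cat wt !orbT.
Qed.

Lemma determining_words_eq0_b : {in determining_words p, forall w, symbol a w = 0} ->
  forall i w, symbol (b i) w = 0.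
Proof.
move=> /determining_words_eq0 a0 i w; apply: (@vanish_b (size w).+1 i) => // v _; exact: a0.
Qed.

End Words.

(** * Power series over a numeric field *)

Section PowerSeries.
Variable K : numFieldType.
Implicit Types (a : nat -> K) (f : K -> K) (z w h : K).

Definition has_series f a (z0 : K) :=
  \forall z \near z0, series (fun n => a n * (z - z0) ^+ n) @ \oo --> f z.

Lemma le_addgt0 (x y : K) : x \is Num.real -> y \is Num.real ->
  (forall e, 0 < e -> x <= y + e) -> x <= y.
Proof.
move=> xr yr H; rewrite real_leNgt //; apply/negP => yx.
have := H ((x - y) / 2%:R); rewrite divr_gt0 ?subr_gt0 // => /(_ isT).
rewrite real_leNgt ?realD ?realM ?realB // => /negP; apply.
rewrite -subr_gt0 (_ : _ - _ = (x - y) / 2%:R); last by field.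
by rewrite divr_gt0 ?subr_gt0.
Qed.

(** Bounds on partial sums pass to the limit; the order of the field is partial, so
this goes through le_addgt0, for real elements only. *)
Lemma cvg_dist_le (u : nat -> K) l c B :
  u @ \oo --> l -> (forall n, `|u n - c| <= B) -> `|l - c| <= B.
Proof.
move=> /cvgrPdist_le ul uB; apply: le_addgt0.
- by rewrite normr_real.
- by rewrite (ger0_real (le_trans (normr_ge0 _) (uB 0%N))).
move=> e e0; have [N _ /(_ N (leqnn N)) /= uN] := ul e e0.
rewrite (_ : l - c = (l - u N) + (u N - c)); last by ring.
by rewrite (le_trans (ler_normD _ _)) // addrC lerD.
Qed.

(** The terms of the series converge to zero, hence are bounded, at a point at
distance r from the centre: the Cauchy estimates on the coefficients. *)
Lemma has_series_bound f a z0 : has_series f a z0 ->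
  exists r B : K, [/\ 0 < r, 0 <= B, (forall n, `|a n| * r ^+ n <= B) &
   forall h, `|h| <= r -> series (fun n => a n * h ^+ n) @ \oo --> f (z0 + h)].
Proof.
move=> /nbhs_ballP[e /= e0 He].
have e20 : 0 < e / 2%:R by rewrite divr_gt0.
have Hh h : `|h| <= e / 2%:R -> series (fun n => a n * h ^+ n) @ \oo --> f (z0 + h).
  move=> he; have := He (z0 + h); rewrite /ball /= opprD addNKr normrN.
  rewrite (addrC z0) addrK; apply; apply: le_lt_trans he _.
  by rewrite gtr_pMr // invf_lt1 ?ltr1n.
exists (e / 2%:R).
have /Hh c : `|e / 2%:R| <= e / 2%:R by rewrite ger0_norm // ltW.
have /cvg_series_cvg_0/cvgP/cvg_seq_bounded[M [Mr HM]] := cvgP _ c.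
have M1 : M < `|M| + 1.
  by rewrite (le_lt_trans (real_ler_norm Mr)) // ltrDl.
exists (`|M| + 1); split=> //.
move=> n; have := HM _ M1 n I; rewrite /= normrM normrX.
by rewrite (ger0_norm (ltW e20)).
Qed.

Let S a N w := series (fun n => a n * w ^+ n) N.
Let S' a N w := series (fun n => a n * (w ^+ n.-1 *+ n)) N.

(** The second-order remainder of a power; the factor 2 ^ n is the usual crude bound on
the sum of the binomial coefficients. Multiplying by rho ^ 2 avoids negative powers. *)
Lemma taylor_term (w h rho : K) n : `|w| + `|h| <= rho ->
  `|(w + h) ^+ n - w ^+ n - h * (w ^+ n.-1 *+ n)| * rho ^+ 2 <= `|h| ^+ 2 * (2%:R * rho) ^+ n.
Proof.
move=> wh; have rho0 : 0 <= rho by rewrite (le_trans _ wh) // addr_ge0.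
have wr : `|w| <= rho by rewrite (le_trans _ wh) // lerDl.
elim: n => [|n IH].
  by rewrite !expr0 subrr mulr0n mulr0 subrr normr0 mul0r mulr1 exprn_ge0.
have -> : (w + h) ^+ n.+1 - w ^+ n.+1 - h * (w ^+ n *+ n.+1) =
    (w + h) * ((w + h) ^+ n - w ^+ n - h * (w ^+ n.-1 *+ n)) + h ^+ 2 * (w ^+ n.-1 *+ n).
  have -> : w ^+ n *+ n.+1 = w * (w ^+ n.-1 *+ n) + w ^+ n.
    by rewrite mulrSr; case: n {IH} => [|n]; rewrite ?mulr0n ?mulr0 // mulrnAr -exprS.
  by rewrite !exprS; ring.
rewrite (le_trans (ler_pM _ _ (ler_normD _ _) (lexx _))) // ?exprn_ge0 //.
rewrite mulrDl normrM (normrM (h ^+ 2)) normrX.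
rewrite [X in _ <= X](_ : _ = rho * (`|h| ^+ 2 * (2%:R * rho) ^+ n) +
   `|h| ^+ 2 * (2%:R ^+ n * rho ^+ n.+1)); last first.
  by rewrite !exprMn !exprS; ring.
apply: lerD.
  rewrite -mulrA ler_pM ?mulr_ge0 ?exprn_ge0 //.
  exact: le_trans (ler_normD _ _) wh.
rewrite -mulrA ler_wpM2l ?exprn_ge0 //.
case: n {IH} => [|n]; first by rewrite mulr0n normr0 mul0r mulr_ge0 ?exprn_ge0.
rewrite /= normrMn normrX -(mulr_natl (`|w| ^+ n)) -mulrA ler_pM ?mulr_ge0 ?exprn_ge0 //.
  by rewrite -natrX ler_nat ltnW // ltn_expl.
by rewrite -[n.+2]addn2 exprD ler_wpM2r ?exprn_ge0 // lerXn2r ?nnegrE.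
Qed.

Lemma geometric_half N : \sum_(0 <= k < N) (2%:R^-1 ^+ k : K) <= 2%:R.
Proof.
suff -> : \sum_(0 <= k < N) (2%:R^-1 ^+ k : K) = 2%:R - 2%:R * 2%:R^-1 ^+ N.
  by rewrite gerBl mulr_ge0 ?exprn_ge0 // invr_ge0.
elim: N => [|N IH]; first by rewrite big_geq // expr0 mulr1 subrr.
by rewrite big_nat_recr //= IH exprS; field.
Qed.

(** Summing the remainders of the powers: with rho = r / 4 the terms are dominated by
a geometric series of ratio 1/2, uniformly in the number N of terms. The estimate
is on partial sums because the field may be incomplete. *)
Lemma taylor_partial a r B w h N : 0 < r -> 0 <= B -> (forall n, `|a n| * r ^+ n <= B) ->
  `|w| + `|h| <= r / 4%:R ->
  `|S a N (w + h) - S a N w - h * S' a N w| <= B * 32%:R / r ^+ 2 * `|h| ^+ 2.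
Proof.
move=> r0 B0 aB wh; set rho := r / 4%:R in wh *.
have rho0 : 0 < rho by rewrite divr_gt0.
pose E n := (w + h) ^+ n - w ^+ n - h * (w ^+ n.-1 *+ n).
pose C := B * (`|h| ^+ 2 / rho ^+ 2).
have C0 : 0 <= C by rewrite mulr_ge0 // divr_ge0 ?exprn_ge0 // ltW.
have term n : `|a n * E n| <= C * 2%:R^-1 ^+ n.
  have En : `|E n| <= r ^+ n * (`|h| ^+ 2 / rho ^+ 2 * 2%:R^-1 ^+ n).
    rewrite -(ler_pM2r (exprn_gt0 2 rho0)) (le_trans (taylor_term n wh)) //.
    rewrite (_ : _ * rho ^+ 2 = `|h| ^+ 2 * (r ^+ n * 2%:R^-1 ^+ n)); last first.
      by field; rewrite gt_eqF.
    rewrite -exprMn (_ : 2%:R * rho = r * 2%:R^-1) //.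
    by rewrite /rho; field.
  rewrite normrM (le_trans (ler_wpM2l _ En)) // /C -(mulrA B) (mulrA `|a n|).
  by rewrite ler_wpM2r // mulr_ge0 ?divr_ge0 ?exprn_ge0 ?invr_ge0 // ltW.
have -> : S a N (w + h) - S a N w - h * S' a N w = \sum_(0 <= n < N) a n * E n.
  rewrite /S /S' !seriesEnat /= -sumrB mulr_sumr -sumrB.
  by apply: eq_bigr => n _; rewrite /E; ring.
rewrite (le_trans (ler_norm_sum _ _ _)) // (le_trans (ler_sum _ (fun n _ => term n))) //.
rewrite -mulr_sumr (le_trans (ler_wpM2l C0 (geometric_half N))) //.
rewrite le_eqVlt; apply/orP; left; apply/eqP; rewrite /C /rho; field.
by rewrite gt_eqF.
Qed.

Lemma has_series_derive f a z0 : has_series f a z0 ->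
  exists2 C : K, 0 <= C & exists2 r : K, 0 < r & forall h, `|h| <= r ->
    `|f (z0 + h) - a 0%N - h * a 1%N| <= C * `|h| ^+ 2.
Proof.
move=> /has_series_bound[r [B [r0 B0 aB Hf]]].
exists (B * 32%:R / r ^+ 2); first by rewrite !mulr_ge0 // invr_ge0 exprn_ge0 // ltW.
exists (r / 4%:R) => [|h hr]; first by rewrite divr_gt0.
rewrite -addrA -opprD; apply: (@cvg_dist_le (fun N => S a N.+2 h)).
  rewrite (cvg_shiftS (fun n => S a n.+1 h)) (cvg_shiftS (fun n => S a n h)).
  apply: Hf; rewrite (le_trans hr) // ler_pdivrMr // ler_peMr ?ltW //.
  by rewrite ltr1n.
move=> N; have := @taylor_partial a r B 0 h N.+2 r0 B0 aB.
rewrite normr0 !add0r => /(_ hr).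
have S0 m : S a m.+1 0 = a 0%N.
  rewrite /S seriesEnat /= big_nat_recl // big1 ?addr0 ?expr0 ?mulr1 // => i _.
  by rewrite exprS mul0r mulr0.
have S'0 : S' a N.+2 0 = a 1%N.
  rewrite /S' seriesEnat /= big_nat_recl // big_nat_recl // big1 ?addr0.
    by rewrite mulr0n mulr0 add0r expr0 mulr1.
  by move=> i _; rewrite exprS mul0r mul0rn mulr0.
by rewrite S0 S'0 opprD addrA.
Qed.

Lemma has_series_center f a z0 : has_series f a z0 -> f z0 = a 0%N.
Proof.
move=> /has_series_derive[C C0 [r r0 /(_ 0)]].
rewrite normr0 => /(_ (ltW r0)); rewrite expr2 mulr0 mulr0 addr0 mul0r subr0 normr_le0.
by rewrite subr_eq0 => /eqP.
Qed.

Lemma has_series_is_derive f a z0 : has_series f a z0 -> is_derive z0 1 f (a 1%N).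
Proof.
move=> fa; have [C C0 [r r0 fC]] := has_series_derive fa.
have lim : h^-1 *: ((f \o shift z0) (h *: (1 : K)) - f z0) @[h --> 0^'] --> a 1%N.
  apply/cvgrPdist_le => e e0; near=> h.
  have h0 : h != 0 by near: h; exact: nbhs_dnbhs_neq.
  have hr : `|h| <= r by near: h; apply: dnbhs0_le.
  have he : `|h| <= e / (C + 1) by near: h; apply: dnbhs0_le; rewrite divr_gt0 // ltr_wpDl.
  rewrite /= [_%:A]mulr1 (addrC h) distrC; have := fC h hr; rewrite -(has_series_center fa) => fh.
  rewrite -(ler_pM2l (_ : 0 < `|h|)) ?normr_gt0 // -normrM.
  rewrite (_ : _ * _ = f (z0 + h) - f z0 - h * a 1%N); last first.
    transitivity (h * (h^-1 * (f (z0 + h) - f z0) - a 1%N)) => //.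
    by rewrite mulrBr mulrA mulfV // mul1r.
  apply: le_trans fh _; rewrite expr2 mulrA mulrC ler_wpM2l //.
  apply: (le_trans (ler_wpM2l C0 he)).
  by rewrite mulrCA ger_pMr // ler_pdivrMr ?ltr_wpDl // mul1r lerDl.
split; first by apply: cvgP lim.
by apply: cvg_lim lim.
Unshelve. all: by end_near. Qed.

(** Differentiation term by term. The derivative is compared with a difference
quotient at a small h, fixed first; the quotient is then compared with that of the
partial sums, which taylor_partial compares with the differentiated series. In an
incomplete field the estimates alone do not make the differentiated series
converge: its limit has to be supplied, and differentiability supplies it. *)
Lemma has_series_derive1 f a z0 : has_series f a z0 ->
  (\forall z \near z0, derivable f z 1) ->
  has_series (derive1 f) (fun n => a n.+1 *+ n.+1) z0.
Proof.
move=> /has_series_bound[r [B [r0 B0 aB Hf]]] fd.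
pose C := B * 32%:R / r ^+ 2.
have C0 : 0 <= C by rewrite !mulr_ge0 // invr_ge0 exprn_ge0 // ltW.
have r80 : 0 < r / 8%:R by rewrite divr_gt0.
near=> z; pose w := z - z0.
have wr : `|w| <= r / 8%:R.
  rewrite /w distrC; near: z; apply/nbhs_ballP; exists (r / 8%:R) => // z.
  by rewrite /ball /= => /ltW.
have dz : derivable f z 1 by near: z.
have zE : z0 + w = z by rewrite /w addrC subrK.
rewrite -/w (_ : series _ = (fun N => S' a N.+1 w)); last first.
  apply/funext => N; rewrite /S' !seriesEnat /= big_nat_recl // mulr0n mulr0 add0r.
  by apply: eq_bigr => n _; rewrite mulrnAl mulrnAr.
rewrite (cvg_shiftS (fun N => S' a N w)).
have rr : r / 4%:R <= r by rewrite ler_pdivrMr // ler_peMr ?(ltW r0) // ler1n.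
have r88 : r / 8%:R + r / 8%:R = r / 4%:R by field.
have r84 : r / 8%:R <= r by rewrite (le_trans _ rr) // -r88 lerDl ltW.
have Lz := dz; rewrite /derivable in Lz.
apply/cvgrPdist_le => e e0.
have e30 : 0 < e / 3%:R by rewrite divr_gt0.
have := Lz; rewrite derive1E /derive => /cvgrPdist_le/(_ _ e30); set L := lim _ => Le.
near (0 : K)^' => h.
have h0 : h != 0 by near: h; exact: nbhs_dnbhs_neq.
have hr : `|h| <= r / 8%:R by near: h; apply: dnbhs0_le.
have he : `|h| <= e / 3%:R / (C + 1).
  by near: h; apply: dnbhs0_le; rewrite divr_gt0 // ltr_wpDl.
have hL : `|L - h^-1 * (f (z + h) - f z)| <= e / 3%:R.
  have : `|L - h^-1 *: ((f \o shift z) (h *: (1 : K)) - f z)| <= e / 3%:R.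
    by near: h; exact: Le.
  by rewrite /= [_%:A]mulr1 (addrC h).
have nh0 : 0 < `|h| by rewrite normr_gt0.
have e60 : 0 < `|h| * (e / 6%:R) by rewrite mulr_gt0 // divr_gt0.
have whr : `|w| + `|h| <= r / 4%:R by rewrite -r88 lerD.
have c1 : S a N (w + h) @[N --> \oo] --> f (z + h).
  by rewrite -zE -(addrA z0); apply: (Hf (w + h)); rewrite (le_trans (ler_normD _ _)) // (le_trans whr).
have c2 : S a N w @[N --> \oo] --> f z.
  by rewrite -zE; apply: (Hf w); rewrite (le_trans wr).
move/cvgrPdist_le/(_ _ e60) : c1 => c1; move/cvgrPdist_le/(_ _ e60) : c2 => c2.
near=> N.
have s1 : `|f (z + h) - S a N (w + h)| <= `|h| * (e / 6%:R) by near: N; exact: c1.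
have s2 : `|f z - S a N w| <= `|h| * (e / 6%:R) by near: N; exact: c2.
have s3 := @taylor_partial a r B w h N r0 B0 aB whr.
rewrite -(ler_pM2l nh0) -normrM.
rewrite (_ : h * (L - S' a N w) = h * (L - h^-1 * (f (z + h) - f z)) +
   ((f (z + h) - S a N (w + h)) + (- (f z - S a N w) +
   (S a N (w + h) - S a N w - h * S' a N w)))); last first.
  by rewrite (mulrBr _ L (_ * _)) (mulrA h h^-1) mulfV // mul1r; ring.
rewrite (_ : `|h| * e =
    `|h| * (e / 3%:R) + (`|h| * (e / 6%:R) + (`|h| * (e / 6%:R) + `|h| * (e / 3%:R)))); last by field.
rewrite !(le_trans (ler_normD _ _) (lerD _ _)) //.
- by rewrite normrM ler_wpM2l.
- by rewrite normrN.
- apply: (le_trans s3); rewrite -/C expr2 mulrA mulrC ler_wpM2l //.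
  apply: (le_trans (ler_wpM2l C0 he)).
  by rewrite mulrCA ger_pMr // ler_pdivrMr ?ltr_wpDl // mul1r lerDl.
Unshelve. all: by end_near. Qed.

Lemma has_series_near0 f a z0 : has_series f a z0 -> (forall n, a n = 0) ->
  \forall z \near z0, f z = 0.
Proof.
move=> fa a0; apply: filterS fa => z; rewrite (_ : series _ = fun=> 0).
  by move=> c; rewrite -(cvg_lim (@norm_hausdorff _ _) c) lim_cst //; exact: norm_hausdorff.
by apply/funext => N; rewrite seriesEnat /= big1 // => n _; rewrite a0 mul0r.
Qed.

Lemma is_derive_cmul2 (c : K) (f g : K -> K) (z df dg : K) :
  is_derive z 1 f df -> is_derive z 1 g dg ->
  is_derive z 1 (fun z => c * f z * g z) (c * df * g z + c * f z * dg).
Proof.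
move=> fd gd.
apply: (is_derive_eq (is_deriveM (is_deriveZ c fd) gd)).
by transitivity (c * f z * dg + g z * (c * df)) => //; ring.
Qed.

Lemma is_derive_add (f g : K -> K) (z df dg : K) :
  is_derive z 1 f df -> is_derive z 1 g dg ->
  is_derive z 1 (fun z => f z + g z) (df + dg).
Proof. by move=> fd gd; apply: is_deriveD. Qed.

Lemma is_derive_cmul (c : K) (f : K -> K) (z df : K) :
  is_derive z 1 f df -> is_derive z 1 (fun z => c * f z) (c * df).
Proof. by move=> fd; apply: is_deriveZ. Qed.

Lemma is_derive1E (f : K -> K) (z df : K) : is_derive z 1 f df -> derive1 f z = df.
Proof. by move=> fd; rewrite derive1E derive_val. Qed.

Lemma derivable1 (f : K -> K) (z : K) : derivable f z 1 -> is_derive z 1 f (derive1 f z).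
Proof. by move=> fd; rewrite derive1E; apply/derivableP. Qed.

Lemma derive1_add (f g : K -> K) (z : K) : derivable f z 1 -> derivable g z 1 ->
  derive1 (fun z => f z + g z) z = derive1 f z + derive1 g z.
Proof. by move=> fd gd; apply/is_derive1E/is_derive_add; apply: derivable1. Qed.

Lemma derive1_cmul (c : K) (f : K -> K) (z : K) : derivable f z 1 ->
  derive1 (fun z => c * f z) z = c * derive1 f z.
Proof. by move=> fd; apply/is_derive1E/is_derive_cmul; apply: derivable1. Qed.

Lemma derive1_const (c z : K) : derive1 (fun=> c) z = 0.
Proof. by apply: is_derive1E; exact: is_derive_cst. Qed.

Lemma derive1_bilin_sum (I : Type) (r : seq I) (P : pred I) (c : I -> K)
    (F G : I -> K -> K) (z : K) :
  (forall i, derivable (F i) z 1) -> (forall i, derivable (G i) z 1) ->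
  derive1 (fun z => \sum_(i <- r | P i) c i * F i z * G i z) z =
  \sum_(i <- r | P i) (c i * derive1 (F i) z * G i z + c i * F i z * derive1 (G i) z).
Proof.
move=> Fd Gd; apply: is_derive1E; elim: r => [|i r IH].
  rewrite big_nil (_ : (fun _ => _) = fun=> 0); first exact: is_derive_cst.
  by apply/funext => w; rewrite big_nil.
rewrite big_cons (_ : (fun _ => _) =
   if P i then (fun z => c i * F i z * G i z + \sum_(j <- r | P j) c j * F j z * G j z)
   else (fun z => \sum_(j <- r | P j) c j * F j z * G j z)); last first.
  by apply/funext => w; rewrite big_cons; case: ifP.
case: ifP => // Pi; apply: is_derive_add IH.
by apply: is_derive_cmul2; apply: derivable1.
Qed.

Lemma derive1_near_eq (f g : K -> K) (z : K) : (\forall w \near z, f w = g w) ->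
  derive1 f z = derive1 g z.
Proof. by move=> fg; rewrite !derive1E; apply: near_eq_derive. Qed.

End PowerSeries.

(** * Holomorphic functions *)

Section Holomorphic.
Variable R : realType.
Implicit Types (V : set (Cx R)) (f : Cx R -> Cx R).

Lemma hol_series V f z : holomorphic_on V f -> V z -> exists a, has_series f a z.
Proof. by move=> Vf Vz; exact: (Vf z Vz). Qed.

Lemma hol_derivable V f z : holomorphic_on V f -> V z -> derivable f z 1.
Proof. by move=> Vf /(hol_series Vf)[a /has_series_is_derive[]]. Qed.

Lemma hol_derive1 V f : open V -> holomorphic_on V f -> holomorphic_on V (derive1 f).
Proof.
move=> oV Vf z0 Vz0; have [a fa] := hol_series Vf Vz0.
have fd : \forall z \near z0, derivable f z 1.
  by apply: filterS (open_nbhs_nbhs (conj oV Vz0)) => z; exact: hol_derivable.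
exists (fun n => a n.+1 *+ n.+1); exact: (has_series_derive1 fa fd).
Qed.

Lemma hol_scale V f (c : Cx R) : holomorphic_on V f -> holomorphic_on V (fun z => c * f z).
Proof.
move=> Vf z0 Vz0; have [a fa] := hol_series Vf Vz0.
exists (fun n => c * a n); apply: filterS fa => z fz.
rewrite (_ : series _ = (fun N => c * series (fun n => a n * (z - z0) ^+ n) N)).
  exact: cvgMl_tmp.
apply/funext => N; rewrite !seriesEnat /= mulr_sumr.
by apply: eq_bigr => n _; rewrite mulrA.
Qed.

Lemma hol_cst V (c : Cx R) : holomorphic_on V (fun=> c).
Proof.
move=> z0 _; exists (fun n => if n == 0%N then c else 0); near=> z.
rewrite -cvg_shiftS (_ : [sequence _]_n = fun=> c); first exact: cvg_cst.
apply/funext => N; rewrite seriesEnat /= big_nat_recl // big1 ?addr0 ?expr0 ?mulr1 //.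
by move=> n _; rewrite mul0r.
Unshelve. all: by end_near. Qed.

Lemma derive1_eq V f g z : open V -> V z -> (forall z, V z -> f z = g z) ->
  derive1 f z = derive1 g z.
Proof.
move=> oV Vz fg; apply: derive1_near_eq.
by apply: filterS (open_nbhs_nbhs (conj oV Vz)).
Qed.

End Holomorphic.

(** * Signs in the Grassmann algebra *)

Section GrassmannSigns.
Variables (R : realType) (n : nat).
Implicit Types (I J K : {set 'I_n}) (i : 'I_n).
Local Open Scope set_scope.

Definition inversions J K : nat := (\sum_(j in J) \sum_(k in K) (k < j))%N.

Lemma grassmann_signE J K : grassmann_sign R J K = (-1) ^+ inversions J K.
Proof.
rewrite /grassmann_sign -sum1_card /inversions; congr (_ ^+ _).
rewrite pair_big_dep /= (bigID (fun jk : 'I_n * 'I_n => (jk.1 \in J) && (jk.2 \in K))) /=.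
rewrite [X in (_ + X)%N]big1 ?addn0; last first.
  by move=> [j k]; rewrite inE /=; case: (j \in J); case: (k \in K); rewrite ?andbF.
rewrite [RHS](bigID (fun jk : 'I_n * 'I_n => (jk.2 < jk.1)%N)) /=.
rewrite [X in _ = (_ + X)%N]big1 ?addn0; last by move=> [j k] /andP[_ /negPf /= ->].
apply: eq_big => [[j k]|[j k] /andP[+ _]] /=; last by rewrite inE => /and3P[_ _ ->].
by rewrite inE /=; case: (j \in J); case: (k \in K); rewrite ?andbT ?andbF.
Qed.

Definition below i K : nat := (\sum_(k in K) (k < i))%N.
Definition above i J : nat := (\sum_(j in J) (i < j))%N.

Lemma inversionsU1l i J K : i \notin J ->
  inversions (i |: J) K = (below i K + inversions J K)%N.
Proof. by move=> iJ; rewrite /inversions big_setU1. Qed.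

Lemma inversionsU1r i J K : i \notin K ->
  inversions J (i |: K) = (above i J + inversions J K)%N.
Proof.
move=> iK; rewrite /inversions -big_split /=.
by apply: eq_bigr => j _; rewrite big_setU1.
Qed.

Lemma below_split i I J : J \subset I -> below i I = (below i J + below i (I :\: J))%N.
Proof. by move=> JI; rewrite /below [LHS](big_setID J) /= (finset.setIidPr JI). Qed.

Lemma below_above i J : i \notin J -> (below i J + above i J)%N = #|J|.
Proof.
move=> iJ; rewrite -sum1_card -big_split; apply: eq_bigr => j jJ /=.
by case: ltngtP => // /val_inj ji; rewrite -ji jJ in iJ.
Qed.

Lemma big_subsetU1 (F : {set 'I_n} -> Cx R) i I : i \notin I ->
  \sum_(J : {set 'I_n} | J \subset i |: I) F J =
  \sum_(J : {set 'I_n} | J \subset I) F J + \sum_(J : {set 'I_n} | J \subset I) F (i |: J).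
Proof.
move=> iI; rewrite (bigID (fun J : {set 'I_n} => i \notin J)) /=; congr (_ + _).
  apply: eq_bigl => J; apply/andP/idP => [[JI iJ]|JI].
    apply/fintype.subsetP => j jJ; have := fintype.subsetP JI j jJ.
    by rewrite !inE => /orP[/eqP ji|//]; rewrite -ji jJ in iJ.
  split; first exact: fintype.subset_trans JI (finset.subsetUr _ _).
  by apply: contra iI; apply: (fintype.subsetP JI).
rewrite (reindex_onto (fun J => i |: J) (fun J => J :\ i)) /=; last first.
  by move=> J /andP[_]; rewrite negbK => /finset.setD1K.
apply: eq_bigl => J; rewrite !inE eqxx /= andbT.
apply/andP/idP => [[JI /eqP iJ]|JI].
  apply/fintype.subsetP => j jJ; have /(fintype.subsetP JI) : j \in i |: J by rewrite !inE jJ orbT.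
  have : j != i by rewrite -iJ !inE in jJ; case/andP: jJ.
  by rewrite !inE => /negPf ->.
split; first exact: finset.setUS.
apply/eqP/finset.setU1K; apply: contra iI; exact: (fintype.subsetP JI).
Qed.

(** The sign comes from moving xi_i to the front of the monomial xi_(I + i). *)
Definition odd_partial (i : 'I_n) (f : {set 'I_n} -> Cx R -> Cx R) (I : {set 'I_n}) (z : Cx R) : Cx R :=
  if i \in I then 0 else (-1) ^+ below i I * f (i |: I) z.

(** The skew Leibniz rule for functions f of parity q. When i is in I, the left
side is zero and on the right the terms of J and J + i cancel; when it is not, the
subsets of I + i are J and J + i for J in I, and the two families are the two terms. *)
Lemma odd_partial_mul i (q : bool) (f g : {set 'I_n} -> Cx R -> Cx R) I z :
  (forall J, odd #|J| != q -> f J z = 0) ->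
  odd_partial i (grassmann_mul f g) I z =
  grassmann_mul (odd_partial i f) g I z + (-1) ^+ q * grassmann_mul f (odd_partial i g) I z.
Proof.
move=> fq; have fJ J : (-1) ^+ q * f J z = (-1) ^+ #|J| * f J z.
  case: (eqVneq (odd #|J|) q) => [<-|/fq ->]; last by rewrite !mulr0.
  by rewrite signr_odd.
have sq (m : nat) : (-1) ^+ m * (-1) ^+ m = 1 :> Cx R by rewrite -expr2 sqrr_sign.
rewrite /odd_partial /grassmann_mul; case: ifPn => iI.
  rewrite mulr_sumr -big_split /= -(finset.setD1K iI).
  have : i \notin I :\ i by rewrite !inE eqxx.
  move: (I :\ i) => I' iI'.
  rewrite big_subsetU1 // -big_split /= big1 // => J JI.
  have iJ : i \notin J by apply: contra iI'; exact: (fintype.subsetP JI).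
  have iIJ : i \notin I' :\: J by rewrite inE (negPf iI') andbF.
  have e1 : (i |: I') :\: J = i |: (I' :\: J).
    apply/finset.setP => j; rewrite !inE; case: eqP => [->|] //=; by rewrite iJ.
  have e2 : (i |: I') :\: (i |: J) = I' :\: J.
    by apply/finset.setP => j; rewrite !inE; case: eqP => [->|] //=; rewrite (negPf iI') andbF.
  rewrite e1 e2 (negPf iJ) !finset.setU11 (negPf iIJ) !grassmann_signE.
  rewrite inversionsU1l // inversionsU1r // !exprD; set G := g _ _; set F := f (i |: J) _.
  transitivity ((-1) ^+ above i J * (-1) ^+ inversions J (I' :\: J) * ((-1) ^+ below i J * F) * G +
     ((-1) ^+ below i (I' :\: J) * (-1) ^+ below i (I' :\: J)) *
       ((-1) ^+ q * F) * (-1) ^+ inversions J (I' :\: J) * G); first by ring.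
  by rewrite sq fJ cardsU1 iJ exprS -(below_above iJ) exprD -/F; ring.
rewrite big_subsetU1 // mulrDr !mulr_sumr addrC -!big_split /=.
apply: eq_bigr => J JI.
have iJ : i \notin J by apply: contra iI; exact: (fintype.subsetP JI).
have iIJ : i \notin I :\: J by rewrite inE (negPf iI) andbF.
have e1 : (i |: I) :\: J = i |: (I :\: J).
  by apply/finset.setP => j; rewrite !inE; case: eqP => [->|] //=; rewrite iJ.
have e2 : (i |: I) :\: (i |: J) = I :\: J.
  by apply/finset.setP => j; rewrite !inE; case: eqP => [->|] //=; rewrite (negPf iI) andbF.
rewrite e1 e2 (negPf iJ) (negPf iIJ) !grassmann_signE.
rewrite inversionsU1l // inversionsU1r // (below_split i JI) !exprD.
congr (_ + _).
  transitivity (((-1) ^+ below i (I :\: J) * (-1) ^+ below i (I :\: J)) *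
     (-1) ^+ inversions J (I :\: J) * ((-1) ^+ below i J * f (i |: J) z) * g (I :\: J) z); first by ring.
  by rewrite sq mul1r.
transitivity ((-1) ^+ inversions J (I :\: J) *
   ((-1) ^+ (below i J + above i J) * f J z) * ((-1) ^+ below i (I :\: J) * g (i |: (I :\: J)) z)).
  by rewrite exprD; ring.
by rewrite below_above // -fJ; ring.
Qed.

End GrassmannSigns.

(** * Coordinate vector fields of a superchart *)

Section Chart.
Variables (R : realType) (M : superspace R) (n : nat) (N : set M).
Variables (phi : M -> Cx R) (Phi : forall W : set M, sfun W -> {set 'I_n} -> Cx R -> Cx R).
Hypothesis chart : superchart N phi Phi.
Implicit Types (W V : set M) (I : {set 'I_n}).

Lemma chart_open : open N. Proof. by case: chart. Qed.

Lemma chart_im_open W : open W -> W `<=` N -> open (phi @` W).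
Proof. by case: chart => _ _ _ + _; apply. Qed.

Lemma chart_hol W (f : sfun W) I : open W -> W `<=` N -> holomorphic_on (phi @` W) (Phi f I).
Proof. by case: chart => _ _ _ _ H oW WN; have [[+ _] _ _ _ _] := H W oW WN; apply. Qed.

(** The default value 0 is immaterial: for holomorphic coefficients the superchart
provides a section. *)
Definition of_coef W (a : {set 'I_n} -> Cx R -> Cx R) : sfun W :=
  xget 0 [set f : sfun W | forall I z, (phi @` W) z -> Phi f I z = a I z].

Lemma of_coefE W a I z : open W -> W `<=` N ->
  (forall I, holomorphic_on (phi @` W) (a I)) -> (phi @` W) z ->
  Phi (of_coef W a) I z = a I z.
Proof.
case: chart => _ _ _ _ H oW WN ha Wz; have [[_ +] _ _ _ _] := H W oW WN.
move=> /(_ a ha)[f [fa _]]; rewrite /of_coef; case: xgetP => [g _ /= -> //|].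
by move=> /(_ f) /(_ fa).
Qed.

Lemma chart_inj W (f g : sfun W) : open W -> W `<=` N ->
  (forall I z, (phi @` W) z -> Phi f I z = Phi g I z) -> f = g.
Proof.
move=> oW WN fg; case: (chart) => _ _ _ _ H; have [[_ +] _ _ _ _] := H W oW WN.
move=> /(_ (Phi g) (fun I => chart_hol g I oW WN))[h [_ hu]].
by rewrite -(hu f) // -(hu g).
Qed.

Lemma chart_add W (f g : sfun W) I z : open W -> W `<=` N -> (phi @` W) z ->
  Phi (f + g) I z = Phi f I z + Phi g I z.
Proof. by case: chart => _ _ _ _ H oW WN; have [_ [+ _] _ _ _] := H W oW WN; apply. Qed.

Lemma chart_mul W (f g : sfun W) I z : open W -> W `<=` N -> (phi @` W) z ->
  Phi (f * g) I z = grassmann_mul (Phi f) (Phi g) I z.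
Proof. by case: chart => _ _ _ _ H oW WN; have [_ [_ +] _ _ _] := H W oW WN; apply. Qed.

Lemma chart_csec W c I z : open W -> W `<=` N -> (phi @` W) z ->
  Phi (csec W c) I z = if I == finset.set0 then c else 0.
Proof. by case: chart => _ _ _ _ H oW WN; have [_ _ + _ _] := H W oW WN; apply. Qed.

Lemma chart_par W p (f : sfun W) : open W -> W `<=` N ->
  (par W p f <-> forall I, odd #|I| != p -> forall z, (phi @` W) z -> Phi f I z = 0).
Proof. by case: chart => _ _ _ _ H oW WN; have [_ _ _ + _] := H W oW WN; apply. Qed.

Lemma chart_res W V (f : sfun W) I z : open W -> W `<=` N -> open V -> V `<=` W ->
  (phi @` V) z -> Phi (res W V f) I z = Phi f I z.
Proof.
by case: chart => _ _ _ _ H oW WN oV VW; have [_ _ _ _] := H W oW WN; apply.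
Qed.

Lemma chart0 W I z : open W -> W `<=` N -> (phi @` W) z -> Phi (0 : sfun W) I z = 0.
Proof.
move=> oW WN Wz; have := chart_add 0 0 I oW WN Wz; rewrite addr0 => /eqP.
by rewrite -subr_eq0 opprD addNKr oppr_eq0 => /eqP.
Qed.

Lemma grassmann_mul_eq (f f' g g' : {set 'I_n} -> Cx R -> Cx R) I z :
  (forall I, f I z = f' I z) -> (forall I, g I z = g' I z) ->
  grassmann_mul f g I z = grassmann_mul f' g' I z.
Proof. by move=> ff gg; apply: eq_bigr => J _; rewrite ff gg. Qed.

Lemma chart_cmul W c (f : sfun W) I z : open W -> W `<=` N -> (phi @` W) z ->
  Phi (csec W c * f) I z = c * Phi f I z.
Proof.
move=> oW WN Wz; rewrite chart_mul // /grassmann_mul (bigD1 finset.set0) ?finset.sub0set //=.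
rewrite chart_csec // eqxx finset.setD0 big1 ?addr0 => [|J /andP[_ /negPf J0]].
  by rewrite grassmann_signE /inversions big_set0 expr0 mul1r.
by rewrite chart_csec // J0 mulr0 mul0r.
Qed.

Lemma chart_sub V : V `<=` N -> open V -> superchart V phi Phi.
Proof.
move=> VN oV; case: (chart) => oN inj ct im H; split=> //.
- by move=> x y /set_mem Vx /set_mem Vy; apply: inj; rewrite inE; apply: VN.
- move=> A oA; rewrite (_ : V `&` _ = V `&` (N `&` phi @^-1` A)); last first.
    by rewrite setIA (setIidl VN).
  exact/openI/ct.
- by move=> A oA AV; apply: im => // x /AV/VN.
- by move=> A oA AV; apply: H => // x /AV/VN.
Qed.

Definition even_coordinate_field : op M := fun W f => of_coef W (fun I => derive1 (Phi f I)).
Definition odd_coordinate_field (i : 'I_n) : op M := fun W f => of_coef W (odd_partial i (Phi f)).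

Lemma even_coordinate_fieldE W (f : sfun W) I z : open W -> W `<=` N -> (phi @` W) z ->
  Phi (even_coordinate_field f) I z = derive1 (Phi f I) z.
Proof.
move=> oW WN Wz; apply: of_coefE => // J.
by apply: hol_derive1; [exact: chart_im_open|exact: chart_hol].
Qed.

Lemma odd_coordinate_fieldE i W (f : sfun W) I z : open W -> W `<=` N -> (phi @` W) z ->
  Phi (odd_coordinate_field i f) I z = odd_partial i (Phi f) I z.
Proof.
move=> oW WN Wz; apply: of_coefE => // J; rewrite /odd_partial.
case: (i \in J); first exact: hol_cst.
by apply: hol_scale; exact: chart_hol.
Qed.

Lemma derivable_chart W (f : sfun W) I z : open W -> W `<=` N -> (phi @` W) z ->
  derivable (Phi f I) z 1.
Proof. by move=> oW WN Wz; apply: hol_derivable Wz; exact: chart_hol. Qed.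

Definition is_even_coordinate_field (dz : op M) := forall W (f : sfun W) I z,
  open W -> W `<=` N -> (phi @` W) z -> Phi (dz W f) I z = derive1 (Phi f I) z.

Definition is_odd_coordinate_field i (dxi : op M) := forall W (f : sfun W) I z,
  open W -> W `<=` N -> (phi @` W) z -> Phi (dxi W f) I z = odd_partial i (Phi f) I z.

Section EvenField.
Variable dz : op M.
Hypothesis dzE : is_even_coordinate_field dz.

Lemma dz_mul W (f g : sfun W) : open W -> W `<=` N -> dz (f * g) = dz f * g + f * dz g.
Proof.
move=> oW WN; apply: chart_inj => // I z Wz.
rewrite dzE // chart_add // !chart_mul //.
rewrite (derive1_eq (chart_im_open oW WN) Wz (g := grassmann_mul (Phi f) (Phi g) I)); last first.
  by move=> w Ww; rewrite chart_mul.
rewrite /grassmann_mul derive1_bilin_sum => [|J|J]; try exact: derivable_chart.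
rewrite -big_split /=; apply: eq_bigr => J _.
by congr (_ * _ * _ + _ * _); apply/esym; exact: dzE.
Qed.

Lemma dz_vf : is_vf N false dz.
Proof.
move=> W oW WN; split.
- move=> f g; apply: (chart_inj oW WN) => I z Wz.
  rewrite (chart_add _ _ _ oW WN Wz) (@dzE _ f I z oW WN Wz) (@dzE _ g I z oW WN Wz).
  rewrite -(derive1_add (@derivable_chart _ f I z oW WN Wz) (@derivable_chart _ g I z oW WN Wz)).
  rewrite (@dzE _ _ I z oW WN Wz); apply: (derive1_eq (chart_im_open oW WN) Wz) => w Ww.
  exact: chart_add.
- move=> c f; apply: (chart_inj oW WN) => I z Wz.
  rewrite (chart_cmul _ _ _ oW WN Wz) (@dzE _ f I z oW WN Wz).
  rewrite -(derive1_cmul _ (@derivable_chart _ f I z oW WN Wz)).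
  rewrite (@dzE _ _ I z oW WN Wz); apply: (derive1_eq (chart_im_open oW WN) Wz) => w Ww.
  exact: chart_cmul.
- move=> q f /(chart_par _ _ oW WN) fq; apply/(chart_par _ _ oW WN) => I Iq z Wz.
  rewrite (@dzE _ f I z oW WN Wz) -[RHS](derive1_const 0 z).
  by apply: (derive1_eq (chart_im_open oW WN) Wz) => w Ww; exact: fq.
- by move=> q f g _; rewrite expr0 mul1r; exact: dz_mul.
- move=> V f oV VW; have VN := subset_trans VW WN.
  apply: (chart_inj oV VN) => I z Vz.
  have Wz : (phi @` W) z by case: Vz => x Vx <-; exists x => //; exact: VW.
  rewrite (chart_res _ _ oW WN oV VW Vz) (@dzE _ f I z oW WN Wz) (@dzE _ _ I z oV VN Vz).
  apply: (derive1_eq (chart_im_open oV VN) Vz) => w Vw.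
  by apply/esym; exact: chart_res.
Qed.

End EvenField.

Section OddField.
Variables (i : 'I_n) (dxi : op M).
Hypothesis dxiE : is_odd_coordinate_field i dxi.

Lemma dxi_vf : is_vf N true dxi.
Proof.
move=> W oW WN; split.
- move=> f g; apply: chart_inj => // I z Wz; rewrite dxiE // chart_add // !dxiE //.
  by rewrite /odd_partial; case: ifP; rewrite ?addr0 // chart_add // mulrDr.
- move=> c f; apply: chart_inj => // I z Wz; rewrite dxiE // chart_cmul // !dxiE //.
  by rewrite /odd_partial; case: ifP; rewrite ?mulr0 // chart_cmul // mulrCA.
- move=> q f /(chart_par _ _ oW WN) fq; apply/chart_par => // I Iq z Wz; rewrite dxiE //.
  rewrite /odd_partial; case: ifPn => // iI; rewrite fq ?mulr0 //.
  by rewrite cardsU1 iI /=; case: q Iq {fq} => /=; case: (odd _).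
- move=> q f g /(chart_par _ _ oW WN) fq; apply: chart_inj => // I z Wz.
  rewrite dxiE // chart_add // -(rmorph_sign (csec W)) chart_cmul // !chart_mul //.
  transitivity (odd_partial i (grassmann_mul (Phi f) (Phi g)) I z).
    by rewrite /odd_partial; case: ifP => // _; rewrite chart_mul.
  rewrite (@odd_partial_mul _ _ i q); last by move=> J Jq; exact: fq.
  by congr (_ + _ * _); apply: grassmann_mul_eq => J; rewrite ?dxiE.
- move=> V f oV VW; apply: chart_inj => //; first exact: subset_trans WN.
  move=> I z Vz; have Wz : (phi @` W) z by case: Vz => x Vx <-; exists x => //; exact: VW.
  have VN := subset_trans VW WN.
  rewrite chart_res // !dxiE // /odd_partial; case: ifP => // _.
  by rewrite chart_res.
Qed.

End OddField.

Lemma even_coordinate_field_exists :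
  exists dz, is_vf N false dz /\ is_even_coordinate_field dz.
Proof.
have H : is_even_coordinate_field even_coordinate_field.
  by move=> W f I z; exact: even_coordinate_fieldE.
by exists even_coordinate_field; split=> //; exact: dz_vf.
Qed.

Lemma odd_coordinate_field_exists i :
  exists dxi, is_vf N true dxi /\ is_odd_coordinate_field i dxi.
Proof.
have H : is_odd_coordinate_field i (odd_coordinate_field i).
  by move=> W f I z; exact: odd_coordinate_fieldE.
by exists (odd_coordinate_field i); split=> //; exact: dxi_vf H.
Qed.

Lemma chart_near (A : set (Cx R)) y : N y -> nbhs (phi y) A ->
  exists V, [/\ open V, V y, V `<=` N & forall x, V x -> A (phi x)].
Proof.
move=> Ny Ay; exists (N `&` phi @^-1` (interior A)); split.
- by case: chart => _ _ ct _ _; apply: ct; exact: open_interior.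
- by split=> //; exact: Ay.
- by move=> x [].
- by move=> x [_ /interior_subset].
Qed.

Definition body_eval y (f : sfun N) : Cx R := Phi f finset.set0 (phi y).

Lemma im_phi y : N y -> (phi @` N) (phi y).
Proof. by exists y. Qed.
Let oN := chart_open.
Let NN : N `<=` N := @subset_refl _ N.

Lemma body_evalD y f g : N y -> body_eval y (f + g) = body_eval y f + body_eval y g.
Proof. by move=> Ny; exact: (chart_add _ _ _ oN NN (im_phi Ny)). Qed.

Lemma body_evalM y f g : N y -> body_eval y (f * g) = body_eval y f * body_eval y g.
Proof.
move=> Ny; rewrite /body_eval (chart_mul _ _ _ oN NN (im_phi Ny)).
rewrite /grassmann_mul (big_pred1 finset.set0) => [|J]; last by rewrite finset.subset0.
by rewrite finset.setD0 grassmann_signE /inversions big_set0 expr0 mul1r.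
Qed.

Lemma body_eval_csec y c : N y -> body_eval y (csec N c) = c.
Proof. by move=> Ny; rewrite /body_eval (chart_csec _ _ oN NN (im_phi Ny)) eqxx. Qed.

Lemma body_eval_odd y f : N y -> par N true f -> body_eval y f = 0.
Proof.
move=> Ny /(chart_par _ _ oN NN) /(_ finset.set0); rewrite cards0 => /(_ isT); apply.
exact: im_phi.
Qed.

Lemma body_eval_neq0_near y f : N y -> body_eval y f != 0 ->
  exists V, [/\ open V, V y, V `<=` N & forall x, V x -> body_eval x f != 0].
Proof.
move=> Ny f0; apply: (@chart_near [set z | Phi f finset.set0 z != 0]) => //.
have [a fa] := hol_series (chart_hol f finset.set0 oN NN) (im_phi Ny).
have ct : {for phi y, continuous (Phi f finset.set0)}.
  by apply/differentiable_continuous/derivable1_diffP; have [] := has_series_is_derive fa.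
exact: (cvgr_neq0 _ ct f0).
Qed.

(** A differentially closed set P of functions that vanish at y consists of germs
equal to zero: the odd coordinate fields peel off the odd coordinates, and the even
one the terms of the power series. *)
Section InfiniteOrder.
Variables (y : M) (P : set (sfun N)).
Hypothesis Ny : N y.
Hypothesis P_vf : forall p X f, is_vf N p X -> P f -> P (X N f).
Hypothesis P_ev : forall f, P f -> body_eval y f = 0.

Lemma infinite_order_coef f I : P f -> Phi f I (phi y) = 0.
Proof.
have [m] := ubnP #|I|; elim: m I f => // m IH I f Im Pf.
have [->|[i iI]] := set_0Vmem I; first exact: P_ev.
have [dxi [dxi_vf dxiE]] := odd_coordinate_field_exists i.
have := IH (I :\ i)%SET (dxi N f) _ (P_vf dxi_vf Pf).
rewrite (@dxiE N f _ _ oN NN (im_phi Ny)) /odd_partial !inE eqxx /= finset.setD1K //.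
rewrite (leq_trans _ (ltnSE Im)); last by rewrite [X in (_ < X)%N](cardsD1 i) iI.
by move=> /(_ isT)/eqP; rewrite mulf_eq0 signr_eq0 => /eqP.
Qed.

Lemma infinite_order_series f I a k : P f -> has_series (Phi f I) a (phi y) -> a k = 0.
Proof.
elim: k f a => [|k IH] f a Pf fa.
  by rewrite -(has_series_center fa); exact: infinite_order_coef.
have [dz [dz_vf dzE]] := even_coordinate_field_exists.
have oI := chart_im_open oN NN.
have fd : \forall z \near phi y, derivable (Phi f I) z 1.
  apply: filterS (open_nbhs_nbhs (conj oI (im_phi Ny))) => z Nz.
  exact: (@derivable_chart N f I z oN NN Nz).
have dfa := has_series_derive1 fa fd.
have : has_series (Phi (dz N f) I) (fun n => a n.+1 *+ n.+1) (phi y).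
  apply: filterS2 dfa (open_nbhs_nbhs (conj oI (im_phi Ny))) => z + Nz.
  by rewrite (@dzE N f I z oN NN Nz).
by move/(IH _ _ (P_vf dz_vf Pf))/eqP; rewrite mulrn_eq0 => /eqP.
Qed.

Lemma infinite_order_zero f : P f -> exists V, [/\ open V, V y, V `<=` N & res N V f = 0].
Proof.
move=> Pf.
have f0 : \forall z \near phi y, forall I, Phi f I z = 0.
  have fI I : \forall z \near phi y, Phi f I z = 0.
    have [a fa] := hol_series (chart_hol f I oN NN) (im_phi Ny).
    by apply: (has_series_near0 fa) => k; exact: infinite_order_series fa.
  exact: (@filter_forall _ _ (fun I => [set z | Phi f I z = 0]) _ _ fI).
have [V [oV Vy VN V0]] := chart_near Ny f0.
exists V; split=> //; apply: (chart_inj oV VN) => I z Vz.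
rewrite (chart_res f I oN NN oV VN Vz) (chart0 I oV VN Vz).
by case: Vz => x Vx <-; exact: V0.
Qed.
End InfiniteOrder.

End Chart.

(** * Parity and calculus of vector fields *)

Section Parity.
Variables (R : realType) (M : superspace R) (W : set M).
Hypothesis alg : supercommutative_algebra W.
Implicit Types (f g : sfun W) (p q : bool).

Lemma parB p f g : par W p f -> par W p g -> par W p (f - g).
Proof. by case: alg => _ + _ _ _; apply. Qed.

Lemma par0 p : par W p 0.
Proof.
have p0 : par W false 0 by rewrite -(rmorph0 (csec W)); case: alg.
case: p => //; case: alg => _ _ _ + _ => /(_ 0)[[f g]] [[/= _ pg fg] _].
by rewrite -(subrr g); exact: parB.
Qed.

Lemma parN p f : par W p f -> par W p (- f).
Proof. by move=> pf; rewrite -sub0r; apply: parB => //; exact: par0. Qed.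

Lemma parD p f g : par W p f -> par W p g -> par W p (f + g).
Proof. by move=> pf pg; rewrite -(opprK g); apply/parB/parN. Qed.

Lemma parM p q f g : par W p f -> par W q g -> par W (p (+) q) (f * g).
Proof. by case: alg => _ _ + _ _; apply. Qed.

Lemma par_csec c : par W false (csec W c).
Proof. by case: alg. Qed.

Lemma par_sign p (b : bool) f : par W p f -> par W p ((-1) ^+ b * f).
Proof. by move=> pf; rewrite mulr_sign; case: b => //; exact: parN. Qed.

Lemma par_sum p I (r : seq I) (P : pred I) (F : I -> sfun W) :
  (forall i, P i -> par W p (F i)) -> par W p (\sum_(i <- r | P i) F i).
Proof. by move=> pF; elim/big_ind : _ => //; [exact: par0|exact: parD]. Qed.

Lemma par_split f : exists g h, [/\ par W false g, par W true h & f = g + h].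
Proof. by case: alg => _ _ _ /(_ f)[[g h] [[/= pg ph fgh] _]] _; exists g, h. Qed.

Lemma par_split_p p f : exists g h, [/\ par W p g, par W (~~ p) h & f = g + h].
Proof.
have [g [h [pg ph ->]]] := par_split f; case: p; last by exists g, h.
by exists h, g; rewrite addrC.
Qed.

Lemma par_uniq g h g' h' : par W false g -> par W true h -> par W false g' -> par W true h' ->
  g + h = g' + h' -> g = g' /\ h = h'.
Proof.
move=> pg ph pg' ph' e; case: alg => _ _ _ /(_ (g + h))[gh [_ u]] _.
have u1 := u (g, h) (And3 pg ph erefl); have u2 := u (g', h') (And3 pg' ph' e).
by have [-> ->] : (g, h) = (g', h') by rewrite -u1.
Qed.

Lemma par_both p f : par W p f -> par W (~~ p) f -> f = 0.
Proof.
move=> p1 p2; have [pf pt] : par W false f /\ par W true f by case: p p1 p2.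
by have [] := par_uniq pf (par0 true) (par0 false) pt (addrC _ _).
Qed.

(** With this involution the sign rule becomes an identity for all functions, of
mixed parity as well, so that words of odd derivations can be handled uniformly. *)
Definition parity_twist f : sfun W :=
  let gh := xget (0, 0) [set gh : sfun W * sfun W |
    [/\ par W false gh.1, par W true gh.2 & f = gh.1 + gh.2]] in gh.1 - gh.2.

Lemma parity_twistE g h : par W false g -> par W true h -> parity_twist (g + h) = g - h.
Proof.
move=> pg ph; rewrite /parity_twist; case: xgetP => [[g' h'] _ /= [pg' ph' e]|].
  by have [-> ->] := par_uniq pg ph pg' ph' e.
by move=> /(_ (g, h)) /(_ (And3 pg ph erefl)).
Qed.

Lemma parity_twist_par p f : par W p f -> parity_twist f = (-1) ^+ p * f.
Proof.
case: p => pf; rewrite mulr_sign.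
  by rewrite -{1}(add0r f) parity_twistE ?sub0r //; exact: par0.
by rewrite -{1}(addr0 f) parity_twistE ?subr0 //; exact: par0.
Qed.

Lemma parity_twistD f g : parity_twist (f + g) = parity_twist f + parity_twist g.
Proof.
have [f0 [f1 [pf0 pf1 ->]]] := par_split f; have [g0 [g1 [pg0 pg1 ->]]] := par_split g.
by rewrite addrACA !parity_twistE ?opprD 1?addrACA //; exact: parD.
Qed.

Lemma parity_twist_mul r f g : par W r f ->
  parity_twist (f * g) = (-1) ^+ r * (f * parity_twist g).
Proof.
move=> rf; have [g0 [g1 [pg0 pg1 ->]]] := par_split g.
have := parM rf pg0; have := parM rf pg1; rewrite addbF addbT => p1 p0.
rewrite mulrDr (parity_twistD (f * g0)) (parity_twist_par p0) (parity_twist_par p1) parity_twistE //.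
by rewrite !mulrBr !mulr_sign; case: (r) => //=; rewrite opprK.
Qed.

End Parity.

Section VectorFields.
Variables (R : realType) (M : superspace R).
Hypothesis hS : presheaf_of_superalgebras M.
Implicit Types (U V W N : set M) (p q r : bool) (X Y Z : op M).

Lemma algP W : open W -> supercommutative_algebra W.
Proof. by case: hS => + _ _ _; apply. Qed.

Lemma resP U V : open U -> open V -> V `<=` U -> restriction_morphism U V.
Proof. by case: hS => _ + _ _; apply. Qed.

Section Res.
Variables (U V : set M).
Hypothesis (oU : open U) (oV : open V) (VU : V `<=` U).

Lemma resD f g : res U V (f + g) = res U V f + res U V g.
Proof. by case: (resP oU oV VU). Qed.
Lemma resM f g : res U V (f * g) = res U V f * res U V g.
Proof. by case: (resP oU oV VU). Qed.
Lemma res_csec c : res U V (csec U c) = csec V c.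
Proof. by case: (resP oU oV VU). Qed.
Lemma res_par p f : par U p f -> par V p (res U V f).
Proof. by case: (resP oU oV VU) => _ _ _; apply. Qed.
Lemma res0 : res U V 0 = 0.
Proof. by rewrite -(rmorph0 (csec U)) res_csec rmorph0. Qed.
Lemma res1 : res U V 1 = 1.
Proof. by rewrite -(rmorph1 (csec U)) res_csec rmorph1. Qed.
Lemma resN f : res U V (- f) = - res U V f.
Proof. by apply/eqP; rewrite -addr_eq0 -resD addNr res0. Qed.
Lemma res_sign (b : bool) f : res U V ((-1) ^+ b * f) = (-1) ^+ b * res U V f.
Proof. by rewrite !mulr_sign; case: b => //; rewrite resN. Qed.
Lemma res_sum I (r : seq I) (P : pred I) (F : I -> sfun U) :
  res U V (\sum_(i <- r | P i) F i) = \sum_(i <- r | P i) res U V (F i).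
Proof. exact: (big_morph _ resD res0). Qed.

Lemma res_twist f : res U V (parity_twist f) = parity_twist (res U V f).
Proof.
have [g [h [pg ph ->]]] := par_split (algP oU) f.
rewrite (parity_twistE (algP oU)) // !resD resN.
by rewrite (parity_twistE (algP oV)) //; exact: res_par.
Qed.
End Res.

Lemma res_id U f : open U -> res U U f = f.
Proof. by case: hS => _ _ + _; apply. Qed.

Lemma res_comp U V W f : open U -> open V -> open W -> V `<=` U -> W `<=` V ->
  res V W (res U V f) = res U W f.
Proof. by case: hS => _ _ _; apply. Qed.

Lemma is_vf_sub U V p X : is_vf U p X -> V `<=` U -> is_vf V p X.
Proof. by move=> Xvf VU W oW WV; apply: Xvf => //; exact: subset_trans VU. Qed.

Lemma is_vf_agree U p X Y : agree U X Y -> is_vf U p X -> is_vf U p Y.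
Proof.
move=> XY Xvf W oW WU; have [a l pa le re] := Xvf W oW WU.
have E f : Y W f = X W f by rewrite XY.
split=> [f g|c f|q f pf|q f g pf|V f oV VW]; rewrite ?E //.
- exact: pa.
- exact: le.
- by rewrite re // XY //; exact: subset_trans WU.
Qed.

Section VF.
Variables (U W : set M) (p : bool) (X : op M).
Hypothesis (Xvf : is_vf U p X) (oW : open W) (WU : W `<=` U).

Lemma vfD f g : @X W (f + g) = @X W f + @X W g.
Proof. by have [] := Xvf oW WU. Qed.
Lemma vf0 : @X W 0 = 0.
Proof. by apply: (addIr (@X W 0)); rewrite -vfD addr0 add0r. Qed.
Lemma vfN f : @X W (- f) = - @X W f.
Proof. by apply/eqP; rewrite -addr_eq0 -vfD addNr vf0. Qed.
Lemma vfB f g : @X W (f - g) = @X W f - @X W g.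
Proof. by rewrite vfD vfN. Qed.
Lemma vf_sum I (r : seq I) (P : pred I) (F : I -> sfun W) :
  @X W (\sum_(i <- r | P i) F i) = \sum_(i <- r | P i) @X W (F i).
Proof. exact: (big_morph _ vfD vf0). Qed.
Lemma vf_sign (b : bool) f : @X W ((-1) ^+ b * f) = (-1) ^+ b * @X W f.
Proof. by rewrite !mulr_sign; case: b => //; rewrite vfN. Qed.
Lemma vf_csec c f : @X W (csec W c * f) = csec W c * @X W f.
Proof. by have [_ + _ _ _] := Xvf oW WU; apply. Qed.
Lemma vf_par q f : par W q f -> par W (p (+) q) (@X W f).
Proof. by have [_ _ + _ _] := Xvf oW WU; apply. Qed.
Lemma vfM q f g : par W q f -> @X W (f * g) = @X W f * g + (-1) ^+ (p && q) * (f * @X W g).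
Proof. by have [_ _ _ + _] := Xvf oW WU; apply. Qed.
Lemma vf_res V f : open V -> V `<=` W -> res W V (@X W f) = @X V (res W V f).
Proof. by have [_ _ _ _] := Xvf oW WU; apply. Qed.
End VF.

Lemma sign_mulC (A : pzRingType) (b : bool) (f g : A) :
  f * ((-1) ^+ b * g) = (-1) ^+ b * (f * g).
Proof. by rewrite !mulr_sign; case: b => //; rewrite mulrN. Qed.

Lemma odd_vf_mul U W X f g : is_vf U true X -> open W -> W `<=` U ->
  X W (f * g) = X W f * g + parity_twist f * X W g.
Proof.
move=> Xvf oW WU; have [f0 [f1 [p0 p1 ->]]] := par_split (algP oW) f.
rewrite (parity_twistE (algP oW)) // !mulrDl !(vfD Xvf) // (vfM Xvf _ _ _ p0) // (vfM Xvf _ _ _ p1) //.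
by rewrite !mulr_sign /= mulNr mulrDl addrACA.
Qed.

Lemma odd_vf_twist U W X f : is_vf U true X -> open W -> W `<=` U ->
  parity_twist (X W f) = - X W (parity_twist f).
Proof.
move=> Xvf oW WU; have [f0 [f1 [p0 p1 ->]]] := par_split (algP oW) f.
rewrite (parity_twistE (algP oW)) // (vfB Xvf) // (vfD Xvf) // addrC.
rewrite (parity_twistE (algP oW)) ?opprB //.
- exact: (vf_par Xvf oW WU p1).
- exact: (vf_par Xvf oW WU p0).
Qed.

Lemma vf_zero U p : is_vf U p (fun W _ => 0).
Proof.
move=> W oW WU; split=> [f g|c f|q f pf|q f g pf|V f oV VW]; rewrite ?addr0 ?mulr0 ?mul0r ?add0r ?mulr0 //.
- exact: (par0 (algP oW)).
- exact: res0.
Qed.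

Lemma vf_addP U p X Y : is_vf U p X -> is_vf U p Y -> is_vf U p (vf_add X Y).
Proof.
move=> Xvf Yvf W oW WU; rewrite /vf_add.
split=> [f g|c f|q f pf|q f g pf|V f oV VW].
- by rewrite (vfD Xvf) // (vfD Yvf) // addrACA.
- by rewrite (vf_csec Xvf) // (vf_csec Yvf) // mulrDr.
- by apply: (parD (algP oW)); [apply: (vf_par Xvf)|apply: (vf_par Yvf)].
- by rewrite (vfM Xvf oW WU _ pf) (vfM Yvf oW WU _ pf) mulrDl !mulrDr addrACA.
- by rewrite (resD oW) // (vf_res Xvf) // (vf_res Yvf).
Qed.

Lemma vf_smulP U r p (f : sfun U) X : open U -> par U r f -> is_vf U p X ->
  is_vf U (r (+) p) (vf_smul f X).
Proof.
move=> oU rf Xvf W oW WU; rewrite /vf_smul; have rfW := res_par oU oW WU rf.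
split=> [g h|c g|q g pg|q g h pg|V g oV VW].
- by rewrite (vfD Xvf) // mulrDr.
- rewrite (vf_csec Xvf) // !mulrA; congr (_ * _).
  case: (algP oW) => _ _ _ _ /(_ _ _ _ _ rfW (par_csec (algP oW) c)) ->.
  by rewrite andbF mul1r.
- by rewrite -addbA; apply: (parM (algP oW)) => //; apply: (vf_par Xvf).
- rewrite (vfM Xvf oW WU _ pg) mulrDr sign_mulC !mulrA; congr (_ + _).
  case: (algP oW) => _ _ _ _ /(_ _ _ _ _ pg rfW) e.
  rewrite -!mulrA (mulrA g) (mulrA (res U W f)) e; case: (p) (q) (r) => [] [] [] /=;
  by rewrite !(mul1r, mulN1r, expr0, expr1, mulNr, mulrN, opprK).
- by rewrite (resM oW oV VW) (vf_res Xvf) // (res_comp _ oU oW oV).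
Qed.

(** The cancellation of cross terms by which a commutator of derivations is a derivation. *)
Lemma leibniz_regroup (A : zmodType) (a a' b c d d' : A) :
  (a + b) + (c + d) - ((a' + c) + (b + d')) = (a - a') + (d - d').
Proof.
rewrite (addrC c d) (addrACA a) (addrC b d') (addrACA a') (addrC c b).
by rewrite opprD (addrACA (a + d)) subrr addr0 opprD addrACA.
Qed.

Lemma vf_bracketP U p q X Y : is_vf U p X -> is_vf U q Y ->
  is_vf U (p (+) q) (bracket p q X Y).
Proof.
move=> Xvf Yvf W oW WU; rewrite /bracket.
split=> [f g|c f|r f pf|r f g pf|V f oV VW].
- rewrite (vfD Yvf) // (vfD Xvf) // (vfD Xvf) // (vfD Yvf) // mulrDr opprD addrACA.
  by [].
- rewrite (vf_csec Yvf) // (vf_csec Xvf) // (vf_csec Xvf) // (vf_csec Yvf) //.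
  by rewrite mulrBr sign_mulC.
- apply: (parB (algP oW)).
    by rewrite -addbA; apply: (vf_par Xvf) => //; apply: (vf_par Yvf).
  apply: (par_sign (algP oW)); rewrite (addbC p) -addbA.
  by apply: (vf_par Yvf) => //; apply: (vf_par Xvf).
- have pX := vf_par Xvf oW WU pf; have pY := vf_par Yvf oW WU pf.
  rewrite (vfM Yvf oW WU _ pf) (vfD Xvf) // (vf_sign Xvf) // (vfM Xvf oW WU _ pf).
  rewrite (vfM Xvf oW WU _ pY) (vfM Xvf oW WU _ pf) (vfD Yvf) // (vf_sign Yvf) //.
  rewrite (vfM Yvf oW WU _ pf) (vfM Yvf oW WU _ pX) !mulrDr.
  have sc (A : pzRingType) (z : A) :
      (-1) ^+ (p && q) * ((-1) ^+ (q && (p (+) r)) * z) = (-1) ^+ (q && r) * z.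
    by rewrite !mulr_sign; case: (p) (q) (r) => [] [] []; rewrite ?opprK.
  have sb (A : pzRingType) (z : A) :
      (-1) ^+ (p && q) * ((-1) ^+ (p && r) * z) = (-1) ^+ (p && (q (+) r)) * z.
    by rewrite !mulr_sign; case: (p) (q) (r) => [] [] []; rewrite ?opprK.
  rewrite sc sb leibniz_regroup mulrBl -mulrA; congr (_ + _).
  by rewrite !mulr_sign; case: (p) (q) (r) => [] [] [] /=; rewrite ?mulrN ?opprK //;
     rewrite ?opprD ?opprK.
- rewrite (resD oW oV VW) (resN oW oV VW) (res_sign oW oV VW).
  have VU := subset_trans VW WU.
  by rewrite (vf_res Xvf) // (vf_res Yvf) // (vf_res Yvf) // (vf_res Xvf).
Qed.

End VectorFields.

(** * Frames of a contact distribution *)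

Section Frames.
Variables (R : realType) (M : superspace R).
Hypothesis hS : presheaf_of_superalgebras M.
Implicit Types (U V W N : set M) (p q r : bool) (X Y Z : op M).
Variable n : nat.

Definition frame_comb V (T : op M) (D : 'I_n -> op M) (a : sfun V) (b : 'I_n -> sfun V) : op M :=
  fun W g => res V W a * T W g + \sum_i res V W (b i) * D i W g.

Definition contact_comb V (D : 'I_n -> op M) (b : 'I_n -> sfun V) : op M :=
  fun W g => \sum_i res V W (b i) * D i W g.

(** Expansions with coefficients of definite parity: the even and the odd symmetries
are bounded separately, and parity is what halves the number of symbols. *)
Record contact_frame (C : superdistribution M) N (T : op M) (D : 'I_n -> op M) : Prop :=
  ContactFrame {
    frame_T : is_vf N false T;
    frame_D : forall i, is_vf N true (D i);
    frame_span : forall p X, is_vf N p X -> exists a b,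
      [/\ par N p a, forall i, par N (~~ p) (b i) & agree N X (frame_comb T D a b)];
    frame_free : forall V (a : sfun V) (b : 'I_n -> sfun V), open V -> V `<=` N ->
      agree V (frame_comb T D a b) (fun _ _ => 0) -> a = 0 /\ forall i, b i = 0;
    frame_contact : forall p X, is_vf N p X ->
      (C N X <-> exists b, (forall i, par N (~~ p) (b i)) /\ agree N X (contact_comb D b)) }.

Lemma agree_sym U X Y : agree U X Y -> agree U Y X.
Proof. by move=> XY W oW WU f; rewrite XY. Qed.

Lemma agree_trans U X Y Z : agree U X Y -> agree U Y Z -> agree U X Z.
Proof. by move=> XY YZ W oW WU f; rewrite XY // YZ. Qed.

Lemma agree_sub U V X Y : agree U X Y -> V `<=` U -> agree V X Y.
Proof. by move=> XY VU W oW WV; apply: XY => //; exact: subset_trans VU. Qed.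

Section Construction.
Variables (C : superdistribution M) (N : set M) (T : op M) (D : 'I_n -> op M).
Hypothesis oN : open N.
Hypothesis fr : vf_frame N T D.

Lemma vf_frame_free V (a : sfun V) (b : 'I_n -> sfun V) : open V -> V `<=` N ->
  agree V (frame_comb T D a b) (fun _ _ => 0) -> a = 0 /\ forall i, b i = 0.
Proof.
move=> oV VN ab0; case: fr => _ _ /(_ V false _ oV VN (vf_zero hS (U := V) false)).
move=> [af [_ u]]; have u1 := u (a, b) (agree_sym ab0).
have u2 : af = (0, fun _ => 0).
  apply: u => W oW WV g /=; rewrite (res0 hS) // mul0r add0r big1 // => i _.
  by rewrite mul0r.
by move: u1; rewrite u2 => -[-> <-].
Qed.

Lemma frame_comb_par V p q (a : sfun V) (b : 'I_n -> sfun V) W f : open V -> V `<=` N ->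
  par V p a -> (forall i, par V (~~ p) (b i)) -> open W -> W `<=` V -> par W q f ->
  par W (p (+) q) (frame_comb T D a b f).
Proof.
move=> oV VN pa pb oW WV pf; case: fr => Tvf Dvf _.
have WN := subset_trans WV VN; have alg := algP hS oW.
apply: (parD alg).
  by apply: (parM alg); [exact: (res_par hS)|exact: (vf_par Tvf)].
apply: (par_sum alg) => i _.
rewrite -(negbK p) addNb -addbN; apply: (parM alg); first exact: (res_par hS).
by have := vf_par (Dvf i) oW WN pf.
Qed.

(** The expansion of a homogeneous field need not a priori have homogeneous
coefficients; those of the wrong parity give a combination whose values have both
parities, so it is zero. *)
Lemma vf_frame_span p X : is_vf N p X -> exists a b,
  [/\ par N p a, forall i, par N (~~ p) (b i) & agree N X (frame_comb T D a b)].
Proof.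
move=> Xvf; have alg := algP hS oN.
case: fr => _ _ /(_ N p X oN (@subset_refl _ N) Xvf) [[a b] [/= Xab _]].
have [a1 [a2 [pa1 pa2 aE]]] := par_split_p alg p a.
have /choice[b12 bP] i : exists b12 : sfun N * sfun N,
    [/\ par N (~~ p) b12.1, par N p b12.2 & b i = b12.1 + b12.2].
  by have [b1 [b2 [pb1 + bE]]] := par_split_p alg (~~ p) (b i); rewrite negbK; exists (b1, b2).
pose b1 i := (b12 i).1; pose b2 i := (b12 i).2.
have X12 W f : open W -> W `<=` N ->
    X W f = frame_comb T D a1 b1 f + frame_comb T D a2 b2 f.
  move=> oW WN; rewrite Xab // /frame_comb aE (resD hS) // mulrDl addrACA -big_split /=.
  by congr (_ + _); apply: eq_bigr => i _; have [_ _ ->] := bP i; rewrite (resD hS) // mulrDl.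
have rest0 W q f : open W -> W `<=` N -> par W q f -> frame_comb T D a2 b2 f = 0.
  move=> oW WN pf; have algW := algP hS oW; apply: (par_both algW (p := p (+) q)).
    rewrite -[frame_comb _ _ _ _ _](addKr (frame_comb T D a1 b1 f)) -X12 // addrC.
    apply: (parB algW); first exact: (vf_par Xvf).
    apply: frame_comb_par => //.
    by move=> i; have [] := bP i.
  rewrite -addNb; apply: frame_comb_par => //.
  by move=> i; rewrite negbK; have [] := bP i.
exists a1, b1; split=> // [i|W oW WN f]; first by have [] := bP i.
rewrite X12 //; have [f0 [f1 [p0 p1 ->]]] := par_split (algP hS oW) f.
case: (fr) => Tvf Dvf _.
rewrite [X in _ + X](_ : _ = 0) ?addr0 //.
transitivity (frame_comb T D a2 b2 f0 + frame_comb T D a2 b2 f1); last first.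
  by rewrite (rest0 W false) // (rest0 W true) // addr0.
rewrite /frame_comb (vfD Tvf) // mulrDr addrACA -big_split /=; congr (_ + _).
by apply: eq_bigr => i _; rewrite (vfD (Dvf i)) // mulrDr.
Qed.

Hypothesis contactP : forall W p X, open W -> W `<=` N -> is_vf W p X ->
  (C W X <-> exists f : 'I_n -> sfun W, agree W X (contact_comb D f)).

Lemma vf_frame_contact_frame : contact_frame C N T D.
Proof.
case: (fr) => Tvf Dvf _; split=> //.
- exact: vf_frame_span.
- exact: vf_frame_free.
move=> p X Xvf; split=> [|[b [_ Xb]]]; last first.
  by apply/(contactP oN (@subset_refl _ N) Xvf); exists b.
move=> /(contactP oN (@subset_refl _ N) Xvf)[f Xf].
have [a [b [pa pb Xab]]] := vf_frame_span Xvf.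
have : agree N (frame_comb T D a (fun i => b i - f i)) (fun _ _ => 0).
  move=> W oW WN g; transitivity (X W g - X W g); last exact: subrr.
  rewrite {1}Xab // Xf // /frame_comb /contact_comb -addrA -sumrB; congr (_ + _).
  by apply: eq_bigr => i _; rewrite (resD hS) // (resN hS) // mulrBl.
move=> /(vf_frame_free oN (@subset_refl _ N))[_ bf].
have E i : b i = f i by apply/eqP; rewrite -subr_eq0 bf.
by exists f; split=> // i; rewrite -E.
Qed.

End Construction.

Section ChangeOfBasis.
Variables (C : superdistribution M) (N : set M) (T : op M) (D : 'I_n -> op M).
Hypothesis oN : open N.
Hypothesis fr : contact_frame C N T D.

Lemma frame_section i : section C N true (D i).
Proof.
split; first exact: frame_D fr i.
apply/(frame_contact fr (frame_D fr i)); exists (fun j => if j == i then 1 else 0); split.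
  have alg := algP hS oN; move=> j; case: eqP => _; last exact: par0.
  by rewrite -(rmorph1 (csec N)); exact: par_csec.
move=> W oW WN g; rewrite /contact_comb (bigD1 i) //= eqxx big1 ?addr0.
  by rewrite (res1 hS) // mul1r.
by move=> j /negPf ->; rewrite (res0 hS) // mul0r.
Qed.

Variable c : 'M[Cx R]_n.
Hypothesis c_unit : c \in unitmx.

Definition change_basis (i : 'I_n) : op M := fun W f => \sum_j csec W (c i j) * @D j W f.

Lemma csec_comm W (oW : open W) z (f : sfun W) : f * csec W z = csec W z * f.
Proof.
have alg := algP hS oW; have [g [h [pg ph ->]]] := par_split alg f.
case: (alg) => _ _ _ _ cm; rewrite mulrDl mulrDr.
by rewrite (cm _ _ _ _ (par_csec alg z) pg) (cm _ _ _ _ (par_csec alg z) ph) !mul1r.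
Qed.

Lemma contact_comb_change V (b : 'I_n -> sfun V) (d : 'M[Cx R]_n) W (g : sfun W) :
  open V -> V `<=` N -> open W -> W `<=` V ->
  contact_comb change_basis (fun i => \sum_j csec V (d j i) * b j) g =
  \sum_j \sum_k csec W ((d *m c) j k) * (res V W (b j) * @D k W g).
Proof.
move=> oV VN oW WV; rewrite /contact_comb /change_basis.
transitivity (\sum_i \sum_j \sum_k csec W (d j i) * csec W (c i k) * (res V W (b j) * @D k W g)).
  apply: eq_bigr => i _; rewrite (res_sum hS) // mulr_suml; apply: eq_bigr => j _.
  rewrite mulr_sumr; apply: eq_bigr => k _.
  rewrite (resM hS) // (res_csec hS) // -!mulrA; congr (_ * _).
  by rewrite !mulrA (csec_comm oW).
rewrite exchange_big; apply: eq_bigr => j _; rewrite exchange_big; apply: eq_bigr => k _.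
rewrite mxE rmorph_sum mulr_suml; apply: eq_bigr => i _.
by rewrite rmorphM.
Qed.

Lemma contact_comb_changeV V (b : 'I_n -> sfun V) W (g : sfun W) :
  open V -> V `<=` N -> open W -> W `<=` V ->
  contact_comb change_basis (fun i => \sum_j csec V (invmx c j i) * b j) g = contact_comb D b g.
Proof.
move=> oV VN oW WV; rewrite contact_comb_change // mulVmx //.
apply: eq_bigr => j _; rewrite (bigD1 j) //= mxE eqxx rmorph1 mul1r big1 ?addr0 // => k kj.
by rewrite mxE eq_sym (negPf kj) rmorph0 mul0r.
Qed.

Lemma change_basis_vf i : is_vf N true (change_basis i).
Proof.
rewrite /change_basis; elim: (index_enum _) => [|j s IH].
  apply: (is_vf_agree _ (vf_zero hS true)) => W oW WN f.
  by rewrite big_nil.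
apply: (is_vf_agree _ (vf_addP hS
   (vf_smulP hS oN (par_csec (algP hS oN) (c i j)) (frame_D fr j)) IH)) => W oW WN f.
by rewrite big_cons /vf_add /vf_smul (res_csec hS).
Qed.

Lemma par_change V (d : 'M[Cx R]_n) p (b : 'I_n -> sfun V) : open V ->
  (forall i, par V p (b i)) -> forall i, par V p (\sum_j csec V (d j i) * b j).
Proof.
move=> oV pb i; have alg := algP hS oV; apply: (par_sum alg) => j _.
by have := parM alg (par_csec alg (d j i)) (pb j).
Qed.

Lemma change_basis_frame : contact_frame C N T change_basis.
Proof.
have NN := @subset_refl _ N; split.
- exact: frame_T fr.
- exact: change_basis_vf.
- move=> p X Xvf; have [a [b [pa pb Xab]]] := frame_span fr Xvf.
  exists a, (fun i => \sum_j csec N (invmx c j i) * b j); split=> //.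
    exact: par_change.
  move=> W oW WN g; rewrite Xab // /frame_comb; congr (_ + _).
  exact/esym/contact_comb_changeV.
- move=> V a b oV VN ab0.
  pose b' k := \sum_i csec V (c i k) * b i.
  have bE : (fun i => \sum_j csec V (invmx c j i) * b' j) = b.
    apply/funext => i; rewrite /b'.
    transitivity (\sum_k csec V ((c *m invmx c) k i) * b k).
      under eq_bigr do rewrite mulr_sumr; rewrite exchange_big; apply: eq_bigr => k _.
      rewrite mxE rmorph_sum mulr_suml; apply: eq_bigr => j _.
      by rewrite rmorphM mulrA -(rmorphM (csec V)) mulrC rmorphM.
    rewrite mulmxV // (bigD1 i) //= mxE eqxx rmorph1 mul1r big1 ?addr0 // => k ki.
    by rewrite mxE (negPf ki) rmorph0 mul0r.
  have [] := frame_free fr (a := a) (b := b') oV VN.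
    move=> W oW WV g; rewrite -(ab0 W oW WV g) /frame_comb; congr (_ + _).
    rewrite -[RHS]/(contact_comb change_basis b g) -bE.
    exact/esym/contact_comb_changeV.
  move=> -> b'0; split=> // i; rewrite -bE big1 // => j _.
  by rewrite b'0 mulr0.
- move=> p X Xvf; rewrite (frame_contact fr Xvf); split=> -[b [pb Xb]].
    exists (fun i => \sum_j csec N (invmx c j i) * b j); split; first exact: par_change.
    move=> W oW WN g; rewrite Xb //; exact/esym/contact_comb_changeV.
  exists (fun k => \sum_i csec N (c i k) * b i); split; first exact: par_change.
  move=> W oW WN g; rewrite Xb // /contact_comb /change_basis.
  under eq_bigr do rewrite mulr_sumr; rewrite exchange_big; apply: eq_bigr => k _.
  rewrite (res_sum hS) // mulr_suml; apply: eq_bigr => i _.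
  by rewrite (resM hS) // (res_csec hS) // mulrA (csec_comm oW).
Qed.

End ChangeOfBasis.
End Frames.

(** * One-forms on combinations of a frame, and evaluation at a point *)

Section Cofields.
Variables (R : realType) (M : superspace R).
Hypothesis hS : presheaf_of_superalgebras M.
Variables (N : set M) (oN : open N) (q : bool) (al : cofield M).
Hypothesis alP : is_cofield (@tangent _ M) N q al.
Let NN : N `<=` N := @subset_refl _ N.

Lemma cofield_agree p (X Y : op M) : is_vf N p X -> is_vf N p Y -> agree N X Y ->
  al N X = al N Y.
Proof.
by move=> Xvf Yvf XY; have [+ _ _ _ _] := alP oN NN; apply; [split; [exact: Xvf|]|split; [exact: Yvf|]|].
Qed.

Lemma cofield_add p (X Y : op M) : is_vf N p X -> is_vf N p Y ->
  al N (vf_add X Y) = al N X + al N Y.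
Proof. by move=> Xvf Yvf; have [_ _ _ + _] := alP oN NN; apply; split; eauto. Qed.

Lemma cofield_smul p r (f : sfun N) (X : op M) : is_vf N p X -> par N r f ->
  al N (vf_smul f X) = (-1) ^+ (q && r) * (f * al N X).
Proof. by move=> Xvf rf; have [_ _ _ _ +] := alP oN NN; apply; [split; eauto|]. Qed.

Lemma cofield_zero (p : bool) : al N (fun _ _ => 0) = 0.
Proof.
have z := vf_zero hS (U := N) p.
apply: (addIr (al N (fun _ _ => 0))); rewrite add0r -(cofield_add z z).
by apply: (cofield_agree (vf_addP hS z z) z) => W oW WN f; rewrite /vf_add addr0.
Qed.

Lemma cofield_sum n (D : 'I_n -> op M) r (b : 'I_n -> sfun N) (s : seq 'I_n) :
  (forall i, is_vf N true (D i)) -> (forall i, par N r (b i)) ->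
  is_vf N (~~ r) (fun W g => \sum_(i <- s) res N W (b i) * D i W g) /\
  al N (fun W g => \sum_(i <- s) res N W (b i) * D i W g) =
  \sum_(i <- s) (-1) ^+ (q && r) * (b i * al N (D i)).
Proof.
move=> Dvf rb; elim: s => [|i s [IHvf IH]].
  have e : agree N (fun _ _ => 0) (fun W g => \sum_(i <- [::]) res N W (b i) * D i W g).
    by move=> W oW WN g; rewrite big_nil.
  have z := vf_zero hS (U := N) (~~ r); have z' := is_vf_agree e z.
  by split=> //; rewrite -(cofield_agree z z' e) big_nil (cofield_zero (~~ r)).
have svf : is_vf N (~~ r) (vf_smul (b i) (D i)).
  by have := vf_smulP hS oN (rb i) (Dvf i); rewrite addbT.
have e : agree N (vf_add (vf_smul (b i) (D i)) (fun W g => \sum_(i <- s) res N W (b i) * D i W g))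
    (fun W g => \sum_(i <- i :: s) res N W (b i) * D i W g).
  by move=> W oW WN g; rewrite big_cons.
have a := vf_addP hS svf IHvf; have a' := is_vf_agree e a.
split=> //; rewrite -(cofield_agree a a' e) (cofield_add svf IHvf) IH big_cons.
by rewrite (cofield_smul (Dvf i) (rb i)).
Qed.

Lemma cofield_contact_comb n (D : 'I_n -> op M) r (b : 'I_n -> sfun N) :
  (forall i, is_vf N true (D i)) -> (forall i, par N r (b i)) ->
  al N (contact_comb D b) = \sum_i (-1) ^+ (q && r) * (b i * al N (D i)).
Proof. by move=> Dvf rb; have [_ ->] := cofield_sum (index_enum _) Dvf rb. Qed.

Lemma contact_comb_vf n (D : 'I_n -> op M) r (b : 'I_n -> sfun N) :
  (forall i, is_vf N true (D i)) -> (forall i, par N r (b i)) ->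
  is_vf N (~~ r) (contact_comb D b).
Proof. by move=> Dvf rb; have [+ _] := cofield_sum (index_enum _) Dvf rb. Qed.

Lemma cofield_frame_comb n (T : op M) (D : 'I_n -> op M) r (a : sfun N) (b : 'I_n -> sfun N) :
  is_vf N false T -> (forall i, is_vf N true (D i)) -> par N (~~ r) a -> (forall i, par N r (b i)) ->
  al N (frame_comb T D a b) = (-1) ^+ (q && ~~ r) * (a * al N T) +
    \sum_i (-1) ^+ (q && r) * (b i * al N (D i)).
Proof.
move=> Tvf Dvf ra rb.
have svf : is_vf N (~~ r) (vf_smul a T).
  by have := vf_smulP hS oN ra Tvf; rewrite addbF.
have cvf := contact_comb_vf Dvf rb.
rewrite -(cofield_contact_comb Dvf rb) -(cofield_smul Tvf ra) -(cofield_add svf cvf).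
apply: (cofield_agree _ (vf_addP hS svf cvf)) => //.
exact: (is_vf_agree _ (vf_addP hS svf cvf)).
Qed.

End Cofields.

Section BodyEvaluation.
Variables (R : realType) (M : superspace R) (n : nat) (N : set M).
Variables (phi : M -> Cx R) (Phi : forall W : set M, sfun W -> {set 'I_n} -> Cx R -> Cx R).
Hypothesis chart : superchart N phi Phi.
Variables (y : M) (Ny : N y).

Fact body_eval_zmod : zmod_morphism (body_eval phi Phi y : sfun N -> Cx R).
Proof.
move=> f g; apply: (addIr (body_eval phi Phi y g)).
by rewrite -(body_evalD chart _ _ Ny) !subrK.
Qed.

Fact body_eval_monoid : monoid_morphism (body_eval phi Phi y : sfun N -> Cx R).
Proof.
split=> [|f g]; last exact: (body_evalM chart).
by rewrite -(rmorph1 (csec N)) (body_eval_csec chart).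
Qed.

Definition body_morphism : {rmorphism sfun N -> Cx R} :=
  HB.pack (body_eval phi Phi y : sfun N -> Cx R)
    (GRing.isZmodMorphism.Build _ _ _ body_eval_zmod)
    (GRing.isMonoidMorphism.Build _ _ _ body_eval_monoid).

End BodyEvaluation.

(** * Frames dual to a conformal coframe at a point *)

Section OddCoordinates.
Variables (R : realType) (M : superspace R) (n : nat) (N : set M).
Variables (phi : M -> Cx R) (Phi : forall W : set M, sfun W -> {set 'I_n} -> Cx R -> Cx R).
Hypothesis chart : superchart N phi Phi.

(** The coordinate xi_i, given by its only nonzero coefficient. *)
Lemma odd_coordinate_exists i : exists2 xi : sfun N, par N true xi &
  forall y l dxi, N y -> is_odd_coordinate_field N phi Phi l dxi ->
    body_eval phi Phi y (dxi N xi) = (l == i)%:R.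
Proof.
have oN := chart_open chart; have NN := @subset_refl _ N.
pose a (I : {set 'I_n}) (z : Cx R) : Cx R := (I == [set i]%SET)%:R.
have aE I z : (phi @` N) z -> Phi (of_coef phi Phi N a) I z = a I z.
  by apply: (of_coefE chart) => // J; exact: hol_cst.
exists (of_coef phi Phi N a).
  apply/(chart_par chart true _ oN NN) => I Iodd z Nz; rewrite aE // /a.
  by case: eqP => // e; rewrite e cards1 in Iodd.
move=> y l dxi Ny dxiE; have Nz : (phi @` N) (phi y) by exists y.
rewrite /body_eval (@dxiE N _ _ _ oN NN Nz) /odd_partial inE (aE _ _ Nz).
by rewrite /below big_set0 expr0 mul1r /a finset.setU0 (inj_eq (@finset.set1_inj _)).
Qed.

End OddCoordinates.

Section Point.
Variables (R : realType) (M : superspace R).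
Hypothesis hS : presheaf_of_superalgebras M.
Variables (N : set M).
Variables (phi : M -> Cx R) (Phi : forall W : set M, sfun W -> {set 'I_8} -> Cx R -> Cx R).
Hypothesis chart : superchart N phi Phi.
Variables (C : superdistribution M) (om th : 'I_4 -> cofield M) (T : op M).
Hypothesis cf : conformal_coframe C N om th.
Variables (x : M) (Nx : N x).

Let oN : open N := chart_open chart.
Let NN : N `<=` N := @subset_refl _ N.
Let ev := body_morphism chart Nx.

Definition coframe (k : 'I_8) : cofield M :=
  if (k < 4)%N then om (inord k) else th (inord (k - 4)).

Lemma coframe_l (k : 'I_4) : coframe (lshift 4 k) = om k.
Proof. by rewrite /coframe /= ltn_ord inord_val. Qed.

Lemma coframe_r (k : 'I_4) : coframe (rshift 4 k) = th k.
Proof. by rewrite /coframe /= addKn inord_val. Qed.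

Lemma dual_l (k : 'I_4) : dual (lshift 4 k) = rshift 4 k.
Proof. by apply: val_inj; rewrite /= addnC modn_small // (ltn_add2l 4 k 4). Qed.

Lemma dual_r (k : 'I_4) : dual (rshift 4 k) = lshift 4 k.
Proof. by rewrite -dual_l dualK. Qed.

Lemma coframe_cofield k : is_cofield (@tangent _ M) N true (coframe k).
Proof. by case: cf => H _; rewrite /coframe; case: ifP => _; [exact: (H _).1|exact: (H _).2]. Qed.

Lemma sum_wedge (K : nmodType) (F : 'I_8 -> 'I_8 -> K) :
  \sum_(k < 4) (F (lshift 4 k) (rshift 4 k) + F (rshift 4 k) (lshift 4 k)) =
  \sum_(k < 8) F (dual k) k.
Proof.
rewrite [RHS](@big_split_ord _ _ _ 4 4) /= big_split addrC; congr (_ + _);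
by apply: eq_bigr => k _; rewrite ?dual_l ?dual_r.
Qed.

Lemma ev_odd f : par N true f -> ev f = 0.
Proof. exact: (body_eval_odd chart). Qed.

Lemma ev_twist f : ev (parity_twist f) = ev f.
Proof.
have alg := algP hS oN; have [g [h [pg ph ->]]] := par_split alg f.
by rewrite (parity_twistE alg) // rmorphB rmorphD (ev_odd ph) subr0 addr0.
Qed.

Section Frame.
Variable D : 'I_8 -> op M.
Hypothesis fr : contact_frame C N T D.

Lemma ev_wedge (X Y : op M) :
  ev (\sum_(k < 4) odd_wedge (om k) (th k) true X Y N) =
  - \sum_(k < 8) ev (coframe (dual k) N X) * ev (coframe k N Y).
Proof.
rewrite rmorph_sum -(sum_wedge (fun k l => ev (coframe k N X) * ev (coframe l N Y))) -sumrN.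
apply: eq_bigr => k _; rewrite !coframe_l !coframe_r /odd_wedge expr1 mulN1r rmorphN.
by rewrite rmorphD !rmorphM.
Qed.

Definition pairing : 'M[Cx R]_8 := \matrix_(k, j) ev (coframe k N (D j)).

(** The odd coordinate fields are combinations of the frame, and at a point the
even field T contributes nothing, T xi_i being odd. *)
Lemma frame_jacobian_unit (xi : 'I_8 -> sfun N) :
  (forall i l dxi, is_odd_coordinate_field N phi Phi l dxi ->
     ev (dxi N (xi i)) = (l == i)%:R) -> (forall i, par N true (xi i)) ->
  \matrix_(i, j) ev (D j (xi i)) \in unitmx.
Proof.
move=> xiE xi_odd.
have /choice[b bE] l : exists b : 'I_8 -> sfun N, forall i,
    \sum_j ev (b j) * ev (D j (xi i)) = (l == i)%:R.
  have [dxi [dxi_vf dxiE]] := odd_coordinate_field_exists chart l.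
  have [a [b [pa pb ab]]] := frame_span fr dxi_vf; exists b => i.
  rewrite -(xiE i l dxi dxiE) ab // /frame_comb rmorphD rmorphM [X in _ = _ * X + _]ev_odd.
    rewrite mulr0 add0r rmorph_sum; apply: eq_bigr => j _.
    by rewrite rmorphM (res_id hS).
  by have := vf_par (frame_T fr) oN NN (xi_odd i).
have : \matrix_(i, j) ev (D j (xi i)) *m (\matrix_(l, j) ev (b l j))^T = 1%:M.
  apply/matrixP => i l; rewrite !mxE eq_sym -(bE l i); apply: eq_bigr => j _.
  by rewrite !mxE mulrC.
by move=> /mulmx1_unit[].
Qed.

(** The differential of xi; the twist supplies the sign that linearity asks of an odd
cofield. *)
Lemma differential_cofield (xi : sfun N) : par N true xi ->
  is_cofield C N true (fun W Y => parity_twist (Y W (res N W xi))).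
Proof.
move=> xi_odd W oW WN; have alg := algP hS oW.
have xiW := res_par hS oN oW WN xi_odd; split.
- by move=> p X Y _ _ XY; rewrite XY.
- move=> p X V [Xvf _] oV VW; rewrite (res_twist hS) // (vf_res Xvf) //.
  by rewrite (res_comp hS).
- move=> p X [Xvf _]; have pX := vf_par Xvf oW (@subset_refl _ W) xiW.
  by rewrite (parity_twist_par alg pX); exact: par_sign.
- by move=> p X Y [Xvf _] [Yvf _]; rewrite /vf_add (parity_twistD alg).
- move=> p r f X [Xvf _] rf; rewrite /vf_smul (res_id hS) //.
  by rewrite (parity_twist_mul alg _ rf).
Qed.

(** Nondegeneracy is a statement about sections; to use it at the point, apply it to
the differentials of the odd coordinates. Each is d sg (X, -) for some X, hence at
the point a combination of the coframe, so the invertible matrix D_j xi_i factors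
through the pairing. *)
Lemma pairing_unit : pairing \in unitmx.
Proof.
have /choice[xi xiP] i : exists xi : sfun N, par N true xi /\
    forall l dxi, is_odd_coordinate_field N phi Phi l dxi ->
    ev (dxi N xi) = (l == i)%:R.
  have [xi xi_odd xiE] := odd_coordinate_exists chart i.
  by exists xi; split=> // l dxi dxiE; exact: xiE.
have Junit := @frame_jacobian_unit xi (fun i => (xiP i).2) (fun i => (xiP i).1).
case: cf => _ [sg [la [la' [[sgP sgC nondeg] la_even lala' dsg]]]].
have /choice[U UE] i : exists u : 'I_8 -> Cx R, forall j,
    ev (D j (xi i)) = \sum_k u k * pairing k j.
  have [X [Xs dX] _] := nondeg N true _ oN NN (differential_cofield (xiP i).1).
  exists (fun k => - ev la * ev (coframe (dual k) N X)) => j.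
  have := dX N true (D j) oN NN (frame_section hS oN fr j).
  rewrite (dsg N true true) // ?(res_id hS) //; last exact: (frame_section hS oN fr).
  move=> /(congr1 ev); rewrite ev_twist rmorphM ev_wedge => <-.
  rewrite mulrN -mulNr mulr_sumr; apply: eq_bigr => k _.
  by rewrite mxE mulrA.
have e : \matrix_(i, j) ev (D j (xi i)) = (\matrix_(i, k) U i k) *m pairing.
  apply/matrixP => i j; rewrite !mxE UE; apply: eq_bigr => k _.
  by rewrite !mxE.
by move: Junit; rewrite e unitmx_mul => /andP[].
Qed.

End Frame.

(** A change of basis with constant coefficients is enough, since the duality is asked
at one point only. *)
Lemma adapted_frame_exists (D0 : 'I_8 -> op M) : contact_frame C N T D0 ->
  exists D, contact_frame C N T D /\
    forall k i, ev (coframe k N (D i)) = (k == i)%:R.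
Proof.
move=> fr0; have unit := pairing_unit fr0.
pose c := (invmx (pairing D0))^T.
have cu : c \in unitmx by rewrite unitmx_tr unitmx_inv.
exists (change_basis D0 c); split; first exact: change_basis_frame.
move=> k i.
have ag : agree N (contact_comb D0 (fun j => csec N (c i j))) (change_basis D0 c i).
  by move=> W oW WN g; apply: eq_bigr => j _; rewrite (res_csec hS).
have pc j : par N false (csec N (c i j)) by exact: (par_csec (algP hS oN)).
have vf1 := contact_comb_vf hS oN (coframe_cofield k) (frame_D fr0) pc.
rewrite -(cofield_agree oN (coframe_cofield k) vf1 (is_vf_agree ag vf1) ag).
rewrite (cofield_contact_comb hS oN (coframe_cofield k) (frame_D fr0) pc) rmorph_sum.
transitivity ((pairing D0 *m invmx (pairing D0)) k i).
  rewrite mxE; apply: eq_bigr => j _.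
  rewrite andbF expr0 mul1r rmorphM [X in X * _](body_eval_csec chart) //.
  by rewrite !mxE mulrC.
by rewrite mulmxV // mxE.
Qed.

End Point.

(** * The bracket of a field with the frame *)

Section BracketCoefficients.
Variables (R : realType) (M : superspace R).
Hypothesis hS : presheaf_of_superalgebras M.
Variables (n : nat) (N : set M) (oN : open N).
Variables (C : superdistribution M) (T : op M) (D : 'I_n -> op M).
Hypothesis fr : contact_frame C N T D.

(** The second-order terms x1 and y occur on both sides of the bracket and cancel. *)
Lemma commutator_regroup (A : zmodType) (x1 x2 x3 y y2 y3 d1 d2 : A) :
  (x1 + (x2 + x3)) + ((y2 + y3) - y) - ((d1 + d2) + (x1 - y)) =
  (x2 + y2 - d1) + (x3 + y3 - d2).
Proof.
rewrite (addrC x1) (addrACA (x2 + x3)) opprD (addrACA (x2 + x3 + _)) subrr addr0.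
by rewrite (addrACA x2) opprD (addrACA (x2 + y2)).
Qed.

(** In [X, D_j] the derivatives of the coefficients a and b_i come from D_j alone, and
the remaining terms are the brackets of the frame fields, taken with the
coefficients. *)
Lemma bracket_frame_comb p (X : op M) (a : sfun N) (b : 'I_n -> sfun N)
    (j : 'I_n) (t : sfun N) (s : 'I_n -> sfun N) (H : 'I_n -> sfun N) (c : 'I_n -> 'I_n -> sfun N) :
  par N p a -> (forall i, par N (~~ p) (b i)) ->
  agree N X (frame_comb T D a b) ->
  agree N (bracket false true T (D j)) (frame_comb T D t s) ->
  (forall i, agree N (bracket true true (D i) (D j)) (frame_comb T D (H i) (c i))) ->
  agree N (bracket p true X (D j))
    (frame_comb T D (a * t + \sum_i b i * H i - (-1) ^+ p * D j a)
       (fun k => a * s k + \sum_i b i * c i k - (-1) ^+ p * D j (b k))).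
Proof.
move=> pa pb Xab Tj Dj W oW WN g.
have Dvf := frame_D fr; have Tvf := frame_T fr.
have paW := res_par hS oN oW WN pa.
have pbW i := res_par hS oN oW WN (pb i).
have TDg : T (D j g) = D j (T g) + (res N W t * T g + \sum_k res N W (s k) * D k g).
  have := Tj W oW WN g; rewrite /bracket /frame_comb expr0 mul1r => <-.
  by rewrite addrC subrK.
have DDg i : D i (D j g) = (res N W (H i) * T g + \sum_k res N W (c i k) * D k g)
    - D j (D i g).
  have := Dj i W oW WN g; rewrite /bracket /frame_comb expr1 mulN1r opprK => <-.
  by rewrite addrK.
pose a' := res N W a; pose b' i := res N W (b i).
have DX : D j (X W g) = (D j a' * T g + \sum_i D j (b' i) * D i g)
    + (-1) ^+ p * (a' * D j (T g) - \sum_i b' i * D j (D i g)).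
  rewrite Xab // /frame_comb (vfD (Dvf j)) // (vf_sum (Dvf j)) //.
  rewrite (vfM (Dvf j) oW WN _ paW) /= mulrBr addrACA mulr_sumr -sumrN -big_split /=.
  congr (_ + _); apply: eq_bigr => i _; rewrite (vfM (Dvf j) oW WN _ (pbW i)) /=.
  by rewrite !mulr_sign; case: (p); rewrite ?opprK.
have XD : X W (D j g) = (a' * D j (T g) + (a' * (res N W t * T g) +
      \sum_k a' * (res N W (s k) * D k g))) +
    ((\sum_i b' i * (res N W (H i) * T g) + \sum_k \sum_i b' i * (res N W (c i k) * D k g))
     - \sum_i b' i * D j (D i g)).
  rewrite Xab // /frame_comb TDg !mulrDr mulr_sumr; congr (_ + _).
  rewrite exchange_big -!sumrN -!big_split /=; apply: eq_bigr => i _.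
  by rewrite DDg mulrBr mulrDr mulr_sumr.
have sgn : (-1) ^+ p * D j (X W g) = ((-1) ^+ p * (D j a' * T g) +
    \sum_i (-1) ^+ p * (D j (b' i) * D i g)) + (a' * D j (T g) - \sum_i b' i * D j (D i g)).
  by rewrite DX mulrDr mulrA -expr2 sqrr_sign mul1r mulrDr mulr_sumr.
rewrite /bracket andbT sgn XD commutator_regroup /frame_comb.
have Da : res N W (D j a) = D j a' by rewrite (vf_res (Dvf j)).
have Db i : res N W (D j (b i)) = D j (b' i) by rewrite (vf_res (Dvf j)).
congr (_ + _).
  rewrite (resD hS) // (resN hS) // (res_sign hS) // (resD hS) // (resM hS) // Da.
  rewrite mulrBl mulrDl !mulrA (res_sum hS) // mulr_suml; congr (_ + _ - _).
  by apply: eq_bigr => i _; rewrite (resM hS) // mulrA.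
rewrite -sumrN -!big_split /=; apply: eq_bigr => k _.
rewrite (resD hS) // (resN hS) // (res_sign hS) // (resD hS) // (resM hS) // Db.
rewrite mulrBl mulrDl !mulrA (res_sum hS) // mulr_suml; congr (_ + _ - _).
by apply: eq_bigr => i _; rewrite (resM hS) // mulrA.
Qed.

End BracketCoefficients.

(** * Levi form and quartic in an adapted frame *)

Section AdaptedFrame.
Variables (R : realType) (M : superspace R).
Hypothesis hS : presheaf_of_superalgebras M.
Variables (N : set M).
Variables (phi : M -> Cx R) (Phi : forall W : set M, sfun W -> {set 'I_8} -> Cx R -> Cx R).
Hypothesis chart : superchart N phi Phi.
Variables (C : superdistribution M) (om th : 'I_4 -> cofield M) (T : op M) (D : 'I_8 -> op M).
Hypothesis cf : conformal_coframe C N om th.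
Variables (x : M) (Nx : N x).
Hypothesis fr : contact_frame C N T D.

Let oN : open N := chart_open chart.
Let NN : N `<=` N := @subset_refl _ N.
Let ev := body_morphism chart Nx.

Hypothesis adapted : forall k i, ev (coframe om th k N (D i)) = (k == i)%:R.

Lemma par_before_true : (\sum_(j < 4) par_before (fun=> true) j)%N = 6.
Proof.
have E (j : 'I_4) : par_before (fun=> true) j = j.
  rewrite /par_before big_mkcond !big_ord_recl big_ord0.
  by case: j => [[|[|[|[|]]]] ?].
by under eq_bigr do rewrite E; rewrite !big_ord_recl big_ord0.
Qed.

Lemma ev_odd_prod4 (m : 4.-tuple nat) (al : 'I_4 -> 'I_8) :
  all (fun k => k < 8)%N m ->
  ev (odd_prod4 [tuple of map (fun k : nat => coframe om th (inZp k)) m] N (fun=> true)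
     (fun i => D (al i))) = (wedge_int m (fun i => al (inZp i)))%:~R.
Proof.
move=> /all_tnthP m8; rewrite /odd_prod4 par_before_true -signr_odd expr0 mul1r rmorph_sum.
rewrite -det_wedge /determinant; apply: eq_bigr => s _.
rewrite rmorphM rmorph_sign rmorph_prod; congr (_ * _); apply: eq_bigr => i _.
rewrite mxE tnth_map adapted -val_eqE /= modn_small ?m8 // eq_sym.
by rewrite (tnth_nth 0%N).
Qed.

Lemma ev_quartic (al : 'I_4 -> 'I_8) :
  ev (F4_quartic om th N (fun=> true) (fun i => D (al i))) = quartic (Cx R) al.
Proof.
have E a b c d (ca cb cc cd : cofield M) : all (fun k => k < 8)%N [:: a; b; c; d] ->
    ca = coframe om th (inZp a) -> cb = coframe om th (inZp b) ->
    cc = coframe om th (inZp c) -> cd = coframe om th (inZp d) ->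
    ev (odd_prod4 [tuple ca; cb; cc; cd] N (fun=> true) (fun i => D (al i))) =
    (wedge_int [:: a; b; c; d] (fun i => al (inZp i)))%:~R.
  move=> abcd -> -> -> ->; rewrite -(@ev_odd_prod4 [tuple a; b; c; d]) //.
  by congr (ev (odd_prod4 _ _ _ _)); exact: val_inj.
have o k : (k < 4)%N -> om (inord k) = coframe om th (inZp k).
  by move=> k4; rewrite /coframe /= modn_small ?k4 // (leq_trans k4).
have t k : (k < 4)%N -> th (inord k) = coframe om th (inZp (k + 4)).
  move=> k4; rewrite /coframe /= modn_small; last by rewrite (ltn_add2r 4 k 4).
  by rewrite ltnNge leq_addl /= addnK.
have intrE (w1 w2 w3 w4 w5 w6 w7 w8 : int) :
    (w1 + w2 + w3 - w4 *+ 2 - w5 - w6 - w7 + w8 *+ 2)%:~R = w1%:~R + w2%:~R + w3%:~R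
      - w4%:~R *+ 2 - w5%:~R - w6%:~R - w7%:~R + w8%:~R *+ 2 :> Cx R.
  by rewrite !(rmorphB, rmorphD, rmorphMn).
rewrite /F4_quartic; cbv beta zeta; rewrite !(rmorphB, rmorphD, rmorphMn).
rewrite /quartic /quartic_int; cbv beta zeta; rewrite intrE.
congr (_ + _ + _ - _ *+ 2 - _ - _ - _ + _ *+ 2); apply: E => //;
  by [exact: o | exact: t].
Qed.

Lemma structure_functions : exists (H : 'I_8 -> 'I_8 -> sfun N) (c : 'I_8 -> 'I_8 -> 'I_8 -> sfun N),
  [/\ forall i j, par N false (H i j), forall i j k, par N true (c i j k) &
   forall i j, agree N (bracket true true (D i) (D j)) (frame_comb T D (H i j) (c i j))].
Proof.
have ex i j : exists Hc : sfun N * ('I_8 -> sfun N), [/\ par N false Hc.1,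
    forall k, par N true (Hc.2 k) &
    agree N (bracket true true (D i) (D j)) (frame_comb T D Hc.1 Hc.2)].
  have [H [c [pH pc Hc]]] := frame_span fr (vf_bracketP hS (frame_D fr i) (frame_D fr j)).
  by exists (H, c).
pose f i := projT1 (choice (ex i)); have fP i := projT2 (choice (ex i)).
exists (fun i j => (f i j).1), (fun i j => (f i j).2).
by split=> i j; have [] := fP i j.
Qed.

Lemma transverse_functions : exists (t : 'I_8 -> sfun N) (s : 'I_8 -> 'I_8 -> sfun N),
   forall j, agree N (bracket false true T (D j)) (frame_comb T D (t j) (s j)).
Proof.
have /choice[f fP] j : exists ts : sfun N * ('I_8 -> sfun N),
    agree N (bracket false true T (D j)) (frame_comb T D ts.1 ts.2).
  have [t [s [_ _ ts]]] := frame_span fr (vf_bracketP hS (frame_T fr) (frame_D fr j)).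
  by exists (t, s).
by exists (fun j => (f j).1), (fun j => (f j).2).
Qed.

(** For sections X, Y of C, d sg (X, Y) = - sg [X, Y], and sg annihilates the D_k;
so the Levi form in the frame is the matrix of d sg, up to the invertible factors
la and sg T. That sg T does not vanish at the point follows from the same formula. *)
Lemma ev_levi H c :
  (forall i j, par N false (H i j)) -> (forall i j k, par N true (c i j k)) ->
  (forall i j, agree N (bracket true true (D i) (D j)) (frame_comb T D (H i j) (c i j))) ->
  exists2 tau : Cx R, tau != 0 & forall i j, ev (H i j) = tau * (levi i j)%:R.
Proof.
move=> pH pc Hc; case: (cf) => _ [sg [la [la' [[sgP sgC nondeg] la_even lala' dsg]]]].
have key i j : ev (H i j) * ev (sg N T) = ev la * (levi i j)%:R.
  have Dvf := frame_D fr; have Tvf := frame_T fr.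
  have sD k : sg N (D k) = 0 by apply/(sgC N true _ oN NN (Dvf k)); case: (frame_section hS oN fr k).
  have Bvf := vf_bracketP hS (Dvf i) (Dvf j).
  have := dsg N true true (D i) (D j) oN NN (frame_section hS oN fr i) (frame_section hS oN fr j).
  rewrite /even_form_d !sD (vf0 (Dvf i)) // (vf0 (Dvf j)) // mulr0 subrr sub0r.
  rewrite (cofield_agree oN sgP Bvf (is_vf_agree (Hc i j) Bvf) (Hc i j)).
  rewrite (cofield_frame_comb (r := true) hS oN sgP Tvf Dvf (pH i j) (pc i j)) /= mul1r.
  rewrite big1 ?addr0 => [|k _]; last by rewrite sD mulr0 mulr0.
  rewrite (res_id hS) // => /(congr1 ev); rewrite rmorphN !rmorphM ev_wedge.
  rewrite mulrN => /oppr_inj ->; congr (_ * _).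
  rewrite (bigD1 j) // big1 ?addr0 => [|k /andP[_ kj]]; last by rewrite !adapted (negPf kj) mulr0.
  by rewrite !adapted eqxx mulr1 levi_sym /levi [in RHS]eq_sym; exact: addr0.
have la0 : ev la != 0.
  apply/eqP => la0; have : ev (la * la') = 0 by rewrite rmorphM la0 mul0r.
  by rewrite lala' rmorph1 => /eqP; rewrite oner_eq0.
have s0 : ev (sg N T) != 0.
  apply: contra_neq la0 => s0; have := key (zz false) (zz true).
  by rewrite s0 mulr0 leviE mulr1.
exists (ev la / ev (sg N T)); first by rewrite mulf_neq0 // invr_neq0.
by move=> i j; rewrite mulrAC -key mulfK.
Qed.

End AdaptedFrame.

(** * The quartic tensor on combinations of the frame *)

Section Tensor.
Variables (R : realType) (M : superspace R).
Hypothesis hS : presheaf_of_superalgebras M.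
Variables (N : set M) (oN : open N).
Variables (C : superdistribution M) (T : op M) (n : nat) (D : 'I_n -> op M).
Hypothesis fr : contact_frame C N T D.
Variable Qt : tensor4 M.
Hypothesis Qsym : is_even_supersym4 C Qt.
Let alg := algP hS oN.

Lemma section_zero p : section C N p (fun _ _ => 0).
Proof.
split; first exact: vf_zero.
apply/(frame_contact fr (vf_zero hS p)); exists (fun _ => 0); split; first by move=> i; exact: (par0 alg).
by move=> W oW WN g; rewrite /contact_comb big1 // => i _; rewrite (res0 hS) // mul0r.
Qed.

Lemma section_add p X Y : section C N p X -> section C N p Y -> section C N p (vf_add X Y).
Proof.
move=> [Xvf CX] [Yvf CY]; have XYvf := vf_addP hS Xvf Yvf; split=> //.
have [b [pb Xb]] := (frame_contact fr Xvf).1 CX.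
have [b' [pb' Yb']] := (frame_contact fr Yvf).1 CY.
apply/(frame_contact fr XYvf); exists (fun i => b i + b' i); split.
  by move=> i; exact: (parD alg).
move=> W oW WN g; rewrite /vf_add Xb // Yb' // /contact_comb -big_split /=.
by apply: eq_bigr => i _; rewrite (resD hS) // mulrDl.
Qed.

Lemma section_smul p r f i : par N r f -> p = ~~ r -> section C N p (vf_smul f (D i)).
Proof.
move=> rf ->; have svf : is_vf N (~~ r) (vf_smul f (D i)).
  by have := vf_smulP hS oN rf (frame_D fr i); rewrite addbT.
split=> //; apply/(frame_contact fr svf); exists (fun j => if j == i then f else 0); split.
  by move=> j; rewrite negbK; case: eqP => // _; exact: (par0 alg).
move=> W oW WN g; rewrite /contact_comb (bigD1 i) //= eqxx big1 ?addr0 //.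
by move=> j /negPf ->; rewrite (res0 hS) // mul0r.
Qed.

Lemma subst_at_id (Y : 'I_4 -> op M) m X Z : subst_at (subst_at Y m X) m Z = subst_at Y m Z.
Proof. by apply/funext => j; rewrite /subst_at; case: eqP. Qed.

Section Slot.
Variables (al : 'I_4 -> 'I_n) (m : 'I_4) (p : bool).
Let Y (i : 'I_4) := D (al i).
Let pv (i : 'I_4) := if i == m then p else true.

Lemma subst_section X : section C N p X -> forall i, section C N (pv i) (subst_at Y m X i).
Proof. by move=> Xs i; rewrite /pv /subst_at; case: eqP => // _; exact: (frame_section hS oN fr). Qed.

Lemma tensor_agree X Z : section C N p X -> section C N p Z -> agree N X Z ->
  Qt N (subst_at Y m X) = Qt N (subst_at Y m Z).
Proof.
move=> Xs Zs XZ; have [+ _ _ _ _] := Qsym oN (subst_section Xs).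
apply; first exact: subst_section.
by move=> i; rewrite /subst_at; case: eqP.
Qed.

Lemma tensor_add X Z : section C N p X -> section C N p Z ->
  Qt N (subst_at Y m (vf_add X Z)) = Qt N (subst_at Y m X) + Qt N (subst_at Y m Z).
Proof.
move=> Xs Zs; have [_ _ _ [+ _] _] := Qsym oN (subst_section Xs).
have Zs' : section C N (pv m) Z by rewrite /pv eqxx.
move=> /(_ m Z Zs'); rewrite !subst_at_id => <-; congr (Qt N (subst_at _ _ _)).
by rewrite /subst_at eqxx.
Qed.
End Slot.

Lemma tensor_smul al m r f k : par N r f ->
  Qt N (subst_at (fun i => D (al i)) m (vf_smul f (D k))) =
  (-1) ^+ (r * par_before (fun=> true) m) * (f * Qt N (fun i => D (replace al m k i))).
Proof.
move=> rf; have Ds i : section C N true (D (replace al m k i)) by exact: (frame_section hS oN fr).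
have [_ _ _ [_ +] _] := @Qsym N (fun=> true) _ oN Ds.
move=> /(_ m r f rf) <-; congr (Qt N _); apply/funext => j.
by rewrite /subst_at /replace eqxx; case: eqP.
Qed.

(** The tensor is additive on homogeneous sections of one parity, and the induction
on the sum has to carry the fact that the partial sums are such sections. *)
Lemma tensor_contact_comb al m p (f : 'I_n -> sfun N) : (forall k, par N p (f k)) ->
  Qt N (subst_at (fun i => D (al i)) m (contact_comb D f)) =
  \sum_k (-1) ^+ (p * par_before (fun=> true) m) * (f k * Qt N (fun i => D (replace al m k i))).
Proof.
move=> pf; rewrite /contact_comb.
suff H (s : seq 'I_n) : section C N (~~ p) (fun W g => \sum_(i <- s) res N W (f i) * D i g) /\
    Qt N (subst_at (fun i => D (al i)) m (fun W g => \sum_(i <- s) res N W (f i) * D i g)) =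
    \sum_(k <- s) (-1) ^+ (p * par_before (fun=> true) m) *
      (f k * Qt N (fun i => D (replace al m k i))) by have [_ ->] := H (index_enum _).
elim: s => [|k s [IHs IH]].
  rewrite [RHS]big_nil.
  have e : (fun W (g : sfun W) => \sum_(i <- [::]) res N W (f i) * D i g) = (fun _ _ => 0).
    by apply/functional_extensionality_dep => W; apply/funext => g; rewrite big_nil.
  rewrite e; split; first exact: section_zero.
  apply: (addIr (Qt N (subst_at (fun i => D (al i)) m (fun _ _ => 0)))).
  have z := section_zero (~~ p); rewrite add0r -(tensor_add al m z z).
  by apply: (tensor_agree al m (section_add z z) z) => W oW WN g; rewrite /vf_add addr0.
have e : (fun W (g : sfun W) => \sum_(i <- k :: s) res N W (f i) * D i g) =
    vf_add (vf_smul (f k) (D k)) (fun W g => \sum_(i <- s) res N W (f i) * D i g).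
  by apply/functional_extensionality_dep => W; apply/funext => g; rewrite big_cons.
have ks := section_smul k (pf k) erefl.
rewrite e big_cons (tensor_add al m ks IHs) IH (tensor_smul _ _ _ (pf k)); split=> //.
exact: section_add.
Qed.

End Tensor.

(** * The equations of a symmetry *)

Section SymmetryEquations.
Variables (R : realType) (M : superspace R).
Hypothesis hS : presheaf_of_superalgebras M.
Variables (N : set M) (oN : open N).
Variables (C : superdistribution M) (T : op M) (D : 'I_8 -> op M).
Hypothesis fr : contact_frame C N T D.
Variable Qt : tensor4 M.
Hypothesis Qsym : is_even_supersym4 C Qt.
Let NN : N `<=` N := @subset_refl _ N.
Let alg := algP hS oN.

Variables (H : 'I_8 -> 'I_8 -> sfun N) (c : 'I_8 -> 'I_8 -> 'I_8 -> sfun N).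
Hypothesis Hc : forall i j, agree N (bracket true true (D i) (D j)) (frame_comb T D (H i j) (c i j)).
Variables (t : 'I_8 -> sfun N) (s : 'I_8 -> 'I_8 -> sfun N).
Hypothesis ts : forall j, agree N (bracket false true T (D j)) (frame_comb T D (t j) (s j)).

Definition Qcomp (al : 'I_4 -> 'I_8) : sfun N := Qt N (fun i => D (al i)).

(** The symmetry conditions as differential equations on the coefficients of X: the
T-component and the D-components of [X, D_j], and L_X Q = mu Q. In this form they
are visibly linear in (X, a, b, m, mu). *)
Record symmetry_equations p (X : op M) (a : sfun N) (b : 'I_8 -> sfun N)
    (m : 'I_8 -> 'I_8 -> sfun N) (mu : sfun N) : Prop := SymmetryEquations {
  sym_par_a : par N p a;
  sym_par_b : forall i, par N (~~ p) (b i);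
  sym_comb : agree N X (frame_comb T D a b);
  sym_contact : forall j, \sum_i b i * H i j = (-1) ^+ p * D j a - a * t j;
  sym_matrix : forall j k, m j k = a * s j k + \sum_i b i * c i j k - (-1) ^+ p * D j (b k);
  sym_quartic : forall al, a * T (Qcomp al) + \sum_i b i * D i (Qcomp al)
    - \sum_(l < 4) \sum_k m (al l) k * Qcomp (replace al l k) = mu * Qcomp al }.

Lemma symmetry_equations_exist p X mu : is_vf N p X ->
  (forall j, C N (bracket p true X (D j))) ->
  (forall al, lie_tensor4 p X Qt N (fun=> true) (fun i => D (al i)) = mu * Qcomp al) ->
  exists a b m, symmetry_equations p X a b m mu.
Proof.
move=> Xvf Xcontact XQ; have [a [b [pa pb Xab]]] := frame_span fr Xvf.
have Bvf j : is_vf N (~~ p) (bracket p true X (D j)).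
  by have := vf_bracketP hS Xvf (frame_D fr j); rewrite addbT.
have /choice[m mP] j : exists m : 'I_8 -> sfun N, (forall k, par N p (m k)) /\
    agree N (bracket p true X (D j)) (contact_comb D m).
  have [m [pm Xm]] := (frame_contact fr (Bvf j)).1 (Xcontact j).
  by exists m; split=> // k; have := pm k; rewrite negbK.
have coef j := bracket_frame_comb hS oN fr pa pb Xab (ts j) (fun i => Hc i j).
have eqs j : (a * t j + \sum_i b i * H i j - (-1) ^+ p * D j a = 0) /\
    forall k, a * s j k + \sum_i b i * c i j k - (-1) ^+ p * D j (b k) - m j k = 0.
  apply: (frame_free fr oN NN) => W oW WN g.
  have e := coef j W oW WN g; rewrite (mP j).2 // in e.
  rewrite -(subrr (contact_comb D (m j) g)) {1}e /frame_comb /contact_comb -[RHS]addrA -[X in _ = _ + X]sumrB.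
  congr (_ + _); apply: eq_bigr => k _.
  by rewrite [res N W (_ - m j k)](resD hS oN oW WN) (resN hS) // mulrBl.
exists a, b, m; split=> //.
- move=> j; have [/eqP] := eqs j; rewrite addrAC addr_eq0 => /eqP e _.
  by rewrite -(opprK (\sum_i _)) -e opprB.
- by move=> j k; have [_ /(_ k)/eqP] := eqs j; rewrite subr_eq0 => /eqP ->.
move=> al; rewrite -XQ /lie_tensor4 Xab // /frame_comb (res_id hS) //; congr (_ + _ - _).
  by apply: eq_bigr => i _; rewrite (res_id hS).
apply: eq_bigr => l _.
have e : Qt N (subst_at (fun i => D (al i)) l (bracket p true X (D (al l)))) =
    Qt N (subst_at (fun i => D (al i)) l (contact_comb D (m (al l)))).
  have [pm Xm] := mP (al l).
  have Bs : section C N (~~ p) (bracket p true X (D (al l))) by split.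
  apply: (tensor_agree hS oN fr Qsym al l Bs) => //; split.
    exact: is_vf_agree Xm (Bvf _).
  apply/(frame_contact fr (is_vf_agree Xm (Bvf _))).
  by exists (m (al l)); split=> // k; rewrite negbK.
rewrite e (tensor_contact_comb hS oN fr Qsym al l (mP (al l)).1) mulr_sumr.
by apply: eq_bigr => k _; rewrite mulrA -expr2 sqrr_sign mul1r.
Qed.

Lemma symmetry_equations_lin p X X' a a' b b' m m' mu mu' z :
  symmetry_equations p X a b m mu -> symmetry_equations p X' a' b' m' mu' ->
  symmetry_equations p (fun W f => csec W z * X W f + X' W f) (csec N z * a + a')
    (fun i => csec N z * b i + b' i) (fun j k => csec N z * m j k + m' j k)
    (csec N z * mu + mu').
Proof.
move=> [pa pb ab e1 e2 e3] [pa' pb' ab' e1' e2' e3'].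
have scal r f : par N r f -> par N r (csec N z * f).
  by move=> rf; have := parM alg (par_csec alg z) rf.
have Dz j f g : D j (csec N z * f + g) = csec N z * D j f + D j g.
  by rewrite (vfD (frame_D fr j)) // (vf_csec (frame_D fr j)).
have sg f : (-1) ^+ p * (csec N z * f) = csec N z * ((-1) ^+ p * f) by rewrite sign_mulC.
split.
- by apply: (parD alg) => //; exact: scal.
- by move=> i; apply: (parD alg) => //; exact: scal.
- move=> W oW WN g; rewrite ab // ab' // /frame_comb mulrDr mulr_sumr addrACA -big_split /=.
  rewrite (resD hS) // (resM hS) // (res_csec hS) // mulrDl -mulrA; congr (_ + _).
  by apply: eq_bigr => i _; rewrite (resD hS) // (resM hS) // (res_csec hS) // mulrDl -mulrA.
- move=> j; rewrite Dz mulrDr sg mulrDl opprD addrACA -e1' -mulrA -mulrBr -e1 mulr_sumr -big_split.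
  by apply: eq_bigr => i _; rewrite mulrDl mulrA.
- move=> j k; rewrite e2 e2' Dz mulrBr !mulrDr mulrDl sg !mulr_sumr opprD.
  rewrite (_ : \sum_i (csec N z * b i + b' i) * c i j k =
     \sum_i csec N z * (b i * c i j k) + \sum_i b' i * c i j k); last first.
    by rewrite -big_split; apply: eq_bigr => i _; rewrite mulrDl mulrA.
  by rewrite !mulrA addrACA; congr (_ + _); rewrite addrACA.
move=> al; rewrite (mulrDl _ mu') -e3' -mulrA -e3 mulrBr mulrDr !mulr_sumr.
rewrite (_ : \sum_i (csec N z * b i + b' i) * D i (Qcomp al) =
   \sum_i csec N z * (b i * D i (Qcomp al)) + \sum_i b' i * D i (Qcomp al)); last first.
  by rewrite -big_split; apply: eq_bigr => i _; rewrite mulrDl mulrA.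
rewrite (_ : \sum_(l < 4) _ = \sum_(l < 4) csec N z * (\sum_k m (al l) k * Qcomp (replace al l k)) +
   \sum_(l < 4) \sum_k m' (al l) k * Qcomp (replace al l k)); last first.
  rewrite -big_split; apply: eq_bigr => l _; rewrite mulr_sumr -big_split.
  by apply: eq_bigr => k _; rewrite mulrDl mulrA.
by rewrite mulrDl -mulrA (addrACA _ (a' * T _)) opprD [LHS]addrACA.
Qed.

End SymmetryEquations.

(** * Fields that vanish to infinite order at a point *)

Section Kernel.
Variables (R : realType) (M : superspace R).
Hypothesis hS : presheaf_of_superalgebras M.
Variables (N : set M).
Variables (phi : M -> Cx R) (Phi : forall W : set M, sfun W -> {set 'I_8} -> Cx R -> Cx R).
Hypothesis chart : superchart N phi Phi.
Variables (C : superdistribution M) (T : op M) (D : 'I_8 -> op M).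
Variables (x : M) (Nx : N x).
Hypothesis fr : contact_frame C N T D.
Let oN : open N := chart_open chart.
Let NN : N `<=` N := @subset_refl _ N.
Let alg := algP hS oN.
Let ev := body_morphism chart Nx.

Fact frame_zmod i : zmod_morphism (@D i N).
Proof. by move=> f g; rewrite (vfB (frame_D fr i)). Qed.

Definition frame_additive i : {additive sfun N -> sfun N} :=
  HB.pack (@D i N) (GRing.isZmodMorphism.Build _ _ _ (frame_zmod i)).

Let ev_tw : forall f, ev (parity_twist f) = ev f := ev_twist hS chart Nx.

Let D_tw i f : parity_twist (frame_additive i f) = - frame_additive i (parity_twist f).
Proof. exact: (odd_vf_twist hS _ (frame_D fr i)). Qed.

Let D_mul i f g :
  frame_additive i (f * g) = frame_additive i f * g + parity_twist f * frame_additive i g.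
Proof. exact: (odd_vf_mul hS _ _ (frame_D fr i)). Qed.

Variables (H : 'I_8 -> 'I_8 -> sfun N) (c : 'I_8 -> 'I_8 -> 'I_8 -> sfun N).
Hypothesis Hc : forall i j, agree N (bracket true true (D i) (D j)) (frame_comb T D (H i j) (c i j)).
Variable tau : Cx R.
Hypothesis tau_neq0 : tau != 0.
Hypothesis ev_H : forall i j, ev (H i j) = tau * (levi i j)%:R.

Let D_comm i j f : frame_additive i (frame_additive j f) + frame_additive j (frame_additive i f) =
  H i j * @T N f + \sum_k c i j k * frame_additive k f.
Proof.
have := Hc i j oN NN f; rewrite /bracket /frame_comb expr1 mulN1r opprK => e.
rewrite [LHS]e (res_id hS) //; congr (_ + _).
by apply: eq_bigr => k _; rewrite (res_id hS).
Qed.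

Definition infinite_order (f : sfun N) := forall w, symbol ev frame_additive f w = 0.

Lemma infinite_orderD f g : infinite_order f -> infinite_order g -> infinite_order (f + g).
Proof. by move=> f0 g0 w; rewrite /symbol wordD rmorphD [X in X + _]f0 [X in _ + X]g0 addr0. Qed.

Lemma infinite_orderM g f : infinite_order f -> infinite_order (g * f).
Proof.
move=> f0 w; rewrite /symbol (ev_word_mul ev_tw D_mul) => [|v _]; last exact: f0.
by rewrite [X in _ * X]f0 mulr0.
Qed.

Lemma infinite_order_D i f : infinite_order f -> infinite_order (D i f).
Proof. by move=> f0 w; have := f0 (rcons w i); rewrite /symbol word_rcons. Qed.

Lemma infinite_order_T f : infinite_order f -> infinite_order (T f).
Proof.
move=> f0 w; apply: (vanish_T ev_tw D_mul D_comm ev_H tau_neq0 (k := (size w).+1)) => //.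
by move=> v _; exact: f0.
Qed.

Lemma infinite_order_vf p X f : is_vf N p X -> infinite_order f -> infinite_order (X N f).
Proof.
move=> Xvf f0; have [a [b [_ _ Xab]]] := frame_span fr Xvf.
rewrite Xab // /frame_comb; apply: infinite_orderD.
  by apply/infinite_orderM/infinite_order_T.
elim/big_ind: _ => [w|f1 f2|i _].
- by rewrite /symbol word0 rmorph0.
- exact: infinite_orderD.
- by apply/infinite_orderM/infinite_order_D.
Qed.

Lemma infinite_order_near0 f : infinite_order f ->
  exists V, [/\ open V, V x, V `<=` N & res N V f = 0].
Proof.
move=> f0; apply: (infinite_order_zero chart Nx (P := infinite_order)) => //.
- by move=> p X g; exact: infinite_order_vf.
- by move=> g /(_ [::]).
Qed.

Lemma infinite_order_vf_near0 X a b : agree N X (frame_comb T D a b) ->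
  infinite_order a -> (forall i, infinite_order (b i)) ->
  exists V, [/\ open V, V x, V `<=` N & agree V X (fun _ _ => 0)].
Proof.
move=> Xab a0 b0.
have [Va [oVa Vax VaN Va0]] := infinite_order_near0 a0.
have /choice[V VP] i := infinite_order_near0 (b0 i).
have Vx : nbhs x [set y | forall i, V i y].
  apply: (@filter_forall _ _ V) => i; have [oV Vx _ _] := VP i.
  exact: open_nbhs_nbhs.
pose W := Va `&` interior [set y | forall i, V i y].
have oW : open W by apply: openI => //; exact: open_interior.
have WN : W `<=` N by move=> y [/VaN].
exists W; split=> //.
move=> W' oW' W'W g; have W'N := subset_trans W'W WN.
rewrite Xab // /frame_comb -(res_comp hS _ oN oVa oW' VaN) => [|y /W'W[] //].
rewrite Va0 (res0 hS) // => [|y /W'W[] //]; rewrite mul0r add0r big1 // => i _.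
have [oV _ VN Vi0] := VP i.
have W'V : W' `<=` V i by move=> y /W'W[_ /interior_subset].
by rewrite -(res_comp hS _ oN oV oW' VN W'V) Vi0 (res0 hS) // mul0r.
Qed.

Lemma symbol_lin z f g w : symbol ev frame_additive (csec N z * f + g) w =
  z * symbol ev frame_additive f w + symbol ev frame_additive g w.
Proof.
rewrite /symbol wordD rmorphD; congr (_ + _).
have -> : word frame_additive w (csec N z * f) = csec N z * word frame_additive w f.
  by elim: w => //= i w ->; rewrite (vf_csec (frame_D fr i)).
by rewrite rmorphM; congr (_ * _); exact: (body_eval_csec chart).
Qed.

Lemma nonzero_symbol_near f w : symbol ev frame_additive f w != 0 ->
  exists V, [/\ open V, V x, V `<=` N & forall y V', V y -> open V' -> V' y -> V' `<=` N ->
    res N V' f != 0].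
Proof.
move=> fw; have [V [oV Vx VN V0]] := body_eval_neq0_near chart Nx fw.
exists V; split=> // y V' Vy oV' V'y V'N; apply: contra_neq (V0 y Vy) => f0.
have w0 : res N V' (word frame_additive w f) = 0.
  elim: w {fw V0} => //= i w IH.
  by rewrite [LHS](vf_res (frame_D fr i)) // IH (vf0 (frame_D fr i)).
have Vz : (phi @` V') (phi y) by exists y.
rewrite /body_eval -(chart_res chart _ _ oN NN oV' V'N Vz) w0.
exact: (chart0 chart).
Qed.

(** If some symbol of a coefficient of X is nonzero at x, it is nonzero near x, and a
neighbourhood of such a point on which X vanishes would make it zero. If there is
no such symbol, X vanishes near x. *)
Lemma vf_nonzero_near p X : is_vf N p X ->
  (forall V, open V -> V x -> ~ agree V X (fun _ _ => 0)) ->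
  exists V, [/\ open V, V x & forall y V', V y -> open V' -> V' y -> ~ agree V' X (fun _ _ => 0)].
Proof.
move=> Xvf X0; have [a [b [_ _ Xab]]] := frame_span fr Xvf.
have res_nz f : (forall V', open V' -> V' `<=` N -> agree V' X (fun _ _ => 0) -> res N V' f = 0) ->
    ~ infinite_order f ->
    exists V, [/\ open V, V x & forall y V', V y -> open V' -> V' y -> ~ agree V' X (fun _ _ => 0)].
  move=> f0 /existsNP[w /eqP /nonzero_symbol_near[V [oV Vx VN Vnz]]].
  exists V; split=> // y V' Vy oV' V'y V'0.
  have oVN : open (V' `&` N) by exact: openI.
  have Ny : N y by exact: VN.
  have VN0 : agree (V' `&` N) X (fun _ _ => 0) by apply: (agree_sub V'0) => z [].
  have VNN : V' `&` N `<=` N by move=> z [].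
  by have /eqP := Vnz y _ Vy oVN (conj V'y Ny) VNN; apply; exact: f0.
have coef0 V' : open V' -> V' `<=` N -> agree V' X (fun _ _ => 0) ->
    res N V' a = 0 /\ forall i, res N V' (b i) = 0.
  move=> oV' V'N V'0.
  apply: (frame_free fr oV' V'N) => W oW WV' g.
  rewrite -(V'0 W oW WV' g) Xab //; last exact: subset_trans V'N.
  rewrite /frame_comb (res_comp hS _ oN oV' oW V'N WV'); congr (_ + _).
  by apply: eq_bigr => i _; rewrite (res_comp hS _ oN oV' oW V'N WV').
have [a0|] := pselect (infinite_order a); last first.
  by apply: res_nz => V' oV' V'N V'0; have [] := coef0 V' oV' V'N V'0.
have [b0|/existsNP bi] := pselect (forall i, infinite_order (b i)); last first.
  by case: bi => i; apply: res_nz => V' oV' V'N V'0; have [_ ->] := coef0 V' oV' V'N V'0.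
have [V [oV Vx _ V0]] := infinite_order_vf_near0 Xab a0 b0.
by have := X0 V oV Vx V0.
Qed.

Section Symmetries.
Variables (t : 'I_8 -> sfun N) (s : 'I_8 -> 'I_8 -> sfun N) (Qt : tensor4 M).
Hypothesis ev_Q : forall al, ev (Qcomp N D Qt al) = quartic (Cx R) al.

Lemma symmetry_near0 p X a b m mu : symmetry_equations T D Qt H c t s p X a b m mu ->
  {in determining_words p, forall w, symbol ev frame_additive a w = 0} ->
  exists V, [/\ open V, V x, V `<=` N & agree V X (fun _ _ => 0)].
Proof.
move=> [pa pb Xab e1 e2 e3] w0.
have parity_a := parity_twist_par alg pa.
apply: (infinite_order_vf_near0 Xab).
  exact: (determining_words_eq0 ev_tw D_tw D_mul D_comm ev_H tau_neq0 e1 e2 e3 ev_Q parity_a w0).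
exact: (determining_words_eq0_b ev_tw D_tw D_mul D_comm ev_H tau_neq0 e1 e2 e3 ev_Q parity_a w0).
Qed.

End Symmetries.

End Kernel.

(** * Linear functionals that bound a dimension *)

Section Global.
Variables (R : realType) (M : superspace R).
Hypothesis hM : is_supermanifold M 8.
Let hS : presheaf_of_superalgebras M. Proof. by case: hM. Qed.

Lemma sheaf_zero (F : set (set M)) (f : sfun (\bigcup_(V in F) V)) :
  (forall V, F V -> open V) -> (forall V, F V -> res _ V f = 0) -> f = 0.
Proof.
move=> Fo f0; case: hM => _ _ sh _.
have VU V : F V -> V `<=` \bigcup_(V in F) V by move=> FV y Vy; exists V.
have oU : open (\bigcup_(V in F) V) by exact: bigcup_open.
have [|g [_ gu]] := sh F Fo (fun _ => 0).
  move=> V W FV FW; have oVW : open (V `&` W) by apply: openI; exact: Fo.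
  by rewrite (res0 hS (Fo _ FV) oVW) ?(res0 hS (Fo _ FW) oVW) // => z [].
rewrite -(gu f) // (gu 0) // => V FV.
by rewrite (res0 hS oU (Fo _ FV)) //; exact: VU.
Qed.

(** The value X f is glued from its restrictions, which are zero on a cover of W. *)
Lemma vf_locally_zero p X : is_vf setT p X ->
  (forall y : M, exists V, [/\ open V, V y & agree V X (fun _ _ => 0)]) ->
  agree setT X (fun _ _ => 0).
Proof.
move=> Xvf X0 W oW _ f; move: (X W f) (fun V => @vf_res _ _ _ W _ _ Xvf oW (@subsetT _ W) V f).
move=> g gres.
pose F := [set V : set M | [/\ open V, V `<=` W & agree V X (fun _ _ => 0)]].
have WE : W = \bigcup_(V in F) V.
  apply/seteqP; split=> [y Wy|y [V [_ VW _] /VW] //].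
  have [V [oV Vy V0]] := X0 y; exists (V `&` W); last by split.
  by split; [exact: openI|move=> z []|apply: (agree_sub V0) => z []].
have g0 V : F V -> res W V g = 0.
  by move=> [oV VW V0]; rewrite gres // V0.
have Fo V : F V -> open V by case.
(* The sheaf condition is about sections over the union itself, so W is replaced by
   the union; only then do the types agree. *)
clearbody F; subst W; exact: sheaf_zero g0.
Qed.

(** S stands for the symmetries and S' for the solutions of the symmetry equations
near a point. A spanning family has to be chosen in S, while linear combinations
are formed in S', which is cut out by linear equations. *)
Section DimensionBound.
Variables (S S' : op M -> Prop) (d : nat) (L : op M -> 'rV[Cx R]_d).
Let lin (z : Cx R) (X Y : op M) : op M := fun W f => csec W z * X W f + Y W f.
Hypothesis S_sub : forall X, S X -> S' X.
Hypothesis S_zero : S (fun _ _ => 0).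
Hypothesis L_zero : L (fun _ _ => 0) = 0.
Hypothesis S'_lin : forall z X Y, S' X -> S' Y -> S' (lin z X Y).
Hypothesis L_lin : forall z X Y, S' X -> S' Y -> L (lin z X Y) = z *: L X + L Y.
Hypothesis L_inj : forall X, S' X -> L X = 0 -> agree setT X (fun _ _ => 0).

(** Take v in S with the rank of the matrix of the L (v i) maximal. If L X were not in
its row space, a row that depends on the others could be replaced by L X, and the
rank would grow. *)
Lemma maximal_rank_rows : exists2 v : 'I_d -> op M, (forall i, S (v i)) &
  forall X, S X -> (L X <= \matrix_i L (v i))%MS.
Proof.
pose rk (v : 'I_d -> op M) := \rank (\matrix_i L (v i)).
suff [v Sv vmax] : exists2 v, (forall i, S (v i)) &
    forall w, (forall i, S (w i)) -> (rk w <= rk v)%N.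
  exists v => // X SX; apply: contraT => XnotV.
  set A := \matrix_i L (v i) in XnotV *.
  have [/eqP full|] := boolP (\rank A == d).
    have : row_full A by rewrite /row_full full.
    by rewrite -sub1mx => /(submx_trans (submx1 _)) h; rewrite h in XnotV.
  move=> nfull; have /rowV0Pn[u uA u0] : kermx A != 0.
    by rewrite kermx_eq0 /row_free.
  have [i0 ui0] : exists i, u 0 i != 0.
    apply/existsP; rewrite -negb_forall; apply: contra u0 => /forallP u0.
    by apply/eqP/rowP => i; rewrite mxE; apply/eqP; exact: u0.
  pose w i := if i == i0 then X else v i.
  have Sw i : S (w i) by rewrite /w; case: eqP.
  have := vmax w Sw; rewrite leqNgt /rk => /negP; case.
  set B := \matrix_i L (w i).
  have XB : (L X <= B)%MS.
    by rewrite (_ : L X = row i0 B) ?row_sub // rowK /w eqxx.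
  have AB : (A <= B)%MS.
    apply/row_subP => i; rewrite rowK; case: (eqVneq i i0) => [->|ii0]; last first.
      by rewrite (_ : L (v i) = row i B) ?row_sub // rowK /w (negPf ii0).
    have : u *m A = 0 by apply/sub_kermxP.
    rewrite mulmx_sum_row (bigD1 i0) //= rowK => /eqP; rewrite addr_eq0 => /eqP e.
    rewrite -[L (v i0)](scalerK ui0) e -sumrN scalemx_sub // summx_sub // => k kk0.
    rewrite -scaleNr scalemx_sub // rowK.
    by rewrite (_ : L (v k) = row k B) ?row_sub // rowK /w (negPf kk0).
  apply: rank_ltmx; rewrite /ltmx AB; apply: contra XnotV => BA.
  exact: submx_trans XB BA.
pose P k := `[< exists2 v, (forall i : 'I_d, S (v i)) & rk v = k >].
have exP : exists k, P k by exists (rk (fun _ _ _ => 0)); apply/asboolP; exists (fun _ _ _ => 0).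
have Pd k : P k -> (k <= d)%N by move=> /asboolP[v _ <-]; exact: rank_leq_row.
case: (ex_maxnP exP Pd) => k /asboolP[v Sv rv] kmax; exists v => // w Sw.
by rewrite rv; apply: kmax; apply/asboolP; exists w.
Qed.

Lemma dim_le_functional : dim_le S d.
Proof.
have [v Sv vX] := maximal_rank_rows; exists v; split=> // X SX.
have /submxP[u uE] := vX X SX.
exists (fun i => u 0 i).
have S'z : S' (fun _ _ => 0) by exact: S_sub.
have key (s : seq 'I_d) : S' (fun W f => - (\sum_(i <- s) csec W (u 0 i) * v i W f)) /\
    L (fun W f => - (\sum_(i <- s) csec W (u 0 i) * v i W f)) = - \sum_(i <- s) u 0 i *: L (v i).
  elim: s => [|i s [IHs IH]].
    have -> : (fun W (f : sfun W) => - (\sum_(i <- [::]) csec W (u 0 i) * v i W f)) = (fun _ _ => 0).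
      by apply/functional_extensionality_dep => W; apply/funext => f; rewrite big_nil oppr0.
    by rewrite big_nil oppr0.
  have -> : (fun W (f : sfun W) => - (\sum_(i <- i :: s) csec W (u 0 i) * v i W f)) =
      lin (- u 0 i) (v i) (fun W f => - (\sum_(i <- s) csec W (u 0 i) * v i W f)).
    apply/functional_extensionality_dep => W; apply/funext => f.
    by rewrite big_cons opprD /lin rmorphN mulNr.
  split; first by apply: S'_lin => //; exact: S_sub.
  by rewrite L_lin // ?IH; [rewrite big_cons opprD scaleNr|exact: S_sub].
have [S'sum Lsum] := key (index_enum _).
have X1 : agree setT X (lin 1 X (fun _ _ => 0)).
  by move=> W oW WT f; rewrite /lin rmorph1 mul1r addr0.
have := L_inj (S'_lin 1 (S_sub SX) S'sum).
rewrite L_lin //; last exact: S_sub.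
rewrite Lsum scale1r uE mulmx_sum_row.
under eq_bigr do rewrite rowK.
rewrite subrr => /(_ erefl) e W oW WT f.
by have := e W oW WT f; rewrite /lin rmorph1 mul1r => /eqP; rewrite subr_eq0 => /eqP.
Qed.

End DimensionBound.

End Global.

(** * The bound *)

Section Final.
Variables (R : realType) (M : superspace R) (C : superdistribution M) (Q : tensor4 M).
Hypothesis hM : is_supermanifold M 8.
Hypothesis hQ : odd_contact_F4 C Q.
Let hS : presheaf_of_superalgebras M. Proof. by case: hM. Qed.
Let Qsym : is_even_supersym4 C Q. Proof. by case: hQ. Qed.

Lemma conformal_coframe_sub U N om th : open U -> open N -> N `<=` U ->
  conformal_coframe C U om th -> conformal_coframe C N om th.
Proof.
move=> oU oN NU [co [sg [la [la' [[sgP sgC nd] la_even lala' dsg]]]]].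
have sub W : W `<=` N -> W `<=` U by move=> WN; exact: subset_trans NU.
split.
  by move=> i; have [omP thP] := co i; split=> W oW WN; [apply: omP|apply: thP] => //; exact: sub.
exists sg, (res U N la), (res U N la'); split.
- split.
  + by move=> W oW WN; apply: sgP => //; exact: sub.
  + by move=> W p X oW WN; apply: sgC => //; exact: sub.
  + by move=> W q al oW WN; apply: nd => //; exact: sub.
- exact: (res_par hS).
- by rewrite -(resM hS) // lala' (res1 hS).
move=> W p q X Y oW WN Xs Ys; rewrite (dsg W p q) //; last exact: sub.
by rewrite (res_comp hS).
Qed.

Lemma local_data x : exists N (phi : M -> Cx R)
    (Phi : forall W : set M, sfun W -> {set 'I_8} -> Cx R -> Cx R) T (D : 'I_8 -> op M) om th,
  [/\ N x, superchart N phi Phi, contact_frame C N T D, conformal_coframe C N om th &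
    forall Y, (forall i, section C N true (Y i)) -> Q N Y = F4_quartic om th N (fun=> true) Y].
Proof.
case: hM => _ _ _ /(_ x)[U1 [phi [Phi [U1x ch]]]].
case: hQ => -[[_ /(_ x)[U2 [T [D [oU2 U2x fr Cfr]]]]] _] _ /(_ x)[U3 [om [th [oU3 U3x cf QF]]]].
have oU1 := chart_open ch.
pose N := U1 `&` U2 `&` U3.
have oN : open N by apply: openI => //; exact: openI.
have N1 : N `<=` U1 by move=> y [[]].
have N2 : N `<=` U2 by move=> y [[]].
have N3 : N `<=` U3 by move=> y [].
have sub W : W `<=` N -> W `<=` U2 by move=> WN; exact: subset_trans N2.
exists N, phi, Phi, T, D, om, th; split=> //.
- exact: (chart_sub ch N1 oN).
- apply: vf_frame_contact_frame => //.
    case: fr => Tvf Dvf span; split; first exact: is_vf_sub Tvf _.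
      by move=> i; exact: is_vf_sub (Dvf i) _.
    by move=> W p X oW WN; apply: span => //; exact: sub.
  by move=> W p X oW WN; apply: Cfr => //; exact: sub.
- exact: (conformal_coframe_sub oU3 oN N3 cf).
- by move=> Y Ys; apply: QF.
Qed.

Lemma agree_zero_contact W p X : open W -> is_vf W p X -> agree W X (fun _ _ => 0) -> C W X.
Proof.
move=> oW Xvf X0; case: hQ => -[[loc fr] _] _ _; apply/(loc W p X oW Xvf) => x Wx.
have [U [T [D [oU Ux _ Cfr]]]] := fr x.
have oWU : open (W `&` U) by exact: openI.
have WU_W : W `&` U `<=` W by move=> y [].
exists (W `&` U); split=> //.
have Xvf' : is_vf (W `&` U) p X by exact: is_vf_sub Xvf WU_W.
apply/(Cfr _ _ _ oWU _ Xvf') => [y []//|]; exists (fun _ => 0) => V oV VW g.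
rewrite X0 //; last exact: subset_trans WU_W.
by rewrite big1 // => i _; rewrite (res0 hS) // mul0r.
Qed.

(** That the zero operator preserves Q needs Q to vanish when one argument is the zero
field, which follows from additivity. *)
Lemma zero_symmetry p : symmetry C Q p (fun _ _ => 0).
Proof.
have z (W : set M) (q : bool) : is_vf W q (fun (V : set M) (_ : sfun V) => 0) by exact: vf_zero.
have B0 (W : set M) (q : bool) (Y : op M) : is_vf W q Y ->
    agree W (bracket p q (fun _ _ => 0) Y) (fun _ _ => 0).
  by move=> Yvf V oV VW f; rewrite /bracket (vf0 Yvf) // mulr0 subr0.
have Bs (W : set M) (q : bool) (Y : op M) : open W -> section C W q Y ->
    section C W (p (+) q) (bracket p q (fun _ _ => 0) Y).
  move=> oW [Yvf _]; have Bvf := vf_bracketP hS (z W p) Yvf; split=> //.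
  exact: (agree_zero_contact oW Bvf (B0 _ _ _ Yvf)).
split=> //.
  by move=> W q Y oW Ys; have [] := Bs W q Y oW Ys.
exists 0 => W r Y oW Ys.
rewrite (res0 hS openT oW (@subsetT _ W)) mul0r /lie_tensor4 sub0r big1 ?oppr0 // => i _.
set Z := bracket _ _ _ _.
have Zs : section C W (p (+) r i) Z by exact: Bs.
pose r' j := if j == i then p (+) r i else r j.
have Ys' j : section C W (r' j) (subst_at Y i Z j).
  by rewrite /r' /subst_at; case: eqP => // ->.
have r'i : r' i = p (+) r i by rewrite /r' eqxx.
have [inv _ _ [add _] _] := Qsym oW Ys'.
have Zs2 : section C W (r' i) Z by rewrite r'i.
have Z0 : agree W Z (fun _ _ => 0) by apply: (B0 _ (r i)); case: (Ys i).
have ZZ : agree W (vf_add Z Z) Z.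
  by move=> V oV VW f; rewrite /vf_add (Z0 V oV VW) addr0.
have ZZs : section C W (p (+) r i) (vf_add Z Z).
  have vf2 := vf_addP hS Zs.1 Zs.1; split=> //.
  exact: (agree_zero_contact oW vf2 (agree_trans ZZ Z0)).
have e : Q W (subst_at Y i (vf_add Z Z)) = Q W (subst_at Y i Z).
  apply/esym/inv => [j|j]; rewrite /subst_at ?/r'; case: eqP => // _.
  exact: agree_sym.
have := add i Z Zs2; rewrite !subst_at_id.
rewrite (_ : subst_at Y i Z i = Z) ?e; last by rewrite /subst_at eqxx.
by move=> /eqP; rewrite -{1}(addr0 (Q W _)) => /eqP/addrI <-; rewrite mulr0.
Qed.

Lemma vf_lin p z X Y : is_vf (@setT M) p X -> is_vf setT p Y ->
  is_vf setT p (fun W f => csec W z * X W f + Y W f).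
Proof.
move=> Xvf Yvf.
have zXvf := vf_smulP hS openT (par_csec (algP hS openT) z) Xvf.
apply: (is_vf_agree _ (vf_addP hS zXvf Yvf)) => W oW _ f.
by rewrite /vf_add /vf_smul (res_csec hS openT).
Qed.

(** The set of points near which X vanishes is open by definition, and closed by
vf_nonzero_near at a point of its complement. *)
Lemma identity_theorem p (X : op M) (x : M) : connected [set: M] -> is_vf setT p X ->
  (exists V, [/\ open V, V x & agree V X (fun _ _ => 0)]) -> agree setT X (fun _ _ => 0).
Proof.
move=> cM Xvf X0; apply: (vf_locally_zero hM Xvf).
pose B := [set y : M | exists V, [/\ open V, V y & agree V X (fun _ _ => 0)]].
suff BT : B = [set: M] by move=> y; have : B y by rewrite BT.
apply: cM; first by exists x.
  exists B; last by rewrite setTI.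
  rewrite openE => y [V [oV Vy V0]]; apply: (filterS _ (open_nbhs_nbhs (conj oV Vy))) => u Vu.
  by exists V.
exists B; last by rewrite setTI.
rewrite -openC openE => y By.
have [N [phi [Phi [T [D0 [om [th [Ny ch fr0 cf _]]]]]]]] := local_data y.
have XvfN := is_vf_sub Xvf (@subsetT _ N).
have [D [fr adapted]] := adapted_frame_exists hS ch cf Ny fr0.
have [H [c [pH pc Hc]]] := structure_functions hS fr.
have [tau tau0 evH] := ev_levi hS cf fr adapted pH pc Hc.
have [|V [oV Vy Vnz]] := vf_nonzero_near hS fr Hc tau0 evH XvfN.
  by move=> V oV Vy V0; apply: By; exists V.
apply: (filterS _ (open_nbhs_nbhs (conj oV Vy))) => u Vu [W [oW Wu W0]].
exact: (Vnz u W Vu oW Wu W0).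
Qed.

(** A symmetry is sent to the symbols, at one point, of its coefficient a; this is
well defined since the expansion in the frame is unique. *)
Lemma symmetry_dim p : connected [set: M] -> dim_le (symmetry C Q p) (size (determining_words p)).
Proof.
move=> cM; have [/eqP M0|] := boolP ([set: M] == set0).
  apply: (@dim_le_functional _ _ _ (is_vf setT p) _ (fun _ => 0)) => //.
  - by move=> X [].
  - exact: zero_symmetry.
  - by move=> z X Y; exact: vf_lin.
  - by move=> z X Y _ _; rewrite scaler0 addr0.
  - move=> X Xvf _; apply: (vf_locally_zero hM Xvf) => y.
    by have : [set: M] y by []; rewrite M0.
move=> /set0P[x _].
have [N [phi [Phi [T [D0 [om [th [Nx ch fr0 cf QF]]]]]]]] := local_data x.
have oN := chart_open ch.
have [D [fr adapted]] := adapted_frame_exists hS ch cf Nx fr0.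
have [H [c [pH pc Hc]]] := structure_functions hS fr.
have [t [s ts]] := transverse_functions hS fr.
have [tau tau0 evH] := ev_levi hS cf fr adapted pH pc Hc.
have evQ al : body_morphism ch Nx (Qcomp N D Q al) = quartic (Cx R) al.
  by rewrite /Qcomp QF; [exact: (ev_quartic adapted)|move=> i; exact: (frame_section hS oN fr)].
pose sol X a := exists b m mu, symmetry_equations T D Q H c t s p X a b m mu.
pose S' X := is_vf setT p X /\ exists a, sol X a.
pose coef X := xget 0 [set a | sol X a].
have solU X a a' : sol X a -> sol X a' -> a = a'.
  move=> [b [m [mu [_ _ ab _ _ _]]]] [b' [m' [mu' [_ _ ab' _ _ _]]]].
  have [] := frame_free fr (a := a - a') (b := fun i => b i - b' i) oN (@subset_refl _ N).
    move=> W oW WN g; rewrite -(subrr (X W g)) {1}ab // ab' // /frame_comb.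
    rewrite (resD hS) // (resN hS) // mulrBl opprD addrACA -sumrB; congr (_ + _).
    by apply: eq_bigr => i _; rewrite (resD hS) // (resN hS) // mulrBl.
  by move=> /eqP; rewrite subr_eq0 => /eqP.
pose L X : 'rV[Cx R]_(size (determining_words p)) :=
  \row_i symbol (body_morphism ch Nx) (frame_additive ch fr) (coef X) (nth [::] (determining_words p) i).
have coefE X a : sol X a -> coef X = a.
  move=> Xa; rewrite /coef; case: xgetP => [a' _ Xa'|/(_ a)//]; exact: solU Xa' Xa.
apply: (@dim_le_functional _ _ _ S' _ L).
- move=> X [Xvf XC [mu Xmu]]; split=> //.
  have XvfN := is_vf_sub Xvf (@subsetT _ N).
  have [||a [b [m ab]]] := symmetry_equations_exist hS oN fr Qsym Hc ts (mu := res setT N mu) XvfN.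
  + by move=> j; apply: XC => //; exact: (frame_section hS oN fr).
  + by move=> al; apply: Xmu => // i; exact: (frame_section hS oN fr).
  by exists a, b, m, (res setT N mu).
- exact: zero_symmetry.
- have [Zvf ZC [mu Zmu]] := zero_symmetry p.
  have ZvfN := is_vf_sub Zvf (@subsetT _ N).
  have [||a [b [m ab]]] := symmetry_equations_exist hS oN fr Qsym Hc ts (mu := res setT N mu) ZvfN.
  + by move=> j; apply: ZC => //; exact: (frame_section hS oN fr).
  + by move=> al; apply: Zmu => // i; exact: (frame_section hS oN fr).
  have Za : sol (fun _ _ => 0) a by exists b, m, (res setT N mu).
  have [_ _ Zab _ _ _] := ab.
  have [a0 _] : a = 0 /\ forall i, b i = 0.
    by apply: (frame_free fr oN (@subset_refl _ N)) => W oW WN g; rewrite -Zab.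
  apply/rowP => i; rewrite !mxE (coefE _ _ Za) a0 /symbol word0 rmorph0; reflexivity.
- move=> z X Y [Xvf [a [b [m [mu ab]]]]] [Yvf [a' [b' [m' [mu' ab']]]]].
  split; first exact: vf_lin.
  exists (csec N z * a + a'), (fun i => csec N z * b i + b' i).
  exists (fun j k => csec N z * m j k + m' j k), (csec N z * mu + mu').
  exact: (symmetry_equations_lin hS oN fr z ab ab').
- move=> z X Y [Xvf [a [b [m [mu ab]]]]] [Yvf [a' [b' [m' [mu' ab']]]]].
  rewrite /L (coefE X a); last by exists b, m, mu.
  rewrite (coefE Y a'); last by exists b', m', mu'.
  rewrite (coefE _ (csec N z * a + a')); last first.
    exists (fun i => csec N z * b i + b' i).
    exists (fun j k => csec N z * m j k + m' j k), (csec N z * mu + mu').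
    exact: (symmetry_equations_lin hS oN fr z ab ab').
  by apply/rowP => i; rewrite !mxE; exact: symbol_lin.
- move=> X [Xvf [a [b [m [mu ab]]]]] /rowP L0.
  apply: (identity_theorem cM Xvf (x := x)).
  have aE : coef X = a by apply: coefE; exists b, m, mu.
  have a0 : {in determining_words p, forall w,
      symbol (body_morphism ch Nx) (frame_additive ch fr) a w = 0}.
    move=> w /(nthP [::])[k kt <-].
    by have := L0 (Ordinal kt); rewrite !mxE aE.
  have [V [oV Vx _ V0]] := symmetry_near0 hS Hc tau0 evH evQ ab a0.
  by exists V.
Qed.

End Final.

Theorem theorem6p7 (R : realType) (M : superspace R)
  (hM : is_supermanifold M 8) (cM : connected [set: M])
  (C : superdistribution M) (Q : tensor4 M) (hQ : odd_contact_F4 C Q) :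
  sdim_le (symmetry C Q) sdim_F4.
Proof.
(* The lists of determining words have 24 and 16 elements by computation. *)
by split; [exact: (symmetry_dim hM hQ false cM)|exact: (symmetry_dim hM hQ true cM)].
Qed.
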